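(* Let $l$ be a prime, $L$ a number field, and let $(V_{\mathbb Z},s,\rho)$ be an $(\infty,l)$-integral structure. Let $M\subset\mathrm{GL}(V_{\mathbb Q})$ be the Mumford–Tate group of $s$, and assume that $U_l:=\rho(\mathrm{Gal}(\overline L/L))$ is an open subgroup of $M(\mathbb Q_l)$. Then the $l$-isogeny class of $(V_{\mathbb Z},s,\rho)$ is a union of finitely many isomorphism classes.
   Context: $\mathbb S=\mathrm{Res}_{\mathbb C/\mathbb R}\mathbb G_{m,\mathbb C}$. Fix a number field $L$ and a prime $l$. An $(\infty,l)$-integral structure $(V_{\mathbb Z},s,\rho)$ on a finite-dimensional $\mathbb Q$-vector space $V_{\mathbb Q}$ consists of a lattice $V_{\mathbb Z}\subset V_{\mathbb Q}$, a polarised $\mathbb Z$-Hodge structure $s:\mathbb S\to\mathrm{GL}(V_{\mathbb R})$, and a continuous representation $\rho:\mathrm{Gal}(\overline L/L)\to\mathrm{GL}(V_{\mathbb Z_l})$, such that $\mathrm{End}_{\mathbb Z\text{-}HS}(V_{\mathbb Z})\otimes\mathbb Z_l\subset\mathrm{End}_{\mathrm{Gal}(\overline L/L)}(V_{\mathbb Z_l})$. Convention: $L$ is large enough that the Zariski closure of the image of $\rho\otimes\mathbb Q_l$ in $\mathrm{GL}(V_{\mathbb Q_l})$ is connected. The Mumford–Tate group of $s$ is the smallest $\mathbb Q$-subgroup $M$ of $\mathrm{GL}(V_{\mathbb Q})$ such that $s$ factors through $M_{\mathbb R}$; it is connected reductive. An isogeny $(V_{\mathbb Z},s,\rho)\to(V'_{\mathbb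 Z},s',\rho')$ (with $V_{\mathbb Z}\otimes\mathbb Q=V'_{\mathbb Z}\otimes\mathbb Q=V_{\mathbb Q}$) is an $\alpha\in\mathrm{GL}(V_{\mathbb Q})$ inducing a morphism of $\mathbb Z$-Hodge structures $V_{\mathbb Z}\to V'_{\mathbb Z}$ and such that $\alpha\otimes\mathbb Z_l$ is a morphism of Galois representations; it is an $l$-isogeny if $|V'_{\mathbb Z}/\alpha V_{\mathbb Z}|$ is a power of $l$, and an isomorphism if $\alpha V_{\mathbb Z}=V'_{\mathbb Z}$. The $l$-isogeny class of a structure is the set of structures related to it by an $l$-isogeny. *)

(* Defs.v *)
From HB Require Import structures.
From mathcomp Require Import all_boot all_order all_algebra all_field.
From mathcomp Require Import boolp classical_sets functions cardinality reals.
From mathcomp Require Import mpoly.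

Set Implicit Arguments.
Unset Strict Implicit.
Unset Printing Implicit Defensive.

Import Order.TTheory GRing.Theory Num.Theory.

Local Open Scope classical_set_scope.
Local Open Scope ring_scope.

Lemma modz_dvdm m n d : (d %| m)%Z -> ((n %% m)%Z = n %[mod d])%Z.
Proof.
by case/dvdzP=> q ->; rewrite {2}(divz_eq n (q * d)) mulrA modzMDl.
Qed.

(* An l-adic integer is the compatible sequence of its residues in
   [0, l ^ k), i.e. an element of the inverse limit of the Z / l ^ k. *)
Record Zadic (l : nat) (hl : prime l) := MkZadic {
  zres :> nat -> int ;
  zresP : forall k, zres k = (zres k.+1 %% (l ^ k)%N)%Z }.

HB.instance Definition _ l hl := gen_eqMixin (@Zadic l hl).
HB.instance Definition _ l hl := gen_choiceMixin (@Zadic l hl).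

Section ZadicRing.
Variables (l : nat) (hl : prime l).
Local Notation Zl := (Zadic hl).
Implicit Types x y z : Zl.

Lemma zadic_ext x y : zres x =1 zres y -> x = y.
Proof.
case: x y => [f fP] [g gP] /= /funext fg; case: _ / fg in gP *.
by congr MkZadic; apply: Prop_irrelevance.
Qed.

Lemma zres_mod x k : (x k %% (l ^ k)%N)%Z = x k.
Proof. by rewrite {1}zresP modz_mod -zresP. Qed.

Fact zadic_subproof (f : nat -> int)
    (hf : forall k, (f k.+1 %% (l ^ k)%N = f k %% (l ^ k)%N)%Z) k :
  (f k %% (l ^ k)%N = (f k.+1 %% (l ^ k.+1)%N)%Z %% (l ^ k)%N)%Z.
Proof. by rewrite modz_dvdm ?hf// dvdzE/= expnS dvdn_mull. Qed.

Definition zadic_of f hf : Zl := MkZadic hl (@zadic_subproof f hf).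

Fact zadic_add_subproof x y k :
  ((x k.+1 + y k.+1) %% (l ^ k)%N = (x k + y k) %% (l ^ k)%N)%Z.
Proof. by rewrite (zresP x k) (zresP y k) modzDm. Qed.
Fact zadic_opp_subproof x k : ((- x k.+1) %% (l ^ k)%N = (- x k) %% (l ^ k)%N)%Z.
Proof. by rewrite (zresP x k) modzNm. Qed.
Fact zadic_mul_subproof x y k :
  ((x k.+1 * y k.+1) %% (l ^ k)%N = (x k * y k) %% (l ^ k)%N)%Z.
Proof. by rewrite (zresP x k) (zresP y k) modzMm. Qed.

Definition zadic_int (m : int) : Zl := @zadic_of (fun=> m) (fun=> erefl).
Definition zadic_add x y : Zl := zadic_of (zadic_add_subproof x y).
Definition zadic_opp x : Zl := zadic_of (zadic_opp_subproof x).
Definition zadic_mul x y : Zl := zadic_of (zadic_mul_subproof x y).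

Fact zadic_addA : associative zadic_add.
Proof. by move=> x y z; apply: zadic_ext => k /=; rewrite modzDmr modzDml addrA. Qed.
Fact zadic_addC : commutative zadic_add.
Proof. by move=> x y; apply: zadic_ext => k /=; rewrite addrC. Qed.
Fact zadic_add0 : left_id (zadic_int 0) zadic_add.
Proof. by move=> x; apply: zadic_ext => k /=; rewrite modzDml add0r zres_mod. Qed.
Fact zadic_addN : left_inverse (zadic_int 0) zadic_opp zadic_add.
Proof. by move=> x; apply: zadic_ext => k /=; rewrite modzDml addNr. Qed.

HB.instance Definition _ := GRing.isZmodule.Build Zl
  zadic_addA zadic_addC zadic_add0 zadic_addN.

Fact zadic_mulA : associative zadic_mul.
Proof. by move=> x y z; apply: zadic_ext => k /=; rewrite modzMmr modzMml mulrA. Qed.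
Fact zadic_mulC : commutative zadic_mul.
Proof. by move=> x y; apply: zadic_ext => k /=; rewrite mulrC. Qed.
Fact zadic_mul1 : left_id (zadic_int 1) zadic_mul.
Proof. by move=> x; apply: zadic_ext => k /=; rewrite modzMml mul1r zres_mod. Qed.
Fact zadic_mulDl : left_distributive zadic_mul +%R.
Proof.
by move=> x y z; apply: zadic_ext => k /=; rewrite modzMml modzDm mulrDl.
Qed.
Fact zadic_1neq0 : zadic_int 1 != 0.
Proof.
apply/eqP => /(congr1 (fun x : Zl => x 1%N)) /=.
by rewrite mod0z !modz_small //= expn1 ltz_nat prime_gt1.
Qed.

HB.instance Definition _ := GRing.Zmodule_isComNzRing.Build Zl
  zadic_mulA zadic_mulC zadic_mul1 zadic_mulDl zadic_1neq0.

Definition zadic_unit : pred Zl := fun x => `[< exists y, y * x = 1 >].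
Definition zadic_inv x : Zl :=
  if pselect (exists y, y * x = 1) is left h then projT1 (cid h) else x.

Fact zadic_mulVx : {in zadic_unit, left_inverse 1 zadic_inv *%R}.
Proof.
move=> x /asboolP h; rewrite /zadic_inv; case: pselect => // h'.
exact: (projT2 (cid h')).
Qed.
Fact zadic_unitP x y : y * x = 1 -> zadic_unit x.
Proof. by move=> h; apply/asboolP; exists y. Qed.
Fact zadic_inv_out : {in [predC zadic_unit], zadic_inv =1 id}.
Proof.
move=> x /=; rewrite inE => /asboolPn h.
by rewrite /zadic_inv; case: pselect.
Qed.

HB.instance Definition _ := GRing.ComNzRing_hasMulInverse.Build Zl
  zadic_mulVx zadic_unitP zadic_inv_out.

Lemma zres_modD x k m : (x (k + m)%N %% (l ^ k)%N)%Z = x k.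
Proof.
elim: m => [|m IH]; first by rewrite addn0 zres_mod.
rewrite -IH addnS (zresP x (k + m)%N) modz_dvdm //.
by rewrite dvdzE /= dvdn_exp2l // leq_addr.
Qed.

Lemma zadic_neq0 x : x != 0 -> exists k, x k != 0.
Proof.
move=> /eqP x0; apply: contrapT => h; apply: x0; apply: zadic_ext => k.
rewrite /= mod0z; apply: contrapT => hk; apply: h; exists k; exact/eqP.
Qed.

Lemma ldvd_mul (a b : nat) k m : (l ^ (k + m) %| a * b)%N ->
  (l ^ k %| a)%N || (l ^ m %| b)%N.
Proof.
case: (posnP a) => [->|a0]; first by rewrite dvdn0.
case: (posnP b) => [->|b0]; first by rewrite dvdn0 orbT.
rewrite !pfactor_dvdn ?muln_gt0 ?a0 // lognM //.
apply: contraLR; rewrite negb_or -!ltnNge => /andP[h1 h2].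
by rewrite -addSn leq_add // ltnW.
Qed.

Fact zadic_idomain x y : x * y = 0 -> (x == 0) || (y == 0).
Proof.
move=> xy; apply: contraT; rewrite negb_or => /andP[/zadic_neq0[k xk]].
move=> /zadic_neq0[m ym].
have /= := congr1 (fun x : Zl => x (k + m)%N) xy.
rewrite mod0z => /dvdz_mod0P; rewrite dvdzE abszM /= => /ldvd_mul/orP[h|h].
  have /dvdz_mod0P : ((l ^ k)%N %| x (k + m)%N)%Z by rewrite dvdzE.
  by rewrite zres_modD => /eqP; rewrite (negPf xk).
have /dvdz_mod0P : ((l ^ m)%N %| y (m + k)%N)%Z by rewrite dvdzE addnC.
by rewrite zres_modD => /eqP; rewrite (negPf ym).
Qed.

HB.instance Definition _ := GRing.ComUnitRing_isIntegral.Build Zl zadic_idomain.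

Lemma zadic_char0 n : (n.+1)%:R != 0 :> Zl.
Proof.
have E m : m%:R = zadic_int m%:Z.
  elim: m => [|m IH]; first by [].
  rewrite -addn1 natrD IH; apply: zadic_ext => k /=.
  by rewrite modzDm -PoszD.
rewrite E; apply/eqP => /(congr1 (fun x : Zl => x n.+1)) /=.
rewrite mod0z modz_small // ltz_nat; apply: ltn_expl; exact: prime_gt1.
Qed.

End ZadicRing.

Definition Qadic (l : nat) (hl : prime l) : fieldType := {fraction (Zadic hl)}.

Definition Zadic_to_Qadic (l : nat) (hl : prime l) : Zadic hl -> Qadic hl :=
  @tofrac (Zadic hl).
HB.instance Definition _ l hl := GRing.RMorphism.on (@Zadic_to_Qadic l hl).

Definition rat_to_Qadic (l : nat) (hl : prime l) : rat -> Qadic hl := ratr.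

Section RatToQadic.
Variables (l : nat) (hl : prime l).
Local Notation iQ := (@rat_to_Qadic l hl).

Lemma qadic_int_neq0 (m : int) : m != 0 -> m%:~R != 0 :> Qadic hl.
Proof.
have H p : (p.+1)%:R != 0 :> Qadic hl.
  by rewrite -(rmorph_nat (@Zadic_to_Qadic l hl)) tofrac_eq0 zadic_char0.
by case: m => [[|p]|p] // _; [exact: H | rewrite NegzE mulrNz oppr_eq0; exact: H].
Qed.

Lemma qadic_den_neq0 x : (denq x)%:~R != 0 :> Qadic hl.
Proof. by rewrite qadic_int_neq0 // denq_neq0. Qed.

Lemma rat_to_QadicE (a b : int) : b != 0 ->
  iQ (a%:~R / b%:~R) = a%:~R / b%:~R.
Proof.
move=> b0; set x := _ / _; rewrite /rat_to_Qadic /ratr.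
apply/eqP; rewrite eqr_div ?qadic_den_neq0 ?qadic_int_neq0 // -!intrM.
suff -> : numq x * b = a * denq x by [].
apply/eqP; rewrite -(eqr_int rat) !intrM -eqr_div ?intr_eq0 ?denq_neq0 //.
by rewrite divq_num_den.
Qed.

Fact rat_to_Qadic_is_zmod_morphism : zmod_morphism iQ.
Proof.
move=> x y; rewrite -[in LHS](divq_num_den x) -[in LHS](divq_num_den y).
rewrite -mulNr addf_div ?intr_eq0 ?denq_neq0 // -!intrM -mulrNz -!intrM -intrD.
rewrite rat_to_QadicE ?mulf_neq0 ?denq_neq0 // /rat_to_Qadic /ratr -mulNr.
by rewrite addf_div ?qadic_den_neq0 // intrD !intrM mulrNz.
Qed.

Fact rat_to_Qadic_is_monoid_morphism : monoid_morphism iQ.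
Proof.
split=> [|x y]; first by rewrite /rat_to_Qadic /ratr divr1.
rewrite -[in LHS](divq_num_den x) -[in LHS](divq_num_den y).
rewrite mulf_div -!intrM rat_to_QadicE ?mulf_neq0 ?denq_neq0 //.
by rewrite /rat_to_Qadic /ratr mulf_div !intrM.
Qed.

HB.instance Definition _ := GRing.isZmodMorphism.Build rat (Qadic hl) iQ
  rat_to_Qadic_is_zmod_morphism.
HB.instance Definition _ := GRing.isMonoidMorphism.Build rat (Qadic hl) iQ
  rat_to_Qadic_is_monoid_morphism.

End RatToQadic.

(* The Z_l-span in M_(m, n)(Q_l) of a set of rational matrices.  For a finitely
   generated subgroup X of M_(m, n)(Q) this is X (x) Z_l. *)
Definition Zl_span (l : nat) (hl : prime l) m n (X : set 'M[rat]_(m, n)) :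
    set 'M[Qadic hl]_(m, n) :=
  [set y | exists k (c : 'I_k -> Zadic hl) (x : 'I_k -> 'M[rat]_(m, n)),
    (forall i, X (x i)) /\
    y = \sum_(i < k) Zadic_to_Qadic (c i) *: map_mx (@rat_to_Qadic l hl) (x i)].
Arguments Zl_span {l} hl {m n} X.

(* A = B modulo l ^ k: the basic neighbourhoods of the l-adic topology. *)
Definition adic_close (l : nat) (hl : prime l) m n (k : nat)
    (A B : 'M[Qadic hl]_(m, n)) : Prop :=
  exists C : 'M[Zadic hl]_(m, n),
    A - B = (l ^ k)%:R *: map_mx (@Zadic_to_Qadic l hl) C.

Definition adic_open_in (l : nat) (hl : prime l) n
    (U X : set 'M[Qadic hl]_n) : Prop :=
  U `<=` X /\
  forall u, U u -> exists k, forall x, X x -> adic_close k x u -> U x.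

(* Regular functions on GL_n are polynomials in the entries up to powers of
   the determinant, so polynomials suffice to cut out closed subschemes. *)
Definition entries (A : comNzRingType) n (g : 'M[A]_n) : 'I_(n * n) -> A :=
  fun i => mxvec g 0 i.

Definition gl_points n (I : set {mpoly rat[n * n]}) (A : comUnitRingType)
    (phi : {rmorphism rat -> A}) : set 'M[A]_n :=
  [set g | g \in unitmx /\ forall f, I f -> mmap phi (entries g) f = 0].

(* Algebraic subgroups of GL_n over Q, through their functor of points. *)
Record Qsubgroup n := MkQsubgroup {
  equations :> set {mpoly rat[n * n]} ;
  points1 : forall (A : comUnitRingType) (phi : {rmorphism rat -> A}),
    gl_points equations phi 1%:M ;
  pointsM : forall (A : comUnitRingType) (phi : {rmorphism rat -> A}) g h,
    gl_points equations phi g -> gl_points equations phi h ->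
    gl_points equations phi (g *m h) ;
  pointsV : forall (A : comUnitRingType) (phi : {rmorphism rat -> A}) g,
    gl_points equations phi g -> gl_points equations phi (invmx g) }.

Definition sub_Qsubgroup n (G H : Qsubgroup n) : Prop :=
  forall (A : comUnitRingType) (phi : {rmorphism rat -> A}),
    gl_points G phi `<=` gl_points H phi.

(* S = Res_{C/R} G_m: S(A) is the group of units of A (x) C, where (a, b)
   stands for a + b i, which is a unit iff a ^ 2 + b ^ 2 is. *)
Definition S_norm (A : comUnitRingType) (z : A * A) : A := z.1 ^+ 2 + z.2 ^+ 2.
Definition S_mul (A : comUnitRingType) (z w : A * A) : A * A :=
  (z.1 * w.1 - z.2 * w.2, z.1 * w.2 + z.2 * w.1).
Definition S_points (A : comUnitRingType) : set (A * A) :=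
  [set z | S_norm z \is a GRing.unit].

(* Value at (a, b) of the matrix of regular functions num / (a^2 + b^2)^den. *)
Definition S_eval (R : realType) n (num : 'M[{mpoly R[2]}]_n) (den : nat)
    (A : comUnitAlgType R) (z : A * A) : 'M[A]_n :=
  (S_norm z) ^- den *:
  map_mx (mmap (in_alg A) (fun i : 'I_2 => if i == 0 then z.1 else z.2)) num.

(* Morphisms of algebraic groups S -> GL_n over R. *)
Record S_rep (R : realType) n := MkSRep {
  S_num : 'M[{mpoly R[2]}]_n ;
  S_den : nat ;
  S_val := S_eval S_num S_den ;
  S_val1 : forall A : comUnitAlgType R, S_val (1 : A, 0 : A) = 1%:M ;
  S_valM : forall (A : comUnitAlgType R) (z w : A * A),
    S_points z -> S_points w -> S_val (S_mul z w) = S_val z *m S_val w }.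

Definition rat_in_alg (R : realType) (A : comUnitAlgType R) : rat -> A :=
  in_alg A \o ratr.
HB.instance Definition _ (R : realType) (A : comUnitAlgType R) :=
  GRing.RMorphism.on (@rat_in_alg R A).

Definition factors_through (R : realType) n (s : S_rep R n) (M : Qsubgroup n) :
    Prop :=
  forall (A : comUnitAlgType R) (z : A * A), S_points z ->
    gl_points M (@rat_in_alg R A) (S_val s z).

Definition is_Mumford_Tate (R : realType) n (s : S_rep R n) (M : Qsubgroup n) :
    Prop :=
  factors_through s M /\
  forall H : Qsubgroup n, factors_through s H -> sub_Qsubgroup M H.

Definition is_lattice n (Lam : set 'cV[rat]_n) : Prop :=
  exists b : 'M[rat]_n, b \in unitmx /\
    Lam = [set b *m map_mx intr x | x in [set: 'cV[int]_n]].

(* psi is a polarisation of the Z-Hodge structure (Lam, s), which is pure: t in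
   G_m acts as t ^ w, so w is plus or minus the weight according to the
   convention for s.  The choice between s(i) and its inverse as Weil operator
   is immaterial too, up to the sign of psi. *)
Record is_polarisation (R : realType) n (Lam : set 'cV[rat]_n) (s : S_rep R n)
    (w : int) (psi : 'M[rat]_n) : Prop := {
  pol_int : forall x y, Lam x -> Lam y ->
    (x^T *m psi *m y) 0 0 \is a Num.int ;
  pol_pure : forall (A : comUnitAlgType R) (t : A), t \is a GRing.unit ->
    S_val s (t, 0) = (t ^ w)%:M ;
  pol_mor : forall (A : comUnitAlgType R) (z : A * A), S_points z ->
    (S_val s z)^T *m map_mx (@rat_in_alg R A) psi *m S_val s z =
    (S_norm z) ^ w *: map_mx (@rat_in_alg R A) psi ;
  pol_form := map_mx ratr psi *m S_val s (0 : R^o, 1 : R^o) : 'M[R]_n ;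
  pol_sym : pol_form^T = pol_form ;
  pol_pos : forall x : 'cV[R]_n, x != 0 -> 0 < (x^T *m pol_form *m x) 0 0 }.

Definition hodge_mor (R : realType) n (Lam : set 'cV[rat]_n) (s : S_rep R n)
    (Lam' : set 'cV[rat]_n) (s' : S_rep R n) (a : 'M[rat]_n) : Prop :=
  (forall x, Lam x -> Lam' (a *m x)) /\
  forall (A : comUnitAlgType R) (z : A * A), S_points z ->
    map_mx (@rat_in_alg R A) a *m S_val s z =
    S_val s' z *m map_mx (@rat_in_alg R A) a.

Record Gal (L E : fieldType) (iota : {rmorphism L -> E}) := MkGal {
  gal_fun :> {rmorphism E -> E} ;
  gal_bij : bijective gal_fun ;
  gal_fix : forall x, gal_fun (iota x) = iota x }.

Section GalGroup.
Variables (L E : fieldType) (iota : {rmorphism L -> E}).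
Implicit Types sigma tau : Gal iota.

Definition gal_id : Gal iota :=
  @MkGal _ _ iota idfun (Bijective (fun=> erefl) (fun=> erefl)) (fun=> erefl).

Fact gal_comp_fix sigma tau x : (sigma \o tau) (iota x) = iota x.
Proof. by rewrite /= !gal_fix. Qed.

Definition gal_comp sigma tau : Gal iota :=
  @MkGal _ _ iota (sigma \o tau) (bij_comp (gal_bij sigma) (gal_bij tau))
    (gal_comp_fix sigma tau).
End GalGroup.

(* Continuous representations Gal(E / L) -> GL(Lam (x) Z_l), for the Krull
   topology on the source; GL(Lam (x) Z_l) is the stabiliser in GL_n(Q_l) of
   the Z_l-lattice Lam (x) Z_l. *)
Record is_gal_rep (L E : fieldType) (iota : {rmorphism L -> E})
    (l : nat) (hl : prime l) n (Lam : set 'cV[rat]_n)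
    (rho : Gal iota -> 'M[Qadic hl]_n) : Prop := {
  rho_unit : forall sigma, rho sigma \in unitmx ;
  rho_stab : forall sigma,
    mulmx (rho sigma) @` Zl_span hl Lam = Zl_span hl Lam ;
  rho1 : rho (gal_id iota) = 1%:M ;
  rhoM : forall sigma tau,
    rho (gal_comp sigma tau) = rho sigma *m rho tau ;
  rho_cont : forall (sigma : Gal iota) (k : nat), exists X : seq E, forall tau : Gal iota,
    {in X, tau =1 sigma} -> adic_close k (rho tau) (rho sigma) }.

Definition gal_mor (L E : fieldType) (iota : {rmorphism L -> E})
    (l : nat) (hl : prime l) n
    (Lam : set 'cV[rat]_n) (rho : Gal iota -> 'M[Qadic hl]_n)
    (Lam' : set 'cV[rat]_n) (rho' : Gal iota -> 'M[Qadic hl]_n)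
    (f : 'M[Qadic hl]_n) : Prop :=
  (forall x, Zl_span hl Lam x -> Zl_span hl Lam' (f *m x)) /\
  forall sigma, f *m rho sigma = rho' sigma *m f.

Definition zariski_closed (F : fieldType) n (X : set 'M[F]_n) : Prop :=
  exists I : set {mpoly F[n * n]},
    X = [set g | g \in unitmx /\ forall f, I f -> meval (entries g) f = 0].

Definition zariski_closure (F : fieldType) n (X : set 'M[F]_n) :
    set 'M[F]_n := smallest (@zariski_closed F n) X.

Definition zariski_connected (F : fieldType) n (X : set 'M[F]_n) : Prop :=
  forall Y Z : set 'M[F]_n, zariski_closed Y -> zariski_closed Z ->
    X `<=` Y `|` Z -> X `&` (Y `&` Z) = set0 -> X `<=` Y \/ X `<=` Z.

(* (infinity, l)-integral structures on V_Q = Q^n, satisfying the convention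
   that L is large enough.  For the closure of a subgroup of GL_n(Q_l),
   connectedness of the group scheme is that of its set of Q_l-points. *)
Record infl_structure (R : realType) (L E : fieldType)
    (iota : {rmorphism L -> E}) (l : nat) (hl : prime l) (n : nat) :=
  MkInfl {
  lat : set 'cV[rat]_n ;
  hdg : S_rep R n ;
  hdg_wt : int ;
  hdg_pol : 'M[rat]_n ;
  galrep : Gal iota -> 'M[Qadic hl]_n ;
  latP : is_lattice lat ;
  polP : is_polarisation lat hdg hdg_wt hdg_pol ;
  galP : is_gal_rep lat galrep ;
  end_sub : Zl_span hl [set a | hodge_mor lat hdg lat hdg a] `<=`
            [set f | gal_mor lat galrep lat galrep f] ;
  gal_connected : zariski_connected (zariski_closure (range galrep)) }.

Section Isogenies.
Variables (R : realType) (L E : fieldType) (iota : {rmorphism L -> E}).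
Variables (l : nat) (hl : prime l) (n : nat).
Implicit Types (V W : infl_structure R iota hl n) (a : 'M[rat]_n).

Definition isogeny V W a : Prop :=
  [/\ a \in unitmx,
      hodge_mor (lat V) (hdg V) (lat W) (hdg W) a &
      gal_mor (lat V) (galrep V) (lat W) (galrep W)
        (map_mx (@rat_to_Qadic l hl) a)].

(* The set of cosets of X in Y. *)
Definition cosets (Y X : set 'cV[rat]_n) : set (set 'cV[rat]_n) :=
  [set [set y + x | x in X] | y in Y].

Definition l_isogeny V W a : Prop :=
  isogeny V W a /\
  exists k : nat, (cosets (lat W) (mulmx a @` lat V) #= `I_(l ^ k))%card.

Definition isomorphism V W a : Prop :=
  isogeny V W a /\ mulmx a @` lat V = lat W.

Definition l_isogeny_class V : set (infl_structure R iota hl n) :=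
  [set W | exists a, l_isogeny V W a].

Definition isomorphism_class V : set (infl_structure R iota hl n) :=
  [set W | exists a, isomorphism V W a].
End Isogenies.

(* Main.v *)
(* Pulling lattices back along isogenies from [V] identifies the structures in
   the l-isogeny class with certain lattices in V_Q that are stable under U_l,
   and an automorphism of V_Q in the commutant of the Hodge structure carrying
   one such lattice to another is an isomorphism.  Let Y in End(V_R) be the
   derivative of s along the circle and b_1, ..., b_d in End(V_Q) its rational
   components.  The b_i lie in Lie M because the equations of M are rational, so
   exp(l^j b_i) is an l-adic point of M, in U_l for large j since U_l is open;
   letting j grow, b_i is in the Q_l-span of U_l.  Hence multiples of the b_i,
   independent of the lattice, preserve all lattices in question.  The
   commutant of the b_i is that of s, and the polarisation makes V_Q a
   semisimple module over the b_i, so the Jordan-Zassenhaus theorem concludes.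
   It is proved here by rescaling a simple module so that the shortest vector of
   the lattice has length 1, completing that vector to a basis of bounded
   vectors, and splitting extensions with bounded denominators. *)

From HB Require Import structures.
Require Import Defs.
From mathcomp Require Import all_boot all_order all_algebra all_field.
From mathcomp Require Import boolp classical_sets functions cardinality reals.
From mathcomp Require Import mpoly.
From mathcomp Require Import ring lra zify.

Set Implicit Arguments.
Unset Strict Implicit.
Unset Printing Implicit Defensive.

Import Order.TTheory GRing.Theory Num.Theory.

Local Open Scope classical_set_scope.
Local Open Scope ring_scope.

(** * Lattices and Jordan-Zassenhaus *)

(** Exponentials enter only algebraically. Points of [M] are known ring by ring: products of
    [1 + eps_i X] over iterated dual numbers give the exponential over a nilpotent ring, and this
    forces every coefficient of an equation of [M] along the formal curve [exp(T X)] to vanish; only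
    then is [T] specialised to a power of [l]. On the Hodge side the circle is never integrated:
    differentiating the homomorphism law gives a recursion that builds all coefficients of [s] from
    scalars and [Y]. All denominators must be uniform over the isogeny class. The multiple [N] of
    the [b_i] depends on the starting structure alone, because an [l]-isogeny changes nothing away
    from [l], while at [l] stability comes from Galois. The inclusion of endomorphism rings enters
    when an automorphism found in the commutant of [s] has to commute with Galois as well. *)

Notation intmx := (mxOver Num.int).

Section IntMx.
Variables m n : nat.
Implicit Types A : 'M[rat]_(m, n).

Lemma intmx_natZ (k : nat) A : A \is a intmx -> k%:R *: A \is a intmx.
Proof. by apply: mxOverZ; rewrite natr_int. Qed.

Lemma intmxB A B : A \is a intmx -> B \is a intmx -> A - B \is a intmx.
Proof.
by move=> /mxOverP hA /mxOverP hB; apply/mxOverP => i j; rewrite !mxE rpredB.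
Qed.

Lemma common_denominator A : exists2 e : nat, (0 < e)%N & e%:R *: A \is a intmx.
Proof.
exists (\prod_(p : 'I_m * 'I_n) absz (denq (A p.1 p.2)))%N.
  by apply/prodn_gt0 => p; rewrite absz_gt0 denq_neq0.
apply/mxOverP => i j; rewrite mxE (bigD1 (i, j)) //= natrM mulrAC.
apply: rpredM; last exact: natr_int.
rewrite pmulrn absz_denq mulrC; apply/intrP; exists (numq (A i j)).
by rewrite -{1}[A i j]divq_num_den mulfVK // intr_eq0 denq_neq0.
Qed.
End IntMx.

Lemma intmxM m n p (A : 'M[rat]_(m, n)) (B : 'M[rat]_(n, p)) :
  A \is a intmx -> B \is a intmx -> A *m B \is a intmx.
Proof. exact: mxOverM. Qed.

(** * Entrywise bounds and simultaneous approximation *)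

Section Bounded.

Definition bounded_mx m n (c : rat) (A : 'M[rat]_(m, n)) :=
  forall i j, `|A i j| <= c.

Lemma bounded_mx_le m n c e (A : 'M[rat]_(m, n)) :
  c <= e -> bounded_mx c A -> bounded_mx e A.
Proof. by move=> ce h i j; apply: le_trans ce. Qed.

Lemma bounded_mxM m n p c e (A : 'M[rat]_(m, n)) (B : 'M[rat]_(n, p)) :
  bounded_mx c A -> bounded_mx e B -> bounded_mx (n%:R * (c * e)) (A *m B).
Proof.
move=> hA hB i j; rewrite mxE (le_trans (ler_norm_sum _ _ _)) //.
rewrite mulr_natl -[n in leRHS]card_ord -sumr_const.
by apply: ler_sum => k _; rewrite normrM ler_pM.
Qed.

Lemma exists_bounded_mx m n (A : 'M[rat]_(m, n)) : exists c : nat, bounded_mx c%:R A.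
Proof.
pose B := \sum_i \sum_j `|A i j|.
exists (Num.bound B) => i j.
have B0 : 0 <= B by apply: sumr_ge0 => ? _; apply: sumr_ge0.
apply: le_trans (ltW (archi_boundP B0)).
rewrite /B (bigD1 i) //= (bigD1 j) //= -addrA lerDl addr_ge0 ?sumr_ge0 //.
by move=> *; apply: sumr_ge0.
Qed.

Lemma exists_bounded_mx_fam n d (b : 'I_d -> 'M[rat]_n) :
  exists c : nat, forall i, bounded_mx c%:R (b i).
Proof.
have /choice[c hc] : forall i, exists c : nat, bounded_mx c%:R (b i).
  by move=> i; exact: exists_bounded_mx.
exists (\sum_i c i)%N => i; apply: bounded_mx_le (hc i).
by rewrite ler_nat (bigD1 i) //= leq_addr.
Qed.

(* Dirichlet's pigeonhole: among the first multiples of [c] modulo [Z^n], two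
   fall in the same cell of side 1/2. *)
Lemma dirichlet_approx (n B : nat) : exists2 K : nat, (0 < K)%N &
  forall (c : 'rV[rat]_n) (W : 'M[rat]_n), bounded_mx B%:R W ->
  exists (m : nat) (z : 'rV[rat]_n), [/\ (0 < m <= K)%N, z \is a intmx,
    forall k, `|((m%:R *: c - z) *m W) 0 k| < 2^-1 &
    bounded_mx 1 (m%:R *: c - z)].
Proof.
pose nB : nat := (n * B)%N.
pose F : finType := {ffun 'I_n -> 'I_(4 * nB).+1}.
exists #|F|.
  by apply/card_gt0P; exists [ffun=> ord0].
move=> c W hW.
pose fl (x : 'rV[rat]_n) := map_mx (fun x => (Num.floor x)%:~R) x : 'rV[rat]_n.
have flint x : fl x \is a intmx by apply/mxOverP => i j; rewrite mxE intr_int.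
pose fr (m : nat) : 'rV[rat]_n := m%:R *: c - fl (m%:R *: c).
have fr01 m i k : 0 <= fr m i k < 1.
  rewrite /fr /fl !mxE subr_ge0 floor_le /= ltrBlDl -(intrD _ _ 1).
  exact: floorD1_gt.
pose y (m : nat) : 'rV[rat]_n := fr m *m W.
have hy m k : `|y m 0 k| <= nB%:R.
  have fr1 : bounded_mx 1 (fr m).
    by move=> i j; have /andP[h0 /ltW h1] := fr01 m i j; rewrite ger0_norm.
  have := bounded_mxM fr1 hW.
  by move=> /(_ 0 k); rewrite mul1r -natrM.
(* The coordinates of [y m] lie between [-nB] and [nB]; shifted by [nB] and doubled, their floors
   lie between 0 and [4 * nB]. There are [#|F|] cells and [#|F|.+1] multiples including 0, so the
   difference of two multiples in one cell is at most [#|F|]. *)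
pose cell m : F := [ffun k => inord (absz (Num.floor (2 * (y m 0 k + nB%:R))))].
have [inj|] := boolP (injectiveb (fun m : 'I_#|F|.+1 => cell m)).
  have := max_card (mem (codom (fun m : 'I_#|F|.+1 => cell m))).
  by rewrite card_codom ?card_ord ?ltnn //; apply/injectiveP.
have cellP m (k : 'I_n) : (absz (Num.floor (2 * (y m 0 k + nB%:R))%R) < (4 * nB).+1)%N /\
    0 <= Num.floor (2 * (y m 0 k + nB%:R)).
  have := hy m k; rewrite ler_norml => /andP[h1 h2].
  have f0 : 0 <= Num.floor (2 * (y m 0 k + nB%:R)).
    by rewrite floor_ge0 mulr_ge0 // -lerBlDr sub0r.
  split=> //; rewrite ltnS -lez_nat gez0_abs //.
  rewrite -(ler_int rat) (le_trans (floor_le _)) //.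
  rewrite (_ : (Posz (4 * nB))%:~R = 4%:R * nB%:R); first by lra.
  by rewrite -natrM.
have key (p q : nat) : (p < q)%N -> (q < #|F|.+1)%N -> cell p = cell q ->
  exists (m : nat) (z : 'rV[rat]_n), [/\ (0 < m <= #|F|)%N, z \is a intmx,
    forall k, `|((m%:R *: c - z) *m W) 0 k| < 2^-1 &
    bounded_mx 1 (m%:R *: c - z)].
  move=> pq qF epq.
  exists (q - p)%N, (fl (q%:R *: c) - fl (p%:R *: c)).
  have -> : (q - p)%:R *: c - (fl (q%:R *: c) - fl (p%:R *: c)) = fr q - fr p.
    by rewrite natrB 1?ltnW // scalerBl /fr !opprD !opprK addrACA.
  split.
  - by rewrite subn_gt0 pq /= (leq_trans (leq_subr _ _)).
  - exact: intmxB.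
  - move=> k; rewrite mulmxBl mxE [X in _ + X]mxE.
    have /ffunP/(_ k) := epq; rewrite !ffunE => /(congr1 (@nat_of_ord _)).
    have [c1 p1] := cellP p k; have [c2 p2] := cellP q k.
    rewrite !inordK // => /(congr1 Posz); rewrite !gez0_abs //.
    set u := 2 * _; set v := 2 * _ => euv.
    have := floor_le u; have := floorD1_gt u.
    have := floor_le v; have := floorD1_gt v; rewrite euv !intrD.
    move: (_%:~R) => f.
    rewrite -/(y q) -/(y p) /u /v.
    move: (y p 0 k) (y q 0 k) (nB%:R) => a1 a2 a3 h1 h2 h3 h4.
    by rewrite ltr_norml; apply/andP; split; lra.
  - move=> i k; rewrite mxE [X in _ + X]mxE.
    have := fr01 p i k; have := fr01 q i k; move: (fr p i k) (fr q i k) => a1 a2.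
    by move=> /andP[? ?] /andP[? ?]; rewrite ler_norml; apply/andP; split; lra.
case/injectivePn => p [q pq /= epq].
case: (ltngtP p q) => [lt|lt|/val_inj e]; last by rewrite e eqxx in pq.
  exact: key lt (ltn_ord _) epq.
exact: key lt (ltn_ord _) (esym epq).
Qed.
End Bounded.

(** * Lattices sandwiched between multiples of the standard one *)

Definition subgroup_set (T : zmodType) (L : set T) : Prop :=
  forall x y, L x -> L y -> L (x - y).

Definition sandwiched n (D : nat) (L : set 'rV[rat]_n) : Prop :=
  (forall x, x \is a intmx -> L (D%:R *: x)) /\
  (forall x, L x -> D%:R *: x \is a intmx).

Definition stable n d (b : 'I_d -> 'M[rat]_n) (L : set 'rV[rat]_n) : Prop :=
  forall i x, L x -> L (x *m b i).

Definition lattice n (L : set 'rV[rat]_n) : Prop :=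
  subgroup_set L /\ exists2 D : nat, (0 < D)%N & sandwiched D L.

Definition commutes n d (b : 'I_d -> 'M[rat]_n) (t : 'M[rat]_n) : Prop :=
  forall i, t *m b i = b i *m t.

(* This yields the finiteness of Jordan and Zassenhaus, since only finitely many
   lattices lie between [D Z^n] and [D^-1 Z^n]. *)
Definition bounded_lattices n d (b : 'I_d -> 'M[rat]_n) : Prop :=
  exists2 D : nat, (0 < D)%N &
  forall L, lattice L -> stable b L ->
  exists t, [/\ t \in unitmx, commutes b t & sandwiched D [set x | L (x *m t)]].

Section Subgroup.
Variables (T : lmodType rat) (L : set T).
Hypotheses (subL : subgroup_set L) (L0 : L 0).

Lemma subgroupN x : L x -> L (- x).
Proof. by move=> Lx; rewrite -sub0r; apply: subL. Qed.

Lemma subgroupD x y : L x -> L y -> L (x + y).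
Proof. by move=> Lx Ly; rewrite -[y]opprK; apply: subL => //; exact: subgroupN. Qed.

Lemma subgroup_sum (I : Type) (r : seq I) (P : pred I) (F : I -> T) :
  (forall i, P i -> L (F i)) -> L (\sum_(i <- r | P i) F i).
Proof. by move=> h; apply: big_ind => //; exact: subgroupD. Qed.

Lemma subgroupZnat (k : nat) x : L x -> L (k%:R *: x).
Proof.
move=> Lx; elim: k => [|k IH]; first by rewrite scale0r.
by rewrite -add1n natrD scalerDl scale1r; apply: subgroupD.
Qed.

Lemma subgroupZint (k : rat) x : k \is a Num.int -> L x -> L (k *: x).
Proof.
move=> /intrP[[m|m] ->] Lx; first exact: subgroupZnat.
by rewrite NegzE mulrNz scaleNr; apply: subgroupN; apply: subgroupZnat.
Qed.
End Subgroup.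

Lemma sandwiched0 n D (L : set 'rV[rat]_n) : sandwiched D L -> L 0.
Proof. by move=> [h _]; rewrite -(scaler0 _ D%:R); apply: h; apply: mxOver0. Qed.

Lemma lattice0 n (L : set 'rV[rat]_n) : lattice L -> L 0.
Proof. by case=> _ [D _ /sandwiched0]. Qed.

Lemma subgroup_mulmx m n (L : set 'rV[rat]_n) (z : 'rV[rat]_m) (W : 'M[rat]_(m, n)) :
  subgroup_set L -> L 0 -> z \is a intmx -> (forall j, L (row j W)) -> L (z *m W).
Proof.
move=> subL L0 /mxOverP hz hW; rewrite mulmx_sum_row.
by apply: subgroup_sum => // i _; apply: subgroupZint.
Qed.

Lemma sandwiched_mull n D e (L : set 'rV[rat]_n) :
  subgroup_set L -> sandwiched D L -> sandwiched (e * D) L.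
Proof.
move=> subL sDL; have L0 := sandwiched0 sDL; case: sDL => h1 h2; split => x hx.
  by rewrite natrM -scalerA; apply: subgroupZnat => //; apply: h1.
by rewrite natrM -scalerA; apply: intmx_natZ; apply: h2.
Qed.

Lemma subgroup_preim n m (L : set 'rV[rat]_n) (t : 'M[rat]_(m, n)) :
  subgroup_set L -> subgroup_set [set x | L (x *m t)].
Proof. by move=> h x y /= Lx Ly; rewrite mulmxBl; apply: h. Qed.

(** A one-sided inverse is enough: [t] embeds row vectors, so this covers both a change of basis and
    the intersection with a coordinate subspace. The denominators of [t] and [t'] multiply the
    sandwiching constant. *)
Lemma lattice_preim n m (L : set 'rV[rat]_n) (t : 'M[rat]_(m, n)) (t' : 'M[rat]_(n, m)) :
  t *m t' = 1%:M -> lattice L -> lattice [set x | L (x *m t)].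
Proof.
move=> tt' [subL [D D0 sDL]]; split; first exact: subgroup_preim.
have L0 := sandwiched0 sDL; case: sDL => h1 h2.
have [e e0 he] := common_denominator t; have [f f0 hf] := common_denominator t'.
exists (e * f * D)%N; first by rewrite !muln_gt0 e0 f0.
split=> x /= hx.
  have -> : (e * f * D)%:R *: x *m t = D%:R *: (f%:R *: (x *m (e%:R *: t))).
    rewrite -scalemxAr -scalemxAl !scalerA -!natrM.
    by congr (_%:R *: _); ring.
  by apply: h1; apply: intmx_natZ; apply: intmxM.
have -> : (e * f * D)%:R *: x = e%:R *: ((D%:R *: (x *m t)) *m (f%:R *: t')).
  rewrite -scalemxAl -scalemxAr -mulmxA tt' mulmx1 !scalerA -!natrM.
  by congr (_%:R *: _); ring.
by apply: intmx_natZ; apply: intmxM => //; apply: h2.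
Qed.

(** * Simple modules *)

Section Simple.
Variables (n d : nat) (b : 'I_d -> 'M[rat]_n).
Hypothesis n_gt0 : (0 < n)%N.
Hypothesis simple_b : forall U : 'M[rat]_n, (forall i, (U *m b i <= U)%MS) ->
  U = 0 \/ row_full U.

(** Start from [v]. As long as the rows of [W] span a proper subspace, simplicity says that it is
    not stable, so some row of some [W *m b i] leaves it and is adjoined. Each step multiplies the
    bound by at most [C], so [B] does not depend on the lattice. *)
Lemma bounded_frame : exists B : nat, forall (L : set 'rV[rat]_n) v,
  stable b L -> L v -> v != 0 -> bounded_mx 1 v ->
  exists W : 'M[rat]_n, [/\ W \in unitmx, bounded_mx B%:R W & forall j, L (row j W)].
Proof.
have [c hc] := exists_bounded_mx_fam b.
pose C : nat := (n * c).+1.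
exists (C ^ n)%N => L v stL Lv v0 bv.
suff key r : (r < n)%N -> exists W : 'M[rat]_(r.+1, n),
    [/\ row_free W, bounded_mx (C ^ r.+1)%:R W & forall j, L (row j W)].
  have e : n.-1.+1 = n by rewrite prednK.
  have [W] := key n.-1 (eq_leq e).
  by move: W; rewrite e => W [h1 h2 h3]; exists W; rewrite -row_free_unit.
elim: r => [_|r IH rn].
  exists v; split.
  - by rewrite /row_free rank_rV v0.
  - by apply: bounded_mx_le bv; rewrite expn1 ler1n.
  - by move=> j; rewrite row_id.
have [W [fW bW LW]] := IH (ltnW rn).
have [i [j hij]] : exists i j, ~~ (row j (W *m b i) <= W)%MS.
  apply: contrapT => h.
  (* [simple_b] speaks of square matrices, hence [<<W>>]. *)
  have st i : (<<W>>%MS *m b i <= <<W>>)%MS.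
    rewrite !(eqmxMr _ (genmxE _)) genmxE; apply/row_subP => j.
    by apply: contrapT => h'; apply: h; exists i, j; apply/negP.
  have rW : \rank W = r.+1 by apply/eqP.
  case: (simple_b st) => [/(congr1 mxrank)|]; first by rewrite genmxE mxrank0 rW.
  by rewrite /row_full genmxE rW => /eqP e; rewrite e ltnn in rn.
exists (col_mx (row j (W *m b i)) W); split.
- apply/inj_row_free => x; rewrite -(@hsubmxK _ 1 1 r.+1 x) (@mul_row_col _ 1 1 r.+1 n).
  set a := lsubmx _; set w := rsubmx _.
  have [a0|a0] := eqVneq (a 0 0) 0.
    have -> : a = 0 by apply/rowP => k; rewrite ord1 a0 mxE.
    rewrite mul0mx add0r => /eqP; rewrite mulmx_free_eq0 // => /eqP->.
    by rewrite row_mx0.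
  move=> /eqP; rewrite addr_eq0 => /eqP e; case/negP: hij.
  have -> : row j (W *m b i) = (a 0 0)^-1 *: (a *m row j (W *m b i)).
    by rewrite {2}[a]mx11_scalar mul_scalar_mx scalerA mulVf // scale1r.
  by rewrite e scalemx_sub // eqmx_opp submxMl.
- have -> : (C ^ r.+2)%:R = (C ^ r.+1 * C)%:R :> rat by rewrite -expnSr.
  move=> k q; rewrite mxE; case: (@fintype.split 1 r.+1 k) => k'.
    rewrite mxE; apply: le_trans (bounded_mxM bW (hc i) _ _) _.
    by rewrite -!natrM ler_nat mulnCA leq_mul // /C.
  by apply: le_trans (bW _ _) _; rewrite ler_nat leq_pmulr.
- move=> k; rewrite -(@fintype.splitK 1 r.+1 k); case: (@fintype.split 1 r.+1 k) => k' /=.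
    by rewrite (@rowKu _ 1 r.+1) row_id row_mul; apply: stL.
  by rewrite (@rowKd _ 1 r.+1).
Qed.

End Simple.

(** [E] makes [L] integral, so the sup norms of its vectors are multiples of [1 / E] and a nonzero
    vector of least norm exists; [s = N / E] is this least norm. *)
Lemma short_vector n (L : set 'rV[rat]_n) : (0 < n)%N -> lattice L ->
  exists (s : rat) (v : 'rV[rat]_n), [/\ s != 0, L (s *: v), v != 0, bounded_mx 1 v &
    forall x, L (s *: x) -> (forall k, `|x 0 k| < 1) -> x = 0].
Proof.
move=> n0 [subL [E E0 [hE1 hE2]]].
have Er : (E%:R : rat) != 0 by rewrite pnatr_eq0 -lt0n.
pose P N := `[< exists x, [/\ L x, x != 0 & forall k, `|E%:R * x 0 k| <= N%:R] >].
have exP : exists N, P N.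
  pose x := E%:R *: delta_mx 0 (Ordinal n0) : 'rV[rat]_n.
  have [N hN] := exists_bounded_mx (E%:R *: x).
  exists N; apply/asboolP; exists x; split.
  - apply: hE1; apply/mxOverP => i j; rewrite !mxE.
    by case: (_ && _); rewrite ?rpred1 ?rpred0.
  - rewrite scaler_eq0 (negPf Er) /=; apply/eqP => /matrixP /(_ 0 (Ordinal n0)).
    by rewrite !mxE !eqxx => /eqP; rewrite oner_eq0.
  - by move=> k; have := hN 0 k; rewrite mxE.
case: (ex_minnP exP) => N /asboolP [x [Lx x0 hx]] minN.
have N0 : (0 < N)%N.
  rewrite lt0n; apply/eqP => N0; move/eqP: x0; apply; apply/rowP => k; rewrite mxE.
  have := hx k; rewrite N0 normr_le0 mulf_eq0 (negPf Er) /= => /eqP //.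
have Nr : (N%:R : rat) != 0 by rewrite pnatr_eq0 -lt0n.
have s0 : N%:R / E%:R != 0 :> rat by rewrite mulf_neq0 ?invr_eq0.
exists (N%:R / E%:R), ((N%:R / E%:R)^-1 *: x); split=> //.
- by rewrite scalerA divff // scale1r.
- by rewrite scaler_eq0 invr_eq0 negb_or s0.
- move=> i k; rewrite ord1 mxE invf_div mulrAC normrM normfV normr_nat.
  by rewrite ler_pdivrMr ?ltr0n // mul1r.
- move=> y Ly hy; apply: contrapT => /eqP y0.
  (* For the vector [s y] of [L], [E s y_k = N y_k] is an integer of absolute value below [N],
     against the minimality of [N]. *)
  have /minN : P N.-1.
    apply/asboolP; exists (N%:R / E%:R *: y); split=> //.
      by rewrite scaler_eq0 negb_or s0.
    move=> k; have /mxOverP /(_ 0 k) := hE2 _ Ly.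
    rewrite !mxE mulrA [E%:R * _]mulrC mulfVK // => hint.
    have /natrP[m em] := natr_norm_int hint; rewrite em ler_nat.
    have : `|N%:R * y 0 k| < N%:R.
      by rewrite normrM normr_nat gtr_pMr ?hy // ltr0n.
    by rewrite em ltr_nat; case: (N) N0.
  by rewrite leqNgt ltn_predL N0.
Qed.

Section Simple.
Variables (n d : nat) (b : 'I_d -> 'M[rat]_n).
Hypothesis n_gt0 : (0 < n)%N.
Hypothesis simple_b : forall U : 'M[rat]_n, (forall i, (U *m b i <= U)%MS) ->
  U = 0 \/ row_full U.

(** In the rescaled lattice [L'] only 0 has sup norm below 1. Approximating the coordinates of a
    vector of [L'] in the bounded frame [W] therefore yields an exact relation, and [K!] kills the
    quotient of [L'] by [Z^n W]. Hence the matrices of the [b i] in the frame [W] have denominators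
    dividing [K!] and bounded entries, which leaves finitely many possibilities; two frames with the
    same matrices differ by an element of the commutant. *)
Lemma bounded_lattices_simple : bounded_lattices b.
Proof.
have [B hB] := bounded_frame n_gt0 simple_b.
have [K K0 hK] := dirichlet_approx n B.
have [c hc] := exists_bounded_mx_fam b.
(* [n * (B * c)] bounds the entries of [W *m b i]; the successor makes [q] positive. The factor
   [2 * K.+1] in [M] accounts for [invmx W], by [small] below. *)
pose q : nat := (n * (B * c)).+1.
pose M : nat := (K`! * (2 * K.+1 * q))%N.
pose beta (W : 'M[rat]_n) i := W *m b i *m invmx W.
pose good (W : 'M[rat]_n) := W \in unitmx /\ forall i,
  K`!%:R *: beta W i \is a intmx /\ bounded_mx M%:R (K`!%:R *: beta W i).
pose F : finType := {ffun 'I_d * ('I_n * 'I_n) -> 'I_(2 * M).+1}.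
pose colour W : F := [ffun t =>
  inord (absz (Num.floor (K`!%:R * beta W t.1 t.2.1 t.2.2 + M%:R)%R))].
have fact0 : (K`!%:R : rat) != 0 by rewrite pnatr_eq0 -lt0n fact_gt0.
have colourP W W' : good W -> good W' -> colour W = colour W' ->
    forall i, beta W i = beta W' i.
  move=> gW gW' /ffunP e i; apply/matrixP => j k.
  have := e (i, (j, k)); rewrite !ffunE /= => /(congr1 (@nat_of_ord _)).
  have aux V : good V -> exists2 p : nat, (p < (2 * M).+1)%N &
      K`!%:R * beta V i j k + M%:R = p%:R.
    move=> [_ /(_ i) [/mxOverP/(_ j k) h1 /(_ j k)]]; rewrite mxE in h1 *.
    rewrite ler_norml => /andP[h2 h3].
    have : K`!%:R * beta V i j k + M%:R \is a Num.nat.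
      by rewrite natrEint rpredD ?natr_int //= -lerBlDr sub0r.
    case/natrP => p ep; exists p => //; rewrite ltnS -(ler_nat rat) -ep natrM.
    by lra.
  have [p hp ep] := aux _ gW; have [p' hp' ep'] := aux _ gW'.
  have fl (r : nat) : Num.floor (r%:R : rat) = r by rewrite pmulrn intrKfloor.
  rewrite ep ep' !fl !absz_nat !inordK // => epp.
  apply: (mulfI fact0); apply: (addIr M%:R).
  by rewrite ep ep' epp.
(* One reference frame [W0] is fixed for each colour that occurs, and the final constant clears the
   denominators of these finitely many frames. Colours that do not occur get the constant 1. *)
have /choice[Df hDf] : forall f : F, exists D : nat, (0 < D)%N /\
    forall W, good W -> colour W = f -> exists W0, [/\ good W0, colour W0 = f,
      D%:R *: invmx W0 \is a intmx & D%:R *: (K`!%:R^-1 *: W0) \is a intmx].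
  move=> f; case: (pselect (exists W0, good W0 /\ colour W0 = f)); last first.
    by move=> h; exists 1%N; split=> // W g e; case: h; exists W.
  case=> W0 [g0 e0].
  have [e1 e1_gt0 he1] := common_denominator (invmx W0).
  have [e2 e2_gt0 he2] := common_denominator (K`!%:R^-1 *: W0).
  exists (e1 * e2)%N; split; first by rewrite muln_gt0 e1_gt0.
  move=> W _ _; exists W0; split=> //.
    by rewrite mulnC natrM -scalerA; apply: intmx_natZ.
  by rewrite natrM -scalerA; apply: intmx_natZ.
exists (\prod_f Df f)%N.
  by apply/prodn_gt0 => f; case: (hDf f).
move=> L latL stL.
have [s [v [s0 Lv v0 bv short]]] := short_vector n_gt0 latL.
have L0 := lattice0 latL; have subL := latL.1.
pose L' : set 'rV[rat]_n := [set x | L (s *: x)].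
have stL' : stable b L' by move=> i x; rewrite /L' /= scalemxAl; exact: stL.
have subL' : subgroup_set L' by move=> x y; rewrite /L' /= scalerBr; exact: subL.
have L'0 : L' 0 by rewrite /L' /= scaler0.
have [W [uW bW LW]] := hB L' v stL' Lv v0 bv.
have red (x : 'rV_n) : exists (m : nat) (z : 'rV[rat]_n), [/\ (0 < m <= K)%N, z \is a intmx,
    forall k, `|(m%:R *: x - z *m W) 0 k| < 2^-1 &
    bounded_mx 1 (m%:R *: (x *m invmx W) - z)].
  have [m [z [h1 h2 h3 h4]]] := hK (x *m invmx W) W bW.
  by exists m, z; split=> // k; have := h3 k; rewrite mulmxBl -scalemxAl mulmxKV.
have zW (z : 'rV[rat]_n) : z \is a intmx -> L' (z *m W).
  by move=> hz; exact: (subgroup_mulmx subL' L'0 hz LW).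
(* [m x - z W] lies in [L'] and has sup norm below 1/2, so it is 0; moreover [m] divides [K!]. *)
have L'W (x : 'rV_n) : L' x -> K`!%:R *: (x *m invmx W) \is a intmx.
  move=> Lx; have [m [z [/andP[m0 mK] hz h3 _]]] := red x.
  have e : m%:R *: x - z *m W = 0.
    apply: short => [|k]; last by apply: lt_trans (h3 k) _; lra.
    exact: (subL' _ _ (subgroupZnat subL' L'0 m Lx) (zW _ hz)).
  have /dvdnP[r ->] : (m %| K`!)%N by apply: dvdn_fact; rewrite m0.
  rewrite natrM -scalerA; apply: intmx_natZ.
  move/eqP: e; rewrite subr_eq0 => /eqP e.
  by rewrite scalemxAl e mulmxK.
(* A bound for [invmx W] on all rational vectors. For so small an [x], [m x] is at most 1/2 and
   [m x - z W] is below 1/2, so [z W], which lies in [L'], is 0; then [m x] itself has coordinates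
   at most 1 in the frame. *)
have small (x : 'rV_n) : bounded_mx (2 * K.+1)%:R^-1 x -> bounded_mx 1 (x *m invmx W).
  move=> hx; have [m [z [/andP[m0 mK] hz h3 h4]]] := red x.
  have e : z *m W = 0.
    apply: short => [|k]; first exact: zW.
    have := h3 k; rewrite !mxE; move: (\sum_j _) => y.
    have mx : `|m%:R * x 0 k| <= 2^-1.
      rewrite normrM normr_nat.
      have := hx 0 k; rewrite natrM invfM => h.
      apply: le_trans (ler_wpM2l _ h) _; first exact: ler0n.
      rewrite mulrCA ler_piMr // ?invr_ge0 ?ler0n //.
      by rewrite ler_pdivrMr ?ltr0n // mul1r ler_nat ltnW.
    move: mx; rewrite ler_norml ltr_norml => /andP[? ?] /andP[? ?].
    by rewrite ltr_norml; apply/andP; split; lra.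
  have z0 : z = 0 by rewrite -(mulmxK uW z) e mul0mx.
  move=> i k; have := h4 i k; rewrite z0 subr0 mxE normrM normr_nat.
  by apply: le_trans; rewrite ler_peMl // ler1n.
have gW : good W.
  split=> // i; split.
    apply/mxOverP => j k.
    have /L'W /mxOverP /(_ 0 k) := stL' i _ (LW j).
    by rewrite -!row_mul !mxE.
  move=> j k; rewrite mxE normrM normr_nat natrM ler_pM2l ?ltr0n ?fact_gt0 //.
  pose y := row j W *m b i.
  have hy : bounded_mx q%:R y.
    move=> i' k'; apply: le_trans (_ : _ <= (n * (B * c))%:R) _; last by rewrite ler_nat.
    have : bounded_mx B%:R (row j W) by move=> ? ?; rewrite mxE.
    by move=> /bounded_mxM /(_ (hc i)) /(_ i' k'); rewrite !natrM.
  have r0 : 0 < (2 * K.+1 * q)%:R :> rat by rewrite ltr0n.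
  have /small : bounded_mx (2 * K.+1)%:R^-1 ((2 * K.+1 * q)%:R^-1 *: y).
    move=> i' k'; rewrite mxE normrM ger0_norm ?invr_ge0 ?ler0n //.
    rewrite natrM invfM -mulrA ler_piMr ?invr_ge0 ?ler0n //.
    by rewrite mulrC ler_pdivrMr ?ltr0n // mul1r.
  move=> /(_ 0 k); rewrite -scalemxAl mxE normrM ger0_norm ?invr_ge0 ?ler0n //.
  rewrite ler_pdivrMl // mulr1 /y -row_mul.
  by rewrite -row_mul mxE.
have [Df0 hD] := hDf (colour W).
have [W0 [[uW0 gW0] cW0 hD1 hD2]] := hD W gW erefl.
(* Carries the reference frame to the actual one and undoes the scaling. It commutes with [b]
   because both frames give the same matrices. *)
pose t := s *: (invmx W0 *m W).
have eb : beta W0 =1 beta W by apply: colourP.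
exists t; split.
- by rewrite /t unitmxZ ?unitfE // unitmx_mul unitmx_inv uW0.
- move=> i; rewrite /t -scalemxAl -scalemxAr; congr (_ *: _).
  have -> : invmx W0 *m W *m b i = invmx W0 *m beta W i *m W.
    by rewrite /beta -!mulmxA mulVmx // mulmx1.
  by rewrite -eb /beta !mulmxA mulVmx // mul1mx.
rewrite (bigD1 (colour W)) //= mulnC; apply: sandwiched_mull; first exact: subgroup_preim.
split=> x /=.
  move=> hx; rewrite /t -scalemxAr.
  suff : L' (x *m ((Df (colour W))%:R *: invmx W0) *m W).
    by rewrite /L' /= -scalemxAr -!scalemxAl mulmxA.
  by apply: zW; apply: intmxM.
rewrite /t -scalemxAr => /L'W hx.
have -> : (Df (colour W))%:R *: x = (K`!%:R *: (x *m (invmx W0 *m W) *m invmx W)) *m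
    ((Df (colour W))%:R *: (K`!%:R^-1 *: W0)).
  rewrite -!scalemxAr -scalemxAl !scalerA mulfVK //.
  by rewrite mulmxA mulmxK // mulmxKV.
exact: intmxM.
Qed.
End Simple.

(** The fixed pseudo-inverse of [A] gives a solution whose denominator exceeds that of the
    right-hand side by a factor depending on [A] only. *)
Lemma bounded_solution p q (A : 'M[rat]_(p, q)) : exists2 e : nat, (0 < e)%N &
  forall (k : nat) (x : 'rV[rat]_p), k%:R *: (x *m A) \is a intmx ->
  exists2 x', (k * e)%:R *: x' \is a intmx & x' *m A = x *m A.
Proof.
have [e e0 he] := common_denominator (pinvmx A).
exists e => // k x hx; exists (x *m A *m pinvmx A); last by rewrite mulmxKpV ?submxMl.
rewrite natrM -scalerA scalemxAr scalemxAl.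
exact: intmxM.
Qed.

(** * Change of basis, and extensions with bounded denominators *)

Section Transfer.
Variables (m n d : nat) (b : 'I_d -> 'M[rat]_n) (b' : 'I_d -> 'M[rat]_m).
Variables (P : 'M[rat]_(m, n)) (Q : 'M[rat]_(n, m)).
Hypotheses (PQ : P *m Q = 1%:M) (QP : Q *m P = 1%:M).
Hypothesis Pb : forall i, P *m b i = b' i *m P.

(** The sizes [m] and [n] are equal but not convertible: a basis adapted to a decomposition has size
    [\rank U + \rank C]. *)
Lemma bounded_lattices_transfer : bounded_lattices b' -> bounded_lattices b.
Proof.
have bQ i : b i *m Q = Q *m b' i.
  by rewrite -[b i]mul1mx -QP -!mulmxA [P *m (_ *m _)]mulmxA Pb -mulmxA PQ mulmx1.
case=> D D0 hD.
have [e e0 he] := common_denominator P.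
have [f f0 hf] := common_denominator Q.
exists (e * f * D)%N; first by rewrite !muln_gt0 e0 f0.
move=> L latL stL.
have latL' := lattice_preim PQ latL.
have stL' : stable b' [set x | L (x *m P)].
  by move=> i x /= Lx; rewrite -mulmxA -Pb mulmxA; apply: stL.
have [t [ut ct [h1 h2]]] := hD _ latL' stL'.
exists (Q *m t *m P); split.
- have /mulmx1_unit[] // : Q *m t *m P *m (Q *m invmx t *m P) = 1%:M.
  by rewrite !mulmxA -[_ *m P *m Q]mulmxA PQ mulmx1 mulmxK.
- move=> i; rewrite -!mulmxA Pb !mulmxA bQ -!mulmxA; congr (_ *m _).
  by rewrite !mulmxA ct.
- split=> x /= hx.
    have -> : (e * f * D)%:R *: x *m (Q *m t *m P) =
        D%:R *: (e%:R *: (x *m (f%:R *: Q))) *m t *m P.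
      rewrite -scalemxAr !scalerA -!natrM -!scalemxAl !mulmxA.
      by congr (_%:R *: _); ring.
    by apply: h1; apply: intmx_natZ; apply: intmxM.
  have -> : (e * f * D)%:R *: x = f%:R *: ((D%:R *: (x *m Q)) *m (e%:R *: P)).
    rewrite -scalemxAl -scalemxAr -mulmxA QP mulmx1 !scalerA -!natrM.
    by congr (_%:R *: _); ring.
  by apply: intmx_natZ; apply: intmxM => //; apply: h2; rewrite /= !mulmxA in hx *.
Qed.
End Transfer.

Section Block.
Variables (m n d : nat) (b1 : 'I_d -> 'M[rat]_m) (b2 : 'I_d -> 'M[rat]_n).

(** The obstruction [G *m b1 i - b2 i *m G] to equivariance is linear in [G]. If it has bounded
    denominators, so does some [G'] with the same obstruction, and [G - G'] is equivariant. *)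
Lemma shear_solution : exists2 e : nat, (0 < e)%N &
  forall (k : nat) (G : 'M[rat]_(n, m)),
  (forall i, k%:R *: (G *m b1 i - b2 i *m G) \is a intmx) ->
  exists2 G' : 'M[rat]_(n, m), (k * e)%:R *: G' \is a intmx &
    forall i, (G - G') *m b1 i = b2 i *m (G - G').
Proof.
pose T (G : 'M[rat]_(n, m)) : 'M[rat]_(d, n * m) :=
  \matrix_(i < d) mxvec (G *m b1 i - b2 i *m G).
have T_lin : linear T.
  move=> c G H; apply/row_matrixP => i; rewrite linearP /= !rowK -linearP /=.
  by congr mxvec; rewrite mulmxDl mulmxDr -scalemxAl -scalemxAr scalerBr opprD addrACA.
pose Tl : {linear _ -> _} := HB.pack T (GRing.isLinear.Build _ _ _ _ T T_lin).
have [e e0 he] := bounded_solution (lin_mx Tl).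
exists e => // k G hG.
case: (he k (mxvec G)).
  rewrite mul_vec_lin /= -linearZ /=; apply/mxOverP => i j.
  rewrite ord1; case/mxvec_indexP: j => j j'; rewrite mxvecE !mxE.
  case/mxvec_indexP: j' => p q; rewrite mxvecE.
  by have /mxOverP /(_ p q) := hG j; rewrite mxE.
move=> x; rewrite -[x]vec_mxK mul_vec_lin; set G' := vec_mx x.
rewrite mul_vec_lin /= => hx /(can_inj mxvecK) eT.
exists G'.
  apply/mxOverP => i j; move/mxOverP/(_ 0 (mxvec_index i j)): hx.
  by rewrite mxE mxvecE => h; rewrite mxE.
move=> i; have : row i (T G) = row i (T G') by rewrite eT.
rewrite !rowK => /(can_inj mxvecK) /eqP.
rewrite -subr_eq0 opprD opprK => /eqP h.
by apply/eqP; rewrite -subr_eq0 mulmxBl mulmxBr opprD opprK addrACA h.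
Qed.

(** The lattice is an extension of its projection [L2] by its intersection [L1] with the first
    summand. After normalising both, lifts of basis vectors form a matrix [G] whose failure to be
    equivariant lies in [L1] up to a factor, hence is bounded. So [G] is equivariant up to a bounded
    error, and a shear in the commutant removes the equivariant part. *)
Lemma bounded_lattices_block : bounded_lattices b1 -> bounded_lattices b2 ->
  bounded_lattices (fun i => block_mx (b1 i) 0 0 (b2 i)).
Proof.
case=> D1 D1_gt0 h1 [D2 D2_gt0 h2].
have [e e0 he] := shear_solution.
pose D := (D1 * D2)%N.
have D_gt0 : (0 < D)%N by rewrite muln_gt0 D1_gt0.
pose e' := (D ^ 3 * e)%N.
have e'_gt0 : (0 < e')%N by rewrite muln_gt0 expn_gt0 D_gt0.
exists (e' * D ^ 3)%N; first by rewrite muln_gt0 e'_gt0 expn_gt0 D_gt0.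
move=> L latL stL; have subL := latL.1; have L0 := lattice0 latL.
pose L1 : set 'rV[rat]_m := [set x | L (x *m row_mx 1%:M 0)].
pose L2 : set 'rV[rat]_n := [set x2 | exists x1, L (row_mx x1 x2)].
have L1E x : L1 x = L (row_mx x 0) by rewrite /L1 /= mul_mx_row mulmx1 mulmx0.
have latL1 : lattice L1.
  apply: (@lattice_preim _ _ _ _ (col_mx 1%:M 0)) => //.
  by rewrite mul_row_col mulmx1 mulmx0 addr0.
have latL2 : lattice L2.
  split.
    move=> x y [x1 Lx] [y1 Ly]; exists (x1 - y1).
    by rewrite -add_row_mx -opp_row_mx; apply: subL.
  have [_ [E E0 [hE1 hE2]]] := latL; exists E => //; split=> x.
    move=> hx; exists 0; have -> : row_mx 0 (E%:R *: x) = E%:R *: row_mx 0 x :> 'rV[rat]_(m + n) by rewrite scale_row_mx scaler0.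
    apply: hE1; apply/mxOverP => i j; rewrite mxE; case: fintype.split => k.
      by rewrite mxE rpred0.
    exact/mxOverP.
  case=> x1 /hE2 /mxOverP hx; apply/mxOverP => i j.
  by have := hx i (rshift m j); rewrite mxE row_mxEr mxE.
have mulb x1 x2 i : row_mx x1 x2 *m block_mx (b1 i) 0 0 (b2 i) =
    row_mx (x1 *m b1 i) (x2 *m b2 i) :> 'rV_(m + n).
  by rewrite mul_row_block !mulmx0 addr0 add0r.
have stL1 : stable b1 L1.
  by move=> i x; rewrite !L1E => /(stL i); rewrite mulb mul0mx.
have stL2 : stable b2 L2.
  by move=> i x [x1 /(stL i)]; rewrite mulb => h; exists (x1 *m b1 i).
have [t1 [ut1 ct1 /(sandwiched_mull D2 (subgroup_preim latL1.1))]] := h1 _ latL1 stL1.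
rewrite mulnC -/D => -[S1l S1u].
have [t2 [ut2 ct2 /(sandwiched_mull D1 (subgroup_preim latL2.1))]] := h2 _ latL2 stL2.
rewrite -/D => -[S2l S2u].
pose N x1 x2 := L (row_mx (x1 *m t1) (x2 *m t2)).
have Nsub x1 x2 y1 y2 : N x1 x2 -> N y1 y2 -> N (x1 - y1) (x2 - y2).
  by move=> hx hy; rewrite /N !mulmxBl -add_row_mx -opp_row_mx; apply: subL.
have Nadd x1 x2 y1 y2 : N x1 x2 -> N y1 y2 -> N (x1 + y1) (x2 + y2).
  by move=> hx hy; rewrite /N !mulmxDl -add_row_mx; apply: subgroupD.
have Nst i x1 x2 : N x1 x2 -> N (x1 *m b1 i) (x2 *m b2 i).
  by move=> /(stL i); rewrite mulb /N -!mulmxA ct1 ct2.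
have NZ (k : nat) x1 x2 : N x1 x2 -> N (k%:R *: x1) (k%:R *: x2).
  move=> /(subgroupZnat subL L0 k).
  by rewrite scale_row_mx !scalemxAl.
have N1l x : x \is a intmx -> N (D%:R *: x) 0.
  by move=> /S1l; rewrite /= L1E /N mul0mx.
have N1u x : N x 0 -> D%:R *: x \is a intmx.
  by rewrite /N mul0mx -L1E => /S1u.
have N2l x : x \is a intmx -> exists x1, N x1 (D%:R *: x).
  by move=> /S2l [x1 h]; exists (x1 *m invmx t1); rewrite /N mulmxKV.
have N2u x1 x2 : N x1 x2 -> D%:R *: x2 \is a intmx.
  by move=> h; apply: S2u; exists (x1 *m t1).
have delta_int k (j : 'I_k) : (delta_mx 0 j : 'rV[rat]_k) \is a intmx.
  by apply/mxOverP => i j'; rewrite mxE; case: (_ && _); rewrite ?rpred1 ?rpred0.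
have /choice[g hg] : forall j : 'I_n, exists x1, N x1 (D%:R *: delta_mx 0 j).
  by move=> j; apply: N2l.
pose G := \matrix_j g j.
have NG x : x \is a intmx -> N (x *m G) (D%:R *: x).
  move=> hx; have : L (x *m row_mx (G *m t1) (D%:R *: t2)).
    apply: subgroup_mulmx => // j; rewrite row_row_mx row_mul rowK.
    by have := hg j; rewrite /N -scalemxAl -rowE linearZ.
  by rewrite mul_mx_row -scalemxAr scalemxAl mulmxA.
(* Apply [b] to the lift of [D x] and let [x2] be the second component. Since [D x2] is integral,
   its image under [G] lifts [D^2 x2]; subtracting this lift from [D^2] times the vector leaves an
   element of the first summand, which one more factor [D] makes integral. *)
have key i : (D ^ 3)%:R *: (G *m b1 i - b2 i *m G) \is a intmx.
  suff h (x : 'rV[rat]_n) : x \is a intmx ->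
      (D ^ 3)%:R *: (x *m (G *m b1 i - b2 i *m G)) \is a intmx.
    apply/mxOverP => j k; have /mxOverP/(_ 0 k) := h _ (delta_int _ j).
    by rewrite -rowE !mxE.
  move=> hx; have Nx := Nst i _ _ (NG _ hx).
  have hy := N2u _ _ Nx; have Ny := NG _ hy.
  have := Nsub _ _ _ _ (NZ (D * D)%N _ _ Nx) Ny.
  rewrite natrM -scalerA -[(_ * _) *: (_ *m b2 i)]scalerA subrr => /N1u.
  rewrite scalerBr mulmxBr !mulmxA -!scalemxAl !scalerBr !scalerA -!natrM.
  by rewrite !expnS expn0 muln1 !mulnA.
have [G' hG' eG'] := he _ _ key.
(* [G] lifts [D] times the basis vectors, hence the division by [D]; subtracting [G'] makes [H]
   equivariant. *)
pose H := D%:R^-1 *: (G - G').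
have Dr : (D%:R : rat) != 0 by rewrite pnatr_eq0 -lt0n.
exists (block_mx 1%:M 0 H 1%:M *m block_mx t1 0 0 t2); split.
- rewrite unitmx_mul unitmxE det_lblock !det1 mulr1 unitr1 /=.
  by rewrite unitmxE det_lblock unitrM -!unitmxE ut1.
- move=> i; rewrite -mulmxA.
  have -> : block_mx t1 0 0 t2 *m block_mx (b1 i) 0 0 (b2 i) =
      block_mx (b1 i) 0 0 (b2 i) *m block_mx t1 0 0 t2.
    by rewrite !mulmx_block !mulmx0 !mul0mx !addr0 !add0r ct1 ct2.
  rewrite !mulmxA; congr (_ *m _).
  rewrite !mulmx_block !mulmx0 !mul0mx !mulmx1 !mul1mx !addr0 !add0r.
  by rewrite /H -scalemxAl -scalemxAr eG'.
have tE (x : 'rV[rat]_(m + n)) :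
    L (x *m (block_mx 1%:M 0 H 1%:M *m block_mx t1 0 0 t2)) =
    N (lsubmx x + rsubmx x *m H) (rsubmx x).
  rewrite -{1}[x]hsubmxK mulmxA mul_row_block !mulmx0 !mulmx1 add0r.
  by rewrite mul_row_block !mulmx0 addr0 add0r.
pose F := e'%:R *: G'.
have hF : F \is a intmx by [].
have HF (y : 'rV[rat]_n) : (D%:R *: y) *m H = y *m G - y *m G'.
  by rewrite -scalemxAl scalemxAr /H scalerA divff // scale1r mulmxBr.
have yG' (y : 'rV[rat]_n) : (e'%:R *: y) *m G' = y *m F.
  by rewrite -scalemxAl scalemxAr.
split=> x /=; rewrite tE.
  move=> /mxOverP hx; rewrite [lsubmx (_ *: x)]linearZ [rsubmx (_ *: x)]linearZ /=; set x1 := lsubmx x; set x2 := rsubmx x.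
  have hx1 : x1 \is a intmx by apply/mxOverP => i j; rewrite mxE.
  have hx2 : x2 \is a intmx by apply/mxOverP => i j; rewrite mxE.
  pose y := e'%:R *: ((D ^ 2)%:R *: x2).
  have hy : y \is a intmx by do 2!apply: intmx_natZ.
  have ey : (e' * D ^ 3)%:R *: x2 = D%:R *: y.
    by rewrite /y !scalerA -!natrM; congr (_%:R *: _); ring.
  pose w := (e' * D ^ 2)%:R *: x1 - D%:R *: x2 *m F.
  have hw : w \is a intmx.
    apply: intmxB; first exact: intmx_natZ.
    by apply: intmxM => //; apply: intmx_natZ.
  have e1 : (e' * D ^ 3)%:R *: x1 + D%:R *: y *m H = D%:R *: w + y *m G.
    have eD : (D * (e' * D ^ 2))%N = (e' * D ^ 3)%N by ring.
    rewrite HF /w scalerBr scalerA -natrM eD yG' [D%:R *: (_ *m F)]scalemxAl.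
    by rewrite scalerA -natrM mulnn addrA addrAC.
  rewrite ey e1 -[D%:R *: y]add0r; apply: Nadd; [exact: N1l | exact: NG].
move=> hx; set x1 := lsubmx x; set x2 := rsubmx x.
pose y := D%:R *: x2.
have hy : y \is a intmx by exact: N2u hx.
have := Nsub _ _ _ _ (NZ (D * D)%N _ _ hx) (NG _ hy).
rewrite -/x1 -/x2 natrM -[_ *: x2]scalerA subrr => /N1u.
rewrite [_ *: (x1 + _)]scalerDr [_ *: (x2 *m H)]scalemxAl -[_ *: x2]scalerA -/y HF.
rewrite [_ - y *m G']addrC addrA addrK; set u := D%:R *: _ => hu.
have ex1 : (e' * D ^ 3)%:R *: x1 = e'%:R *: u + D%:R *: (y *m F).
  rewrite -yG' -scalemxAl scalerA [D%:R * _]mulrC -scalerA -scalerDr -scalerDr.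
  by rewrite subrK !scalerA -!natrM; congr (_%:R *: _); ring.
have ex2 : (e' * D ^ 3)%:R *: x2 = (e' * D ^ 2)%:R *: y.
  by rewrite scalerA -natrM; congr (_%:R *: _); ring.
rewrite -[x]hsubmxK -/x1 -/x2 scale_row_mx ex1 ex2.
apply/mxOverP => i j; rewrite mxE; case: fintype.split => k.
  rewrite mxE; apply: rpredD; apply/mxOverP; first exact: intmx_natZ.
  by apply: intmx_natZ; exact: intmxM.
by apply/mxOverP; exact: intmx_natZ.
Qed.
End Block.

Definition semisimple n d (b : 'I_d -> 'M[rat]_n) : Prop :=
  forall U : 'M[rat]_n, (forall i, (U *m b i <= U)%MS) ->
  exists C : 'M[rat]_n, [/\ forall i, (C *m b i <= C)%MS,
    row_full (U + C)%MS & (U :&: C = 0)%MS].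

(** Modular law: a complement of [U *m R] in the whole space, intersected with the row space of [R],
    is a complement there; [C'] is this intersection in the coordinates of [R]. *)
Lemma semisimple_sub r n d (b : 'I_d -> 'M[rat]_n) (b' : 'I_d -> 'M[rat]_r)
    (R : 'M[rat]_(r, n)) :
  row_free R -> (forall i, R *m b i = b' i *m R) -> semisimple b -> semisimple b'.
Proof.
move=> fR Rb ssb U stU.
have stUR i : (<<U *m R>>%MS *m b i <= <<U *m R>>)%MS.
  rewrite (eqmxMr _ (genmxE _)) genmxE -mulmxA Rb mulmxA.
  by apply: submxMr; apply: stU.
have [C [stC fullC capC]] := ssb _ stUR.
pose C' := kermx (R *m cokermx C).
have C'E m (x : 'M_(m, r)) : (x <= C')%MS = (x *m R <= C)%MS.
  by rewrite sub_kermx mulmxA submxE.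
exists C'; split.
- move=> i; rewrite C'E -mulmxA -Rb mulmxA.
  by apply: submx_trans (stC i); apply: submxMr; rewrite -C'E.
- rewrite -sub1mx; apply/row_subP => i; move: (row i _) => y.
  have /sub_addsmxP[[u c] /= e] := submx_full (y *m R) fullC.
  have /submxP[v ev] : (u *m <<U *m R>>%MS <= U *m R)%MS.
    by apply: submx_trans (submxMl _ _) _; rewrite genmxE.
  rewrite -[y](subrKC (v *m U)).
  apply: addmx_sub_adds; first exact: submxMl.
  rewrite C'E mulmxBl e ev mulmxA addrC addKr.
  exact: submxMl.
- apply/eqP; rewrite -submx0; apply/rV_subP => x; rewrite sub_capmx C'E => /andP[xU xC].
  have : (x *m R <= (<<U *m R>> :&: C))%MS.
    by rewrite sub_capmx xC genmxE submxMr.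
  by rewrite capC submx0 mulmx_free_eq0 // => /eqP->; apply: sub0mx.
Qed.

(** Induction on the dimension: bases of a nontrivial stable subspace and of a stable complement put
    the [b i] in block diagonal form; if there is no such subspace, the module is simple. *)
Theorem jordan_zassenhaus n d (b : 'I_d -> 'M[rat]_n) :
  semisimple b -> bounded_lattices b.
Proof.
elim/ltn_ind: n => n IH in b *; move=> ssb.
have [n0|n0] := posnP n.
  exists 1%N => // L latL _; exists 1%:M.
  split; [exact: unitmx1 | by move=> i; rewrite mulmx1 mul1mx | split=> x /=].
    move=> _; suff -> : 1%:R *: x *m 1%:M = 0 by apply: lattice0.
    by apply/rowP => -[j hj]; exfalso; rewrite n0 in hj.
  by move=> _; apply/mxOverP => i [j hj]; exfalso; rewrite n0 in hj.
case: (pselect (exists U : 'M[rat]_n, [/\ forall i, (U *m b i <= U)%MS, U != 0 & ~~ row_full U])); last first.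
  move=> h; apply: bounded_lattices_simple => // U stU.
  apply: contrapT => h'; apply: h; exists U; split=> //.
    by apply/eqP => U0; apply: h'; left.
  by apply/negP => fU; apply: h'; right.
case=> U [stU U0 nfU].
have [C [stC fullC capC]] := ssb _ stU.
have rkUC : (\rank U + \rank C = n)%N.
  by rewrite -mxrank_disjoint_sum //; apply/eqP.
have rU : (\rank U < n)%N by rewrite ltn_neqAle rank_leq_row andbT.
have rC : (\rank C < n)%N.
  by rewrite -[X in (_ < X)%N]rkUC -[X in (X < _)%N]add0n ltn_add2r lt0n mxrank_eq0.
have st_base (A : 'M[rat]_n) i : (A *m b i <= A)%MS -> (row_base A *m b i <= row_base A)%MS.
  by move=> h; rewrite (eqmxMr _ (eq_row_base A)) eq_row_base.
pose b1 i := row_base U *m b i *m pinvmx (row_base U).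
pose b2 i := row_base C *m b i *m pinvmx (row_base C).
have e1 i : row_base U *m b i = b1 i *m row_base U.
  by rewrite /b1 mulmxKpV //; apply: st_base.
have e2 i : row_base C *m b i = b2 i *m row_base C.
  by rewrite /b2 mulmxKpV //; apply: st_base.
have JZ1 : bounded_lattices b1.
  by apply: IH => //; apply: semisimple_sub e1 ssb; apply: row_base_free.
have JZ2 : bounded_lattices b2.
  by apply: IH => //; apply: semisimple_sub e2 ssb; apply: row_base_free.
pose P := col_mx (row_base U) (row_base C).
have eP : (P :=: U + C)%MS.
  by apply: eqmx_trans (eqmx_sym (addsmxE _ _)) (adds_eqmx (eq_row_base _) (eq_row_base _)).
have fullP : row_full P by rewrite (eq_row_full eP).
have freeP : row_free P.
  by rewrite /row_free eP mxrank_disjoint_sum.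
apply: bounded_lattices_transfer (mulmxVp freeP) (mulVpmx fullP) _ (bounded_lattices_block JZ1 JZ2).
by move=> i; rewrite /P mul_col_mx mul_block_col !mul0mx addr0 add0r e1 e2.
Qed.

(** * Dual numbers and Lie algebras *)

(** [Dual a b] stands for [a + b eps] with [eps^2 = 0]. A separate type keeps this product apart
    from the componentwise product on pairs. *)
Record dual (A : Type) := Dual { dre : A ; deps : A }.

HB.instance Definition _ (A : Type) := gen_eqMixin (dual A).
HB.instance Definition _ (A : Type) := gen_choiceMixin (dual A).

Section DualRing.
Variable A : comUnitRingType.
Implicit Types x y z : dual A.

Lemma dual_ext x y : dre x = dre y -> deps x = deps y -> x = y.
Proof. by case: x y => [a b] [c d] /= -> ->. Qed.

Definition dual_add x y := Dual (dre x + dre y) (deps x + deps y).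
Definition dual_opp x := Dual (- dre x) (- deps x).
Definition dual_mul x y := Dual (dre x * dre y) (dre x * deps y + deps x * dre y).

Fact dual_addA : associative dual_add.
Proof. by move=> x y z; apply: dual_ext; rewrite /= addrA. Qed.
Fact dual_addC : commutative dual_add.
Proof. by move=> x y; apply: dual_ext; rewrite /= addrC. Qed.
Fact dual_add0 : left_id (Dual 0 0) dual_add.
Proof. by move=> x; apply: dual_ext; rewrite /= add0r. Qed.
Fact dual_addN : left_inverse (Dual 0 0) dual_opp dual_add.
Proof. by move=> x; apply: dual_ext; rewrite /= addNr. Qed.

HB.instance Definition _ := GRing.isZmodule.Build (dual A)
  dual_addA dual_addC dual_add0 dual_addN.

Fact dual_mulA : associative dual_mul.
Proof. by move=> x y z; apply: dual_ext => /=; ring. Qed.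
Fact dual_mulC : commutative dual_mul.
Proof. by move=> x y; apply: dual_ext => /=; ring. Qed.
Fact dual_mul1 : left_id (Dual 1 0) dual_mul.
Proof. by move=> x; apply: dual_ext => /=; ring. Qed.
Fact dual_mulDl : left_distributive dual_mul +%R.
Proof. by move=> x y z; apply: dual_ext => /=; ring. Qed.
Fact dual_1neq0 : Dual 1 0 != 0 :> dual A.
Proof. by apply/eqP => /(congr1 (@dre _)) /= /eqP; rewrite oner_eq0. Qed.

HB.instance Definition _ := GRing.Zmodule_isComNzRing.Build (dual A)
  dual_mulA dual_mulC dual_mul1 dual_mulDl dual_1neq0.

Definition dual_unit : pred (dual A) := fun x => dre x \is a GRing.unit.
Definition dual_inv x : dual A :=
  if dre x \is a GRing.unit then Dual (dre x)^-1 (- deps x * ((dre x)^-1 * (dre x)^-1)) else x.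

Fact dual_mulVx : {in dual_unit, left_inverse 1 dual_inv *%R}.
Proof.
move=> x ux; rewrite /dual_inv; have := ux; rewrite unfold_in => ux'.
rewrite ux'; apply: dual_ext => /=; first by rewrite mulVr.
by rewrite -!mulrA mulVr // mulr1 mulNr mulrC subrr.
Qed.
Fact dual_unitP x y : y * x = 1 -> dual_unit x.
Proof. by move=> /(congr1 (@dre _)) /= h; apply/unitrPr; exists (dre y); rewrite mulrC. Qed.
Fact dual_inv_out : {in [predC dual_unit], dual_inv =1 id}.
Proof. by move=> x; rewrite inE unfold_in => /negPf h; rewrite /dual_inv h. Qed.

HB.instance Definition _ := GRing.ComNzRing_hasMulInverse.Build (dual A)
  dual_mulVx dual_unitP dual_inv_out.
End DualRing.

Section DualAlg.
Variables (K : comNzRingType) (A : comUnitAlgType K).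
Definition dual_scale (k : K) (x : dual A) : dual A := Dual (k *: dre x) (k *: deps x).
Fact dual_scaleA a b v : dual_scale a (dual_scale b v) = dual_scale (a * b) v.
Proof. by apply: dual_ext; rewrite /= scalerA. Qed.
Fact dual_scale1 : left_id 1 dual_scale.
Proof. by move=> v; apply: dual_ext; rewrite /= scale1r. Qed.
Fact dual_scaleDr : right_distributive dual_scale +%R.
Proof. by move=> a u v; apply: dual_ext; rewrite /= scalerDr. Qed.
Fact dual_scaleDl v : {morph dual_scale^~ v : a b / a + b}.
Proof. by move=> a b; apply: dual_ext; rewrite /= scalerDl. Qed.
HB.instance Definition _ := GRing.Zmodule_isLmodule.Build K (dual A)
  dual_scaleA dual_scale1 dual_scaleDr dual_scaleDl.
Fact dual_scaleAl (a : K) (x y : dual A) : a *: (x * y) = a *: x * y.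
Proof. by apply: dual_ext; rewrite /= ?scalerDr !scalerAl. Qed.
HB.instance Definition _ := GRing.Lmodule_isLalgebra.Build K (dual A) dual_scaleAl.
HB.instance Definition _ := GRing.Lalgebra_isComAlgebra.Build K (dual A).
End DualAlg.

Section DualMorph.
Variable A : comUnitRingType.

Definition dual_const (a : A) : dual A := Dual a 0.
Fact dual_const_zmod : zmod_morphism dual_const.
Proof. by move=> x y; apply: dual_ext => //=; rewrite subr0. Qed.
Fact dual_const_monoid : monoid_morphism dual_const.
Proof. by split=> // x y; apply: dual_ext => //=; rewrite mulr0 mul0r addr0. Qed.
HB.instance Definition _ := GRing.isZmodMorphism.Build A (dual A) dual_const dual_const_zmod.
HB.instance Definition _ := GRing.isMonoidMorphism.Build A (dual A) dual_const dual_const_monoid.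

Fact dre_zmod : zmod_morphism (@dre A). Proof. by []. Qed.
Fact dre_monoid : monoid_morphism (@dre A). Proof. by []. Qed.
HB.instance Definition _ := GRing.isZmodMorphism.Build (dual A) A (@dre A) dre_zmod.
HB.instance Definition _ := GRing.isMonoidMorphism.Build (dual A) A (@dre A) dre_monoid.
Fact deps_zmod : zmod_morphism (@deps A). Proof. by []. Qed.
HB.instance Definition _ := GRing.isZmodMorphism.Build (dual A) A (@deps A) deps_zmod.
End DualMorph.

(** * Tangent vectors and exponentials over nilpotent rings *)

Lemma mpoly_ind_ring N (R : comNzRingType) (P : {mpoly R[N]} -> Prop) :
  (forall c, P c%:MP) -> (forall i, P 'X_i) ->
  (forall f g, P f -> P g -> P (f + g)) -> (forall f g, P f -> P g -> P (f * g)) ->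
  forall f, P f.
Proof.
move=> PC PX PD PM f; rewrite [f]mpolyE.
apply: (big_ind P) => [| |m _]; [exact: (PC 0) | exact: PD |].
rewrite -mul_mpolyC; apply: (PM) => //; rewrite mpolyXE_id.
apply: (big_ind P) => [| |i _]; [exact: (PC 1) | exact: PM |].
by elim: (m i) => [|k IH]; [exact: (PC 1) | rewrite exprS; apply: PM].
Qed.

(** Makes [gl_points] insensitive to the chosen structure map: the values on integers are forced,
    and nonzero denominators go to units. *)
Lemma rat_rmorph_unique (A : unitRingType) (f g : {rmorphism rat -> A}) : f =1 g.
Proof.
move=> x; have ux : f (denq x)%:~R \is a GRing.unit.
  by rewrite rmorph_unit // unitfE intr_eq0 denq_neq0.
have eden : f (denq x)%:~R = g (denq x)%:~R by rewrite !rmorph_int.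
by apply: (mulIr ux); rewrite {2}eden -!rmorphM -numqE !rmorph_int.
Qed.

Lemma mmap_rmorph N (R : nzRingType) (A B : comNzRingType) (u : {rmorphism A -> B})
    (phi : {rmorphism R -> A}) (psi : {rmorphism R -> B}) (v : 'I_N -> A) (w : 'I_N -> B) f :
  (forall x, psi x = u (phi x)) -> (forall i, w i = u (v i)) ->
  mmap psi w f = u (mmap phi v f).
Proof.
move=> e1 e2; rewrite /mmap rmorph_sum; apply: eq_bigr => m _.
rewrite rmorphM e1 /mmap1 rmorph_prod; congr (_ * _).
by apply: eq_bigr => i _; rewrite rmorphXn e2.
Qed.

Lemma entries_map (A B : comNzRingType) n (u : A -> B) (g : 'M[A]_n) i :
  entries (map_mx u g) i = u (entries g i).
Proof. by rewrite /entries; case/mxvec_indexP: i => i j; rewrite !mxvecE mxE. Qed.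

Lemma gl_points_map n (I : set {mpoly rat[n * n]}) (A B : comUnitRingType)
    (u : {rmorphism A -> B}) (phi : {rmorphism rat -> A}) (psi : {rmorphism rat -> B}) g :
  gl_points I phi g -> gl_points I psi (map_mx u g).
Proof.
move=> [ug hg]; split; first by rewrite unitmxE det_map_mx rmorph_unit // -unitmxE.
move=> f If; rewrite (@mmap_rmorph _ _ _ _ u phi psi (entries g)) ?hg ?rmorph0 //.
  by move=> x; exact: (rat_rmorph_unique psi (u \o phi)).
by move=> i; rewrite entries_map.
Qed.

Lemma deps_rat (A : comUnitRingType) (psi : {rmorphism rat -> dual A}) x :
  psi x = Dual (dre (psi x)) 0.
Proof. exact: (rat_rmorph_unique psi (@dual_const A \o (@dre A \o psi))). Qed.

(** Taylor expansion at a rational point: [c0] is the value of [f] and the [c i] are its partial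
    derivatives. They are rational and the same for all [A], which allows tangent vectors over
    different rings to be compared. *)
Lemma first_order N (f : {mpoly rat[N]}) (x : 'I_N -> rat) :
  exists (c0 : rat) (c : 'I_N -> rat), forall (A : comUnitRingType)
    (psi : {rmorphism rat -> dual A}) (v : 'I_N -> A),
  mmap psi (fun i => psi (x i) + Dual 0 (v i)) f =
  Dual (dre (psi c0)) (\sum_i dre (psi (c i)) * v i).
Proof.
elim/mpoly_ind_ring: f => [c|i|f g [c0 [c hf]] [d0 [d hg]]|f g [c0 [c hf]] [d0 [d hg]]].
- exists c, (fun=> 0) => A psi v; rewrite mmapC [LHS]deps_rat.
  by congr Dual; rewrite big1 // => i _; rewrite rmorph0 mul0r.
- exists (x i), (fun j => (j == i)%:R) => A psi v; rewrite mmapX mmap1U [psi (x i)]deps_rat.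
  apply: dual_ext => /=; first by rewrite addr0.
  rewrite add0r (bigD1 i) //= eqxx rmorph1 mul1r big1 ?addr0 // => j /negPf ->.
  by rewrite rmorph0 mul0r.
- exists (c0 + d0), (fun i => c i + d i) => A psi v; rewrite mmapD hf hg.
  apply: dual_ext => /=; first by rewrite rmorphD.
  by rewrite -big_split; apply: eq_bigr => i _; rewrite rmorphD mulrDl.
- exists (c0 * d0), (fun i => c0 * d i + c i * d0) => A psi v; rewrite rmorphM /= hf hg.
  apply: dual_ext => /=; first by rewrite rmorphM /= (deps_rat psi c0).
  rewrite mulr_sumr mulr_suml -big_split; apply: eq_bigr => i _ /=.
  by rewrite raddfD /= !rmorphM /=; ring.
Qed.

Definition dual_mx (A : comUnitRingType) m n (X : 'M[A]_(m, n)) : 'M[dual A]_(m, n) :=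
  map_mx (fun x => Dual 0 x) X.

Lemma dual_mxM0 (A : comUnitRingType) m n p (X : 'M[A]_(m, n)) (Y : 'M[A]_(n, p)) :
  dual_mx X *m dual_mx Y = 0.
Proof.
apply/matrixP => i j; rewrite !mxE big1 // => k _; rewrite !mxE.
by apply: dual_ext; rewrite /= ?mulr0 ?mul0r ?addr0.
Qed.

Lemma unitmx_1dual (A : comUnitRingType) n (X : 'M[A]_n) : 1%:M + dual_mx X \in unitmx.
Proof.
have /mulmx1_unit[] // : (1%:M + dual_mx X) *m (1%:M - dual_mx X) = 1%:M.
by rewrite mulmxDl mul1mx mulmxBr mulmx1 dual_mxM0 subr0 subrK.
Qed.

(* [1 + eps X] is a point of [G] over the dual numbers, i.e. [X] lies in the
   Lie algebra of [G]. *)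
Definition tangent n (G : Qsubgroup n) (X : 'M[rat]_n) : Prop :=
  forall (A : comUnitRingType) (phi : {rmorphism rat -> A})
    (psi : {rmorphism rat -> dual A}),
  gl_points G psi (1%:M + dual_mx (map_mx phi X)).

Lemma entries_1dual (A : comUnitRingType) n (psi : {rmorphism rat -> dual A}) (X : 'M[A]_n) i :
  entries (1%:M + dual_mx X) i = psi (entries 1%:M i) + Dual 0 (entries X i).
Proof.
rewrite /entries; case/mxvec_indexP: i => i j; rewrite !mxvecE !mxE.
by rewrite rmorph_nat.
Qed.

(** At [1 + eps Y] an equation of [G] says that it vanishes at 1 and that its differential, a linear
    form with rational coefficients, vanishes on [Y]. An [X] that satisfies the rational linear
    relations among the entries of [Y] inherits this. *)
Lemma tangent_descent n (G : Qsubgroup n) (A : comUnitRingType)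
    (psi : {rmorphism rat -> dual A}) (Y : 'M[A]_n) (X : 'M[rat]_n) :
  gl_points G psi (1%:M + dual_mx Y) ->
  (forall c : 'I_(n * n) -> rat,
    \sum_i dre (psi (c i)) * entries Y i = 0 -> \sum_i c i * entries X i = 0) ->
  tangent G X.
Proof.
move=> [_ hY] YX B phi psi'; split; first exact: unitmx_1dual.
move=> f Gf; have [c0 [c hc]] := first_order f (entries 1%:M).
have := hY f Gf; rewrite (_ : entries (1%:M + dual_mx Y) =
    fun i => psi (entries 1%:M i) + Dual 0 (entries Y i)); last first.
  by apply/funext => i; exact: entries_1dual.
rewrite hc => e0.
have /(congr1 (@dre _)) /= /eqP := e0.
have -> : dre (psi c0) = (@dre A \o psi) c0 by [].
rewrite fmorph_eq0 => /eqP c00.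
have /(congr1 (@deps _)) /= /YX hX := e0.
rewrite (_ : entries (1%:M + dual_mx _) =
    fun i => psi' (entries 1%:M i) + Dual 0 (entries (map_mx phi X) i)); last first.
  by apply/funext => i; exact: entries_1dual.
rewrite hc c00 rmorph0; apply: dual_ext => //=.
transitivity (phi (\sum_i c i * entries X i)); last by rewrite hX rmorph0.
rewrite rmorph_sum; apply: eq_bigr => i _; rewrite rmorphM entries_map.
by congr (_ * _); exact: (rat_rmorph_unique (@dre B \o psi') phi).
Qed.

(** [X^j / j!], the coefficient of degree [j] of the exponential. *)
Fixpoint exp_coef n (X : 'M[rat]_n) (j : nat) : 'M[rat]_n :=
  if j is j'.+1 then j%:R^-1 *: (exp_coef X j' *m X) else 1%:M.

(* The point [exp (tau X)] of [G] with values in [Q[eps_1, ..., eps_m]], where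
   [tau = eps_1 + ... + eps_m]: it is the product of the [1 + eps_i X]. *)
Lemma exp_points n (G : Qsubgroup n) (X : 'M[rat]_n) (m : nat) : tangent G X ->
  exists (A : comUnitRingType) (phi : {rmorphism rat -> A}) (tau : A),
  [/\ tau ^+ m != 0, tau ^+ m.+1 = 0 &
    gl_points G phi (\sum_(j < m.+1) tau ^+ j *: map_mx phi (exp_coef X j))].
Proof.
move=> tX; elim: m => [|m [A [phi [tau [t0 t1 pt]]]]].
  exists rat, idfun, 0; split; rewrite ?expr0 ?oner_eq0 ?expr1 //.
  by rewrite big_ord1 expr0 scale1r map_mx1; exact: points1.
pose psi : {rmorphism rat -> dual A} := @dual_const A \o phi.
exists (dual A), psi, (Dual tau 1).
(* [(tau + eps)^j = tau^j + j tau^(j-1) eps]: the power [m + 1] survives through its [eps] part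
   [(m + 1) tau^m], and the power [m + 2] vanishes. *)
have powE j : Dual tau 1 ^+ j = Dual (tau ^+ j) (j%:R * tau ^+ j.-1) :> dual A.
  elim: j => [|j IH]; first by rewrite !expr0 mul0r.
  rewrite exprS IH; apply: dual_ext => /=; first by rewrite exprS.
  rewrite mul1r [X in X + _ = _]mulrCA -exprS -[in RHS]natr1 mulrDl mul1r.
  by case: j {IH} => [|j] //=; rewrite !mul0r.
have unat (j : nat) : (j.+1%:R : A) \is a GRing.unit.
  by rewrite -(rmorph_nat phi) rmorph_unit // unitfE pnatr_eq0.
split.
- rewrite powE; apply/eqP => /(congr1 (@deps _)) /= /eqP.
  by rewrite mulrI_eq0 ?(negPf t0) //; apply: mulrI; exact: unat.
- by rewrite powE exprS t1 mulr0 mulr0.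
(* [exp((tau + eps) X) = exp(tau X) (1 + eps X)], since [eps] has square zero. *)
have -> : \sum_(j < m.+2) Dual tau 1 ^+ j *: map_mx psi (exp_coef X j) =
    map_mx (@dual_const A) (\sum_(j < m.+1) tau ^+ j *: map_mx phi (exp_coef X j))
      *m (1%:M + dual_mx (map_mx phi X)).
  have -> : map_mx (@dual_const A) (\sum_(j < m.+1) tau ^+ j *: map_mx phi (exp_coef X j))
      *m (1%:M + dual_mx (map_mx phi X)) =
    \sum_(j < m.+1) Dual (tau ^+ j) 0 *: map_mx psi (exp_coef X j) +
    \sum_(j < m.+1) Dual 0 (tau ^+ j) *: map_mx psi (exp_coef X j *m X).
    have -> : dual_mx (map_mx phi X) = Dual 0 1 *: map_mx psi X.
      apply/matrixP => i j; rewrite !mxE.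
      by apply: dual_ext; rewrite /= ?mul0r ?mul1r ?add0r.
    have -> : map_mx (@dual_const A) (\sum_(j < m.+1) tau ^+ j *: map_mx phi (exp_coef X j))
        = \sum_(j < m.+1) Dual (tau ^+ j) 0 *: map_mx psi (exp_coef X j).
      rewrite map_mx_sum; apply: eq_bigr => j _.
      by rewrite map_mxZ -map_mx_comp.
    rewrite mulmxDr mulmx1; congr (_ + _); rewrite mulmx_suml; apply: eq_bigr => j _.
    rewrite -scalemxAl -scalemxAr scalerA map_mxM; congr (_ *: _).
    by apply: dual_ext; rewrite /= ?mulr0 ?mulr1 ?mul0r ?addr0.
  rewrite (eq_bigr (fun j : 'I_m.+2 => Dual (tau ^+ j) 0 *: map_mx psi (exp_coef X j) +
     Dual 0 (j%:R * tau ^+ j.-1) *: map_mx psi (exp_coef X j))); last first.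
    move=> j _; rewrite powE -scalerDl; congr (_ *: _).
    by apply: dual_ext; rewrite /= ?addr0 ?add0r.
  rewrite big_split /=; congr (_ + _).
    rewrite big_ord_recr /= t1 (_ : Dual 0 0 = 0) // scale0r addr0 //.
  rewrite big_ord_recl (_ : Dual 0 (_%:R * _) = 0); last first.
    by apply: dual_ext; rewrite //= mul0r.
  rewrite scale0r add0r.
  apply: eq_bigr => j _; rewrite lift0 -[exp_coef X j.+1]/(_ *: _) map_mxZ scalerA.
  congr (_ *: _); apply: dual_ext => /=; first by rewrite mul0r.
  rewrite mul0r add0r mulrAC -(rmorph_nat phi) -rmorphM divff ?rmorph1 ?mul1r //.
  by rewrite pnatr_eq0.
apply: pointsM; last exact: tX.
exact: gl_points_map pt.
Qed.

(** Substituting the [tau] of [exp_points] for the variable kills the polynomial. If its first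
    nonzero coefficient had index [i <= m], multiplying by [tau^(m - i)] would leave this
    coefficient times [tau^m], which is nonzero because nonzero rationals become units. So an
    equation of [G] vanishes along [exp(T X)] to every order. *)
Lemma exp_vanish n (G : Qsubgroup n) (X : 'M[rat]_n) (m : nat) (f : {mpoly rat[n * n]}) :
  tangent G X -> equations G f -> forall i, (i <= m)%N ->
  (mmap (@polyC rat) (entries (\sum_(j < m.+1) 'X^j *: map_mx polyC (exp_coef X j))) f)`_i = 0.
Proof.
move=> tX Gf; have [A [phi [tau [t0 t1 [_ pt]]]]] := exp_points m tX.
set F := mmap _ _ f.
pose h : {rmorphism {poly rat} -> A} := horner_eval tau \o map_poly phi.
have hF : h F = 0.
  rewrite -(pt f Gf); apply/esym/mmap_rmorph => [x|i].
    by rewrite /h /= map_polyC /horner_eval hornerC.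
  rewrite -entries_map; congr (entries _ i).
  rewrite map_mx_sum; apply: eq_bigr => j _.
  rewrite map_mxZ -map_mx_comp; congr (_ *: _).
    by rewrite /h /= map_polyXn /horner_eval hornerXn.
  by apply/matrixP => p q; rewrite !mxE /h /= map_polyC /horner_eval hornerC.
elim/ltn_ind => i IH im; apply/eqP; apply: contraT => Fi0; case/negP: t0.
have big_tau k : (m < k)%N -> tau ^+ k = 0.
  by move=> mk; rewrite -(subnK mk) exprD t1 mulr0.
have : h ('X^(m - i) * F) = 0 by rewrite rmorphM hF mulr0.
rewrite rmorphM /= map_polyXn /horner_eval hornerXn.
rewrite horner_coef mulr_sumr.
have si : (i < size (map_poly phi F))%N.
  rewrite size_map_poly ltnNge; apply: contra Fi0 => le.
  by rewrite nth_default.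
rewrite (bigD1 (Ordinal si)) //= big1 ?addr0.
  rewrite coef_map mulrCA -exprD subnK // => /eqP.
  rewrite mulrI_eq0 //; apply: mulrI; apply: rmorph_unit.
  by rewrite unitfE.
move=> k ki; rewrite coef_map; case: (ltngtP k i) => [ki'|ki'|e].
- by rewrite (IH k ki' (leq_trans (ltnW ki') im)) raddf0 mul0r mulr0.
- rewrite mulrCA -exprD big_tau ?mulr0 //.
  by rewrite -{1}(subnK im) ltn_add2l.
- by rewrite -val_eqE /= e eqxx in ki.
Qed.

(** * The l-adic exponential *)

Lemma fraction_numden (R : idomainType) (a : {fraction R}) :
  exists n d : R, d != 0 /\ tofrac d * a = tofrac n.
Proof.
elim/quotW: a => x; exists \n_x, \d_x; split; first exact: denom_ratioP.
unlock tofrac; rewrite -[LHS]FracField.pi_mul; apply/eqmodP => /=.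
have d0 := denom_ratioP x.
rewrite FracField.equivfE /FracField.mulf !numden_Ratio ?mulf_neq0 ?oner_eq0 //.
by rewrite mulr1 mul1r.
Qed.

Section ZadicFacts.
Variables (l : nat) (hl : prime l).
Local Notation Zl := (Zadic hl).
Implicit Types x y : Zl.

Let l_gt0 k : (0 < l ^ k)%N. Proof. by rewrite expn_gt0 prime_gt0. Qed.

Lemma zres_int (m : int) k : zres (m%:~R : Zl) k = (m %% (l ^ k)%N)%Z.
Proof.
suff -> : m%:~R = zadic_int hl m by [].
have E (p : nat) : p%:R = zadic_int hl p.
  elim: p => [|p IH]; first by [].
  by rewrite -natr1 IH; apply: zadic_ext => j /=; rewrite modzDm -PoszD addn1.
case: m => p; first exact: E.
rewrite NegzE mulrNz -pmulrn E; apply: zadic_ext => j /=.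
by rewrite modzNm.
Qed.

Lemma zres0 k : zres (0 : Zl) k = 0.
Proof. by rewrite -[0]/(0%:~R) zres_int mod0z. Qed.

Lemma zresD x y k : zres (x + y) k = ((zres x k + zres y k) %% (l ^ k)%N)%Z.
Proof. by []. Qed.

Lemma zresM x y k : zres (x * y) k = ((zres x k * zres y k) %% (l ^ k)%N)%Z.
Proof. by []. Qed.

Lemma zres_pow0 k : zres ((l ^ k)%:R : Zl) k = 0.
Proof. by rewrite pmulrn zres_int modzz. Qed.

Lemma zadic_separated x : (forall k, zres x k = 0) -> x = 0.
Proof. by move=> h; apply: zadic_ext => k; rewrite h zres0. Qed.

(** Dividing the residue modulo [l^(k + m)] by [l^k] gives a residue modulo [l^m]: the quotient is
    the sequence of residues shifted by [k]. *)
Lemma zadic_dvd x k : zres x k = 0 -> exists y, x = (l ^ k)%:R * y.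
Proof.
move=> xk; pose f m := (zres x (k + m)%N %/ (l ^ k)%N)%Z.
have lk0 : (Posz (l ^ k)%N) != 0 by rewrite eqz_nat -lt0n l_gt0.
have fE m : zres x (k + m)%N = f m * (l ^ k)%N.
  rewrite /f divzK //; apply/dvdz_mod0P; rewrite zres_modD //.
have hf m : (f m.+1 %% (l ^ m)%N = f m %% (l ^ m)%N)%Z.
  apply/eqP; rewrite eqz_mod_dvd -(dvdz_mul2r (p := Posz (l ^ k)%N)) //.
  rewrite mulrBl -!fE -eqz_mod_dvd -PoszM -expnD [(m + k)%N]addnC addnS.
  by rewrite -zresP zres_mod.
exists (zadic_of hl hf); apply: zadic_ext => m.
by rewrite zresM pmulrn zres_int /= modzMm -(zres_modD x m k) addnC fE mulrC.
Qed.

(** Bezout inverts each residue; inverses modulo [l^k] are unique, so the chosen ones are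
    compatible. *)
Lemma zadic_unit1 x : zres x 1 != 0 -> exists y, y * x = 1.
Proof.
move=> x1.
have /choice[v hv] : forall k, exists v : int, (zres x k * v = 1 %[mod (l ^ k)%N])%Z.
  move=> k; case: k => [|k]; first by exists 0; rewrite expn0 !modz1.
  have cop : coprimez (zres x k.+1) (l ^ k.+1)%N.
    rewrite /coprimez -[gcdz _ _]/(Posz (gcdn _ _)) /= eqz_nat.
    rewrite -/(coprime _ _) coprimeXr // coprime_sym prime_coprime //.
    apply: contra x1 => h; rewrite -(zres_modD x 1 k) add1n expn1.
    by apply/eqP/dvdz_mod0P; rewrite dvdzE.
  case/coprimezP: cop => -[u w] /= e; exists u.
  apply/eqP; rewrite eqz_mod_dvd; apply/dvdzP; exists (- w).
  by rewrite -e; ring.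
have hf k : (v k.+1 %% (l ^ k)%N = v k %% (l ^ k)%N)%Z.
  have e1 : (zres x k * v k.+1 = 1 %[mod (l ^ k)%N])%Z.
    have /(congr1 (fun z => (z %% (l ^ k)%N)%Z)) := hv k.+1.
    have dv : (Posz (l ^ k)%N %| Posz (l ^ k.+1)%N)%Z by rewrite dvdzE /= dvdn_exp2l.
    by rewrite !modz_dvdm // => <-; rewrite (zresP x k) modzMml.
  rewrite -[v k.+1 in LHS]mulr1 -[in LHS]modzMmr -(hv k) modzMmr.
  by rewrite mulrA -modzMml [v k.+1 * _]mulrC e1 modzMml mul1r.
exists (zadic_of hl hf); apply: zadic_ext => k.
by rewrite zresM /= modzMml mulrC hv.
Qed.

Lemma zadic_unit_part x : x != 0 -> exists k y, x * y = (l ^ k)%:R.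
Proof.
move=> /zadic_neq0 exk.
case: (ex_minnP exk) => -[|k] hk mink.
  by move: hk; rewrite -zres_mod expn0 modz1.
have xk : zres x k = 0.
  by apply/eqP; apply: contraT => /mink; rewrite ltnn.
have [u eu] := zadic_dvd xk.
have /zadic_unit1[y ey] : zres u 1 != 0.
  apply: contra hk => /eqP /zadic_dvd[w ew].
  by rewrite eu ew expn1 mulrA -natrM -expnSr zresM zres_pow0 mul0r mod0z.
by exists k, y; rewrite eu -mulrA [u * y]mulrC ey mulr1.
Qed.

Lemma qadic_denominator (a : Qadic hl) : exists k (z : Zl),
  (l ^ k)%:R * a = Zadic_to_Qadic z.
Proof.
have [n [d [d0 e]]] := fraction_numden a.
have [k [y ey]] := zadic_unit_part d0.
exists k, (y * n); rewrite -(rmorph_nat (@Zadic_to_Qadic l hl)) -ey [d * y]mulrC.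
by rewrite !rmorphM -mulrA; congr (_ * _).
Qed.

Lemma zadic_limit (x : nat -> Zl) :
  (forall k, zres (x k.+1) k = zres (x k) k) ->
  exists y, forall k, zres y k = zres (x k) k.
Proof.
move=> h; have hf k : (zres (x k.+1) k.+1 %% (l ^ k)%N = zres (x k) k %% (l ^ k)%N)%Z.
  by rewrite -zresP h zres_mod.
by exists (zadic_of hl hf) => k /=; rewrite zres_mod.
Qed.
End ZadicFacts.

(** In Legendre's sum, [m %/ p] is at most half of [m], and the terms after the first form the same
    sum for [m %/ p]. This crude bound makes [l^j / j!] integral for every [l], including 2. *)
Lemma logn_fact_le (p n : nat) : prime p -> (logn p n`! <= n)%N.
Proof.
move=> pp; rewrite logn_fact //.
suff H (N m : nat) : (\sum_(1 <= k < N.+1) m %/ p ^ k <= m)%N by exact: H.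
elim: N m => [|N IH] m; first by rewrite big_geq.
rewrite big_nat_recl //=.
have -> : (\sum_(1 <= i < N.+1) m %/ p ^ i.+1 = \sum_(1 <= i < N.+1) (m %/ p) %/ p ^ i)%N.
  by apply: eq_bigr => i _; rewrite expnS divnMA.
rewrite expn1; apply: leq_trans (leq_add (leqnn _) (IH _)) _.
rewrite addnn -muln2 (leq_trans _ (leq_trunc_div m p)) //.
by rewrite leq_mul // prime_gt1.
Qed.

Section ZadicExp.
Variables (l : nat) (hl : prime l).
Local Notation Zl := (Zadic hl).
Local Notation Ql := (Qadic hl).
Local Notation iZ := (@Zadic_to_Qadic l hl).
Local Notation iQ := (@rat_to_Qadic l hl).

(** A single [g] serves every ring that receives both Z_l and Q; it is used with values in Q_l and
    in polynomials over Q_l. *)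
Lemma clear_denominators N (f : {mpoly rat[N]}) :
  exists2 q : nat, (0 < q)%N & exists g : {mpoly Zl[N]},
  forall (B : comNzRingType) (alpha : {rmorphism Zl -> B}) (beta : {rmorphism rat -> B})
    (v : 'I_N -> B), mmap alpha v g = q%:R * mmap beta v f.
Proof.
elim/mpoly_ind_ring: f => [c|i|f g [p p0 [f' hf]] [q q0 [g' hg]]|f g [p p0 [f' hf]] [q q0 [g' hg]]].
- exists `|denq c|%N; first by rewrite absz_gt0 denq_neq0.
  exists ((numq c)%:~R)%:MP => B alpha beta v; rewrite !mmapC.
  transitivity ((numq c)%:~R : B); first exact: (rmorph_int alpha).
  rewrite -(rmorph_int beta) numqE rmorphM mulrC; congr (_ * _).
  by rewrite rmorph_int pmulrn absz_denq.
- exists 1%N => //; exists 'X_i => B alpha beta v.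
  by rewrite !mmapX mul1r.
- exists (p * q)%N; first by rewrite muln_gt0 p0.
  exists (q%:R *: f' + p%:R *: g') => B alpha beta v.
  rewrite !mmapD !mmapZ !rmorph_nat (hf B alpha beta) (hg B alpha beta) natrM mulrDr.
  by rewrite mulrA [q%:R * _]mulrC -!mulrA [_ * (q%:R * _)]mulrCA.
- exists (p * q)%N; first by rewrite muln_gt0 p0.
  exists (f' * g') => B alpha beta v.
  by rewrite !rmorphM /= (hf B alpha beta) (hg B alpha beta) ?natrM mulrACA.
Qed.

Lemma pow_div_fact (j : nat) : exists w : Zl, iZ w = iQ (l%:R ^+ j / j`!%:R).
Proof.
pose v := logn l j`!.
have vj : (v <= j)%N by exact: logn_fact_le.
have f0 : (0 < j`!)%N := fact_gt0 j.
have [u cu eu] := pfactor_coprime hl f0.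
have /zadic_unit1[y ey] : zres (u%:R : Zl) 1 != 0.
  rewrite pmulrn zres_int expn1; apply/eqP => /dvdz_mod0P; rewrite dvdzE /=.
  by apply/negP; rewrite -prime_coprime.
exists ((l ^ (j - v))%:R * y).
have : iQ j`!%:R != 0 by rewrite fmorph_eq0 pnatr_eq0 -lt0n.
move=> /mulIf; apply; rewrite -rmorphM divfK ?pnatr_eq0 -?lt0n //.
rewrite -natrX !rmorph_nat eu -(rmorph_nat iZ) -rmorphM -(rmorph_nat iZ (l ^ j)).
congr (iZ _); rewrite natrM [u%:R * _]mulrC mulrACA ey mulr1.
by rewrite -natrM -expnD subnK.
Qed.

Lemma intmx_Zl m n (A : 'M[rat]_(m, n)) : A \is a intmx ->
  exists B : 'M[Zl]_(m, n), map_mx iZ B = map_mx iQ A.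
Proof.
move=> /mxOverP hA.
exists (\matrix_(i, j) (Num.floor (A i j))%:~R).
apply/matrixP => i j; rewrite !mxE rmorph_int.
by rewrite -[in RHS](floorK (hA i j)) rmorph_int.
Qed.

Lemma exp_coef_integral n (Z : 'M[rat]_n) (j : nat) : Z \is a intmx ->
  exists D : 'M[Zl]_n, map_mx iZ D = map_mx iQ (exp_coef (l%:R *: Z) j).
Proof.
move=> hZ.
pose P := fix P k := if k is k'.+1 then P k' *m Z else 1%:M.
have hP : P j \is a intmx.
  elim: j => [|j IH] /=; last exact: intmxM.
  by apply: mxOver_scalar; rewrite ?rpred0 ?rpred1.
have [B hB] := intmx_Zl hP; have [w hw] := pow_div_fact j.
exists (w *: B); rewrite map_mxZ /= hw hB -map_mxZ; congr map_mx.
elim: j {hP B hB w hw} => [|j IH] /=; first by rewrite expr0 fact0 divr1 scale1r.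
rewrite -IH -scalemxAl -scalemxAr !scalerA; congr (_ *: _).
rewrite factS natrM exprS; field.
by rewrite nat1r !pnatr_eq0 -!lt0n fact_gt0.
Qed.

Lemma zres_mulpow (x : Zl) k e : (k <= e)%N -> zres ((l ^ e)%:R * x) k = 0.
Proof.
move=> ke; rewrite -(subnKC ke) expnD natrM -mulrA.
by rewrite zresM zres_pow0 mul0r mod0z.
Qed.

Lemma zres_sub0 (x y : Zl) k : zres x k = zres y k -> zres (x - y) k = 0.
Proof.
move=> e; rewrite zresD e -[zres (- y) k]/((- zres y k) %% _)%Z.
by rewrite modzDmr subrr mod0z.
Qed.

Lemma zres_sum0 (I : Type) (r : seq I) (P : pred I) (F : I -> Zl) k :
  (forall i, P i -> zres (F i) k = 0) -> zres (\sum_(i <- r | P i) F i) k = 0.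
Proof.
move=> h; apply: (big_ind (fun x : Zl => zres x k = 0)) => //; first exact: zres0.
by move=> x y hx hy; rewrite zresD hx hy addr0 mod0z.
Qed.

Lemma zres_meval N (g : {mpoly Zl[N]}) (v w : 'I_N -> Zl) k :
  (forall i, zres (v i) k = zres (w i) k) -> zres (meval v g) k = zres (meval w g) k.
Proof.
move=> vw; elim/mpoly_ind_ring: g => [c|i|f g hf hg|f g hf hg].
- by rewrite !mevalC.
- by rewrite !mevalXU.
- by rewrite !mevalD !zresD hf hg.
- by rewrite !mevalM !zresM hf hg.
Qed.

Lemma zres_det n (A B : 'M[Zl]_n) k :
  (forall i j, zres (A i j) k = zres (B i j) k) -> zres (\det A) k = zres (\det B) k.
Proof.
move=> AB; rewrite /determinant.
apply: (big_ind2 (fun x y : Zl => zres x k = zres y k)) => //.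
  by move=> x y z t; rewrite !zresD => -> ->.
move=> s _; rewrite !zresM; congr ((_ * _) %% _)%Z.
apply: (big_ind2 (fun x y : Zl => zres x k = zres y k)) => //.
by move=> x y z t; rewrite !zresM => -> ->.
Qed.

Lemma iZ_inj : injective iZ.
Proof. by move=> x y /eqP; rewrite tofrac_eq => /eqP. Qed.

Lemma map_iZ_inj m n : injective (fun A : 'M[Zl]_(m, n) => map_mx iZ A).
Proof.
move=> A B /matrixP e; apply/matrixP => i j; apply: iZ_inj.
by have := e i j; rewrite !mxE.
Qed.

(** [E] is [exp(l^s (l Z))], the entrywise limit of the partial sums [S]. By [exp_vanish], an
    equation of [G] along the truncated curve has no terms of degree at most [m], and at [l^s] the
    others are divisible by [l^m]. The factor [l] of [l Z] absorbs the factorials; [s > 0] gives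
    convergence. *)
Lemma padic_exp n (G : Qsubgroup n) (Z : 'M[rat]_n) (D1 : 'M[Zl]_n) s :
  Z \is a intmx -> tangent G (l%:R *: Z) -> map_mx iZ D1 = map_mx iQ (l%:R *: Z) ->
  (0 < s)%N -> exists E C : 'M[Zl]_n, gl_points G iQ (map_mx iZ E) /\
    E = 1%:M + (l ^ s)%:R *: D1 + (l ^ (s + s))%:R *: C.
Proof.
move=> hZ tZ hD1 s0.
have /choice[D hD] := fun j => exp_coef_integral j hZ.
have D0E : D 0 = 1%:M.
  by apply: map_iZ_inj; rewrite hD /= !map_mx1.
have D1E : D 1 = D1.
  by apply: map_iZ_inj; rewrite hD hD1 /= mul1mx invr1 scale1r.
pose S m : 'M[Zl]_n := \sum_(j < m.+1) (l ^ (s * j))%:R *: D j.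
have /choice[E' hE'] : forall ij : 'I_n * 'I_n, exists y : Zl,
    forall k, zres y k = zres (S k ij.1 ij.2) k.
  move=> [i j]; apply: (@zadic_limit _ _ (fun k => S k i j)) => k.
  rewrite /S big_ord_recr /= mxE zresD mxE zres_mulpow ?addr0 ?zres_mod //.
  by rewrite ltnW // -{1}[k.+1]mul1n leq_mul.
pose E : 'M[Zl]_n := \matrix_(i, j) E' (i, j).
have hE k i j : zres (E i j) k = zres (S k i j) k by rewrite mxE hE'.
have SE t : S t.+1 = 1%:M + (l ^ s)%:R *: D1 +
    \sum_(j < t) (l ^ (s * j.+2))%:R *: D j.+2.
  rewrite /S 2!big_ord_recl /= muln0 expn0 scale1r D0E muln1 D1E addrA.
  by congr (_ + _).
(* The comparison modulo [l^(2 s)] uses the partial sum of index [2 s], whose terms from degree 2 on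
   are divisible by [l^(2 s)]. *)
have [t et] : exists t, (s + s)%N = t.+1.
  by exists (s + s).-1; rewrite prednK // addn_gt0 s0.
have /choice[C' hC'] : forall ij : 'I_n * 'I_n, exists y : Zl,
    (E - (1%:M + (l ^ s)%:R *: D1)) ij.1 ij.2 = (l ^ (s + s))%:R * y.
  move=> [i j]; apply: zadic_dvd => /=.
  rewrite mxE [X in _ + X]mxE; apply: zres_sub0.
  rewrite hE et SE mxE zresD [X in _ + X](_ : _ = 0) ?addr0 ?zres_mod //.
  rewrite summxE; apply: zres_sum0 => k _; rewrite mxE zres_mulpow //.
  by rewrite -et addnn -muln2 leq_mul.
exists E, (\matrix_(i, j) C' (i, j)); split; last first.
  apply/eqP; rewrite addrC -subr_eq; apply/eqP.
  by apply/matrixP => i j; rewrite (hC' (i, j)) !mxE.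
split.
  rewrite unitmxE det_map_mx unitfE tofrac_eq0; apply/eqP => e.
  have : zres (\det E) 1 = zres (\det (1%:M : 'M[Zl]_n)) 1.
    apply: zres_det => i j; rewrite hE (SE 0) big_ord0 addr0 mxE zresD.
    by rewrite [X in _ + zres X _]mxE zres_mulpow // addr0 zres_mod.
  rewrite e det1 zres0 -[1]/(1%:~R) zres_int expn1 modz_small //=.
  by rewrite ltz_nat prime_gt1.
move=> f Gf.
have [q q0 [g hg]] := clear_denominators f.
have qr (B : {rmorphism rat -> Ql}) : (q%:R : Ql) != 0.
  by rewrite -(rmorph_nat B) fmorph_eq0 pnatr_eq0 -lt0n.
apply: (mulfI (qr iQ)); rewrite mulr0 -(hg _ iZ iQ).
have -> : mmap iZ (entries (map_mx iZ E)) g = iZ (meval (entries E) g).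
  by apply: mmap_rmorph => // i; rewrite entries_map.
suff -> : meval (entries E) g = 0 by rewrite rmorph0.
apply: zadic_separated => m.
rewrite (@zres_meval _ g _ (entries (S m))); last first.
  by move=> i; rewrite /entries; case/mxvec_indexP: i => i j; rewrite !mxvecE hE.
pose W : 'M[{poly Zl}]_n := \sum_(j < m.+1) 'X^j *: map_mx polyC (D j).
pose P := mmap (@polyC Zl) (entries W) g.
have -> : meval (entries (S m)) g = P.[(l ^ s)%:R].
  apply: (mmap_rmorph (u := horner_eval (l ^ s)%:R)) => [x|i].
    by rewrite /= /horner_eval hornerC.
  rewrite -entries_map; congr (entries _ i).
  rewrite map_mx_sum; apply: eq_bigr => j _; rewrite map_mxZ /= /horner_eval hornerXn.
  rewrite -natrX -expnM; congr (_ *: _).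
  by apply/matrixP => a b; rewrite !mxE hornerC.
have P0 i : (i <= m)%N -> P`_i = 0.
  move=> im; apply: iZ_inj; rewrite rmorph0 -coef_map.
  have -> : map_poly iZ P = mmap (polyC \o iZ) (entries (map_mx (map_poly iZ) W)) g.
    apply/esym/mmap_rmorph => [x|j]; first by rewrite /= map_polyC.
    by rewrite entries_map.
  rewrite (hg _ (polyC \o iZ) (polyC \o iQ)).
  pose W' : 'M[{poly rat}]_n :=
    \sum_(j < m.+1) 'X^j *: map_mx polyC (exp_coef (l%:R *: Z) j).
  have -> : mmap (polyC \o iQ) (entries (map_mx (map_poly iZ) W)) f =
      map_poly iQ (mmap (@polyC rat) (entries W') f).
    apply: mmap_rmorph => [x|j]; first by rewrite /= map_polyC.
    rewrite -entries_map; congr (entries _ j).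
    rewrite !map_mx_sum; apply: eq_bigr => k _; rewrite !map_mxZ /= !map_polyXn.
    congr (_ *: _); rewrite -!map_mx_comp.
    apply/matrixP => a b; rewrite !mxE /= !map_polyC; congr (_%:P).
    by have /matrixP/(_ a b) := hD k; rewrite !mxE.
  by rewrite mulr_natl coefMn coef_map (exp_vanish tZ Gf im) raddf0 mul0rn.
rewrite horner_coef; apply: zres_sum0 => i _.
have [im|mi] := leqP i m; first by rewrite P0 // mul0r zres0.
rewrite mulrC -natrX -expnM zres_mulpow // ltnW // (leq_trans mi) //.
by rewrite -{1}[nat_of_ord i]mul1n leq_mul.
Qed.
End ZadicExp.

(** * Tangent vectors in the span of an open subgroup *)

Lemma spanning_rows (F : fieldType) N (S : set 'rV[F]_N) :
  exists p (B : 'M[F]_(p, N)), (forall i, S (row i B)) /\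
    forall s, S s -> (s <= B)%MS.
Proof.
pose P r := `[< exists p (B : 'M[F]_(p, N)), (forall i, S (row i B)) /\ \rank B = r >].
have exP : exists r, P r.
  exists 0; apply/asboolP; exists 0%N, 0; split; last exact: mxrank0.
  by case.
have bP r : P r -> (r <= N)%N.
  by move=> /asboolP[p [B [_ <-]]]; exact: rank_leq_col.
case: (ex_maxnP exP bP) => r /asboolP[p [B [SB rB]]] maxr.
exists p, B; split=> // s Ss; apply: contraT => nsB.
have : (r < \rank (col_mx s B))%N.
  rewrite -rB ltnNge; apply: contra nsB => le.
  have sub : (B <= col_mx s B)%MS by rewrite -addsmxE addsmxSr.
  have : (col_mx s B <= B)%MS by rewrite -(geq_leqif (mxrank_leqif_sup sub)).
  by apply: submx_trans; rewrite -addsmxE addsmxSl.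
rewrite ltnNge => /negP[]; apply: maxr; apply/asboolP.
exists (1 + p)%N, (col_mx s B); split=> // i.
rewrite -[i]splitK; case: (fintype.split i) => j /=.
  by rewrite rowKu row_id.
by rewrite rowKd.
Qed.

Section LieSpan.
Variables (l : nat) (hl : prime l).
Local Notation Zl := (Zadic hl).
Local Notation Ql := (Qadic hl).
Local Notation iZ := (@Zadic_to_Qadic l hl).
Local Notation iQ := (@rat_to_Qadic l hl).

Lemma qadic_denominators (I : finType) (a : I -> Ql) :
  exists e (z : I -> Zl), forall i, (l ^ e)%:R * a i = iZ (z i).
Proof.
have /choice[f hf] : forall i, exists p : nat * Zl, (l ^ p.1)%:R * a i = iZ p.2.
  by move=> i; have [k [z h]] := qadic_denominator (a i); exists (k, z).
exists (\sum_i (f i).1)%N, (fun i => (l ^ (\sum_(j | j != i) (f j).1))%:R * (f i).2) => i.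
by rewrite (bigD1 i) //= addnC expnD natrM -mulrA hf rmorphM rmorph_nat.
Qed.

(** By duality: otherwise some linear form, scaled to be integral, kills [U] but not [Z]. It kills 1
    and the points [1 + l^s (l Z) + O(l^(2 s))], which lie in [U] for large [s]; dividing their
    difference by [l^s] and letting [s] grow shows that it kills [l Z]. *)
Lemma lie_in_span n (G : Qsubgroup n) (Z : 'M[rat]_n) (U : set 'M[Ql]_n) :
  Z \is a intmx -> tangent G (l%:R *: Z) ->
  adic_open_in U (gl_points G iQ) -> U 1%:M ->
  exists e k (c : 'I_k -> Zl) (u : 'I_k -> 'M[Ql]_n), (forall i, U (u i)) /\
    (l ^ e)%:R *: map_mx iQ Z = \sum_(i < k) iZ (c i) *: u i.
Proof.
move=> hZ tZ [_ hU] U1.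
have [p [B [SB spanB]]] := spanning_rows [set mxvec u | u in U].
have lr (K : nat) : (l ^ K)%:R != 0 :> Ql.
  by rewrite -(rmorph_nat iQ) fmorph_eq0 pnatr_eq0 -lt0n expn_gt0 prime_gt0.
have [|nsub] := boolP (mxvec (map_mx iQ Z) <= B)%MS.
  case/submxP => a ea.
  have /choice[u hu] : forall i, exists u, U u /\ mxvec u = row i B.
    by move=> i; have [u Uu e] := SB i; exists u.
  have [e [c hc]] := qadic_denominators (fun i => a 0 i).
  exists e, p, c, u; split=> [i|]; first by have [] := hu i.
  apply: (can_inj mxvecK); rewrite linearZ /= ea linear_sum mulmx_sum_row scaler_sumr.
 by apply: eq_bigr => i _; rewrite [RHS]linearZ /= (hu i).2 scalerA -hc.
have [j hj] : exists j, mxvec (map_mx iQ Z) *m col j (cokermx B) != 0.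
  apply: contrapT => h; move: nsub; rewrite submxE; case/eqP.
  apply/rowP => j; rewrite [RHS]mxE; apply: contrapT => h'; apply: h; exists j.
  apply/eqP => /matrixP/(_ 0 0); rewrite mxE [in RHS]mxE => e; apply: h'.
  rewrite mxE -[RHS]e; apply: eq_bigr => k _; by rewrite [col _ _ _ _]mxE.
set lam := col j _ in hj.
have [e [z hz]] := qadic_denominators (fun i => lam i 0).
pose lam' : 'cV[Zl]_(n * n) := \col_i z i.
have elam : map_mx iZ lam' = (l ^ e)%:R *: lam.
  by apply/colP => i; rewrite [LHS]mxE [lam' _ _]mxE -hz [RHS]mxE.
have Ulam u : U u -> mxvec u *m map_mx iZ lam' = 0.
  move=> Uu; have /submxP[w ->] := spanB _ (ex_intro2 _ _ u Uu erefl).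
  by rewrite elam /lam colE -scalemxAr -mulmxA [B *m _]mulmxA mulmx_coker mul0mx mulmx0 scaler0.
have [D1 hD1] := exp_coef_integral hl 1 hZ.
rewrite /= mul1mx invr1 scale1r in hD1.
have [k0 hk0] := hU 1%:M U1.
have key : mxvec D1 *m lam' = 0.
  apply/matrixP => i i'; rewrite !ord1 [RHS]mxE; apply: zadic_separated => k.
  (* Beyond [k0] so that the exponential falls in the neighbourhood of 1 contained in [U], and
     beyond [k] for the congruence modulo [l^k]. *)
  pose s := (k + k0).+1.
  have [E [C [GE eE]]] := padic_exp hZ tZ hD1 (ltn0Sn (k + k0)).
  rewrite -/s in eE.
  have UE : U (map_mx iZ E).
    apply: hk0 => //; exists ((l ^ (s - k0))%:R *: (D1 + (l ^ s)%:R *: C)).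
    have -> : E = 1%:M + (l ^ k0)%:R *: ((l ^ (s - k0))%:R *: (D1 + (l ^ s)%:R *: C)).
      rewrite scalerA -natrM -expnD subnKC; last by rewrite /s ltnW // ltnS leq_addl.
      by rewrite scalerDr scalerA -natrM -expnD addrA.
    by rewrite map_mxD map_mx1 addrAC subrr add0r map_mxZ /= rmorph_nat.
  have e0 : mxvec (E - 1%:M) *m lam' = 0.
    apply: (@map_iZ_inj _ hl); rewrite map_mx0 map_mxM map_mxvec map_mxB map_mx1.
    by rewrite linearB mulmxBl (Ulam _ UE) (Ulam _ U1) subrr.
  have lz : (l ^ s)%:R != 0 :> Zl.
    by rewrite -tofrac_eq0 (rmorph_nat iZ) lr.
  have -> : mxvec D1 *m lam' = - ((l ^ s)%:R *: (mxvec C *m lam')).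
    apply/eqP; rewrite -addr_eq0; apply/eqP.
    have e1 : (l ^ s)%:R *: (mxvec D1 *m lam' + (l ^ s)%:R *: (mxvec C *m lam')) = 0.
      have eE1 : E - 1%:M = (l ^ s)%:R *: D1 + (l ^ (s + s))%:R *: C.
        by apply/eqP; rewrite eE subr_eq [X in _ == X]addrC addrA.
      rewrite -e0 eE1 [mxvec (_ + _)]linearD /= [mxvec (_ *: D1)]linearZ.
      rewrite [mxvec (_ *: C)]linearZ /= mulmxDl -!scalemxAl scalerDr scalerA.
      by rewrite -natrM -expnD.
    apply/matrixP => a b; apply: (mulfI lz); have /matrixP/(_ a b) := e1.
    by rewrite mxE => ->; rewrite !mxE mulr0.
  rewrite !mxE -[zres (- _) k]/((- zres _ k) %% _)%Z zres_mulpow ?oppr0 ?mod0z //.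
  by rewrite /s ltnW // ltnS leq_addr.
case/negP: hj; apply/eqP.
have := congr1 (map_mx iZ) key; rewrite map_mxM map_mxvec hD1 elam map_mx0 => h.
have lQ : (l%:R : Ql) != 0 by have := lr 1%N; rewrite expn1.
apply: (scalerI (lr e)); apply: (scalerI lQ).
rewrite map_mxZ rmorph_nat [mxvec (_ *: _)]linearZ /= -scalemxAl -scalemxAr in h.
by rewrite !scaler0 h.
Qed.
End LieSpan.

(** * The differential of the Deligne torus *)

Lemma poly_eq0_of_roots (D : idomainType) (p : {poly D}) (f : nat -> D) :
  injective f -> (forall k, p.[f k] = 0) -> p = 0.
Proof.
move=> injf hf; apply: (@roots_geq_poly_eq0 _ p (map f (iota 0 (size p)))).
- by apply/allP => x /mapP[k _ ->]; apply/eqP.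
- by rewrite map_inj_uniq ?iota_uniq.
- by rewrite size_map size_iota.
Qed.

Definition pt2 (A : Type) (a b : A) : 'I_2 -> A := fun i => if i == 0 then a else b.

Lemma mmap2E (R S : comNzRingType) (phi : {rmorphism R -> S}) (a b : S) u :
  mmap phi (pt2 a b) u = \sum_(m <- msupp u) phi u@_m * (a ^+ m 0 * b ^+ m 1).
Proof.
rewrite /mmap; apply: eq_bigr => m _; congr (_ * _).
rewrite /mmap1 big_ord_recl big_ord1.
have -> : lift ord0 ord0 = 1 :> 'I_2 by apply: val_inj.
by [].
Qed.

Lemma mnm2_eq (m m' : 'X_{1..2}) : m 0 = m' 0 -> m 1 = m' 1 -> m = m'.
Proof.
move=> e0 e1; apply/mnmP => i.
by case: i => [[|[|//]] hi]; [move: e0 | move: e1]; congr (_ = _); congr (_ _); apply: val_inj.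
Qed.

Section Vanishing.
Variable R : numFieldType.
Implicit Types u : {mpoly R[2]}.

Lemma natr_inj_num : injective (fun k : nat => k%:R : R).
Proof. by move=> j k /eqP; rewrite eqr_nat => /eqP. Qed.

Lemma mpoly2_eq0 u : (forall a b, meval (pt2 a b) u = 0) -> u = 0.
Proof.
move=> h; pose T := mmap (polyC \o polyC) (pt2 ('X%:P) 'X) u : {poly {poly R}}.
have ev a b : T.[b%:P].[a] = 0.
  rewrite -[RHS](h a b) /meval.
  apply/esym/(mmap_rmorph (u := horner_eval a \o horner_eval b%:P)) => [x|i].
    by rewrite /= /horner_eval !hornerC.
  rewrite /pt2 /= /horner_eval; case: (i == 0); last by rewrite hornerX hornerC.
  by rewrite hornerC hornerX.
have T0 : T = 0.
  apply: (@poly_eq0_of_roots _ _ (fun k => k%:R%:P)) => [j k /polyC_inj /natr_inj_num //|k].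
  by apply: (poly_eq0_of_roots natr_inj_num) => j; apply: ev.
apply/mpolyP => m; rewrite mcoeff0; have /(congr1 (fun p : {poly {poly R}} => p`_(m 1)`_(m 0))) := T0.
rewrite !coef0 /T mmap2E !coef_sum.
have [mu|mu] := boolP (m \in msupp u); last by rewrite memN_msupp_eq0.
have cf (x : R) (i j i' j' : nat) :
    (x%:P%:P * ('X%:P ^+ i * 'X^j) : {poly {poly R}})`_j'`_i' = x * ((i' == i) && (j' == j))%:R.
  rewrite -rmorphXn /= mulrA -rmorphM /= coefCM coefXn.
  by case: (j' == j); rewrite ?andbF ?andbT ?mulr1 ?mulr0 ?coef0 // coefCM coefXn.
rewrite (bigD1_seq m) //= cf !eqxx mulr1 big1 ?addr0 // => m' m'm.
rewrite cf; case: eqP => [e0|]; last by rewrite mulr0.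
case: eqP => [e1|]; last by rewrite mulr0.
by case/eqP: m'm; apply: mnm2_eq.
Qed.

Lemma mcoeff_axis u : (forall a, a != 0 -> meval (pt2 a 0) u = 0) ->
  forall m : 'X_{1..2}, m 1 = 0%N -> u@_m = 0.
Proof.
move=> h m m1; pose p := mmap (@polyC R) (pt2 'X 0) u.
have ev a : p.[a] = meval (pt2 a 0) u.
  apply/esym/(mmap_rmorph (u := horner_eval a)) => [x|i].
    by rewrite /= /horner_eval hornerC.
  by rewrite /pt2 /= /horner_eval; case: (i == 0); rewrite ?hornerX ?horner0.
have /(congr1 (fun q : {poly R} => q`_(m 0))) : p = 0.
  apply: (@poly_eq0_of_roots _ _ (fun k => k.+1%:R)) => [j k /natr_inj_num [] //|k].
  by rewrite ev h // pnatr_eq0.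
rewrite coef0 /p mmap2E coef_sum.
have [mu|mu] := boolP (m \in msupp u); last by move=> _; rewrite memN_msupp_eq0.
have cf (x : R) i j i' : (x%:P * ('X ^+ i * 0 ^+ j) : {poly R})`_i' = x * ((i' == i) && (j == 0%N))%:R.
  rewrite coefCM expr0n; case: (j == _); rewrite ?andbF ?andbT ?mulr1 ?mulr0 ?coef0 ?mulr0 //.
  by rewrite coefXn.
rewrite (bigD1_seq m) //= cf m1 !eqxx mulr1 big1 ?addr0 // => m' m'm.
rewrite cf; case: eqP => [e0|]; last by rewrite mulr0.
case: eqP => [e1|]; last by rewrite mulr0.
by case/eqP: m'm; apply: mnm2_eq; rewrite ?e1 ?m1.
Qed.
End Vanishing.

Lemma scalemx_unit_inj (B : comUnitRingType) m p (c : B) (X Y : 'M[B]_(m, p)) :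
  c \is a GRing.unit -> c *: X = c *: Y -> X = Y.
Proof.
move=> uc /matrixP e; apply/matrixP => i j; apply: (mulrI uc).
by have := e i j; rewrite !mxE.
Qed.

Section HodgeTangent.
Variables (R : realType) (n : nat) (s : S_rep R n).
Local Notation num := (S_num s).
Local Notation dR := (dual R^o).

(** The point [1 + eps i], tangent to the unit circle at 1. *)
Definition S_eps : dR * dR := (Dual 1 0, Dual 0 1).

(** Only the numerator is differentiated: [a^2 + b^2] equals 1 at [(1, 0)] and is stationary there
    in the direction of [b]. *)
Definition hodge_tangent : 'M[R]_n :=
  \matrix_(i, j) meval (pt2 1 0) (mderiv 1 (num i j)).

(** The vector field generating rotations. It annihilates [X_0^2 + X_1^2], which is why the
    denominator of [s] drops out of [rot_deriv_num]. *)
Definition rot_deriv (p : {mpoly R[2]}) : {mpoly R[2]} :=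
  'X_0 * mderiv 1 p - 'X_1 * mderiv 0 p.

Lemma S_valE (A : comUnitAlgType R) (z : A * A) :
  S_val s z = (S_norm z) ^- S_den s *: map_mx (mmap (in_alg A) (pt2 z.1 z.2)) num.
Proof. by []. Qed.

Lemma mmap_real (a b : R) (p : {mpoly R[2]}) :
  mmap (in_alg R^o) (pt2 (a : R^o) (b : R^o)) p = meval (pt2 a b) p.
Proof.
by rewrite /meval /mmap; apply: eq_bigr => m _; rewrite /= /GRing.scale /= mulr1.
Qed.

Lemma mderiv_var (i j : 'I_2) (a b : R) :
  meval (pt2 a b) (mderiv j 'X_i) = (i == j)%:R.
Proof.
rewrite mderivX mevalZ mnm1E; case: eqP => [->|]; last by rewrite mul0r.
have -> : (U_(j) - U_(j))%MM = 0%MM :> 'X_{1..2}.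
  by apply/mnmP => k; rewrite mnmBE subnn mnm0E.
by rewrite mpolyX0 meval1 mulr1.
Qed.

Lemma mmap_dual2 (a b u v : R) (p : {mpoly R[2]}) :
  mmap (in_alg dR) (pt2 (Dual (a : R^o) u) (Dual (b : R^o) v)) p =
  Dual (meval (pt2 a b) p : R^o)
    (u * meval (pt2 a b) (mderiv 0 p) + v * meval (pt2 a b) (mderiv 1 p) : R).
Proof.
elim/mpoly_ind_ring: p => [c|i|p q hp hq|p q hp hq].
- rewrite mmapC !mderivC !meval0 !mulr0 addr0 mevalC.
  by apply: dual_ext; rewrite /= ?scaler0 // /GRing.scale /= mulr1.
- rewrite mmapX mmap1U !mderiv_var mevalXU.
  have [->|->] : i = 0 \/ i = 1.
    by case: i => [[|[|//]] hi]; [left | right]; apply: val_inj.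
  + by apply: dual_ext => //=; rewrite mulr1 mulr0 addr0.
  + by apply: dual_ext => //=; rewrite mulr1 mulr0 add0r.
- by rewrite mmapD hp hq !mderivD !mevalD; apply: dual_ext => //=; ring.
- rewrite rmorphM /= hp hq !mderivM !mevalD !mevalM.
  by apply: dual_ext => //=; ring.
Qed.

Lemma S_norm_eps : S_norm S_eps = 1.
Proof. by apply: dual_ext; rewrite /=; ring. Qed.

Lemma S_points_eps : S_points S_eps.
Proof. by rewrite /S_points /= S_norm_eps unitr1. Qed.

Lemma S_val_eps : S_val s S_eps = 1%:M + dual_mx (hodge_tangent : 'M[R^o]_n).
Proof.
rewrite S_valE S_norm_eps expr1n invr1 scale1r; apply/matrixP => i j.
rewrite mxE (mmap_dual2 1 0 0 1) !mxE mul0r mul1r add0r.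
have /matrixP/(_ i j) := S_val1 s R^o.
rewrite S_valE /S_norm /= expr1n expr0n addr0 expr1n invr1 scale1r !mxE mmap_real => ->.
by case: (i == j); apply: dual_ext; rewrite /= ?addr0 ?add0r.
Qed.

Lemma rot_derivE (a b : R) p :
  meval (pt2 a b) (rot_deriv p) =
  a * meval (pt2 a b) (mderiv 1 p) - b * meval (pt2 a b) (mderiv 0 p).
Proof. by rewrite /rot_deriv mevalB !mevalM !mevalXU. Qed.

(* Differentiate [s (z * w) = s z * s w] at [w = 1] in the direction of the
   circle: [z * (1 + eps i) = z + eps i z]. *)
Lemma rot_deriv_num :
  map_mx rot_deriv num = num *m map_mx (@mpolyC 2 R) hodge_tangent.
Proof.
apply/matrixP => i j; rewrite mxE.
set q := _ i j; apply/eqP; rewrite -subr_eq0; apply/eqP.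
have N0 : 'X_0 ^+ 2 + 'X_1 ^+ 2 != 0 :> {mpoly R[2]}.
  apply/eqP => /(congr1 (meval (pt2 1 0))) /eqP.
  by rewrite mevalD !rmorphXn /= !mevalXU meval0 expr1n expr0n addr0 oner_eq0.
(* The law of [s] gives the identity only where [a^2 + b^2] is invertible; multiplying by this
   polynomial allows testing at all real points. *)
apply: (mulfI N0); rewrite mulr0; apply: mpoly2_eq0 => a b.
rewrite mevalM mevalD !rmorphXn /= !mevalXU /=.
have [->|nz] := eqVneq (a ^+ 2 + b ^+ 2) 0; first by rewrite mul0r.
apply/eqP; rewrite mulf_eq0 (negPf nz) /= mevalB subr_eq0; apply/eqP.
pose z : dR * dR := (Dual a 0, Dual b 0).
have Nz : S_norm z = Dual (a ^+ 2 + b ^+ 2) 0.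
  by apply: dual_ext; rewrite /=; ring.
have uN : S_norm z \is a GRing.unit.
  by rewrite Nz; change ((a ^+ 2 + b ^+ 2 : R^o) \is a GRing.unit); rewrite unitfE.
have zE : S_mul z S_eps = (Dual a (- b), Dual b a).
  by congr pair; apply: dual_ext; rewrite /=; ring.
have NE : S_norm (S_mul z S_eps) = S_norm z.
  by rewrite zE Nz; apply: dual_ext; rewrite /=; ring.
have := S_valM s uN S_points_eps.
rewrite !(S_valE z) (S_valE (S_mul z S_eps)) NE zE S_val_eps -scalemxAl.
have uNd : S_norm z ^- S_den s \is a GRing.unit by rewrite unitrV unitrX.
move=> /(scalemx_unit_inj uNd) /matrixP/(_ i j).
rewrite mxE (mmap_dual2 a b (- b) a) => /(congr1 (@deps _)) /=.
rewrite rot_derivE addrC -mulNr => ->.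
rewrite /q mxE mxE !raddf_sum /=; apply: eq_bigr => k _.
rewrite !mxE (mmap_dual2 a b 0 0) mevalM mevalC /= !mul0r addr0.
by rewrite mul0r addr0; case: (k == j); rewrite /= add0r.
Qed.

Definition num_coef (m : 'X_{1..2}) : 'M[R]_n := map_mx (mcoeff m) num.

Lemma mcoeffXM (i : 'I_2) (p : {mpoly R[2]}) (m : 'X_{1..2}) : (0 < m i)%N ->
  ('X_i * p)@_m = p@_(m - U_(i)).
Proof.
move=> mi; have {1}<- : (U_(i) + (m - U_(i)))%MM = m.
  rewrite addmC; apply: submK; apply/mnm_lepP => k; rewrite mnm1E.
  by case: eqP => // <-.
by rewrite mulrC mcoeffMX.
Qed.

Lemma mcoeffXM0 (i : 'I_2) (p : {mpoly R[2]}) (m : 'X_{1..2}) : m i = 0%N ->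
  ('X_i * p)@_m = 0.
Proof.
move=> mi; rewrite mcoeffM big1 // => k /eqP mk; rewrite mcoeffX.
case: eqP => [e|]; last by rewrite mul0r.
have := congr1 (fun x : 'X_{1..2} => x i) mk.
by rewrite -e mnmDE mnm1E eqxx mi.
Qed.

(** Compare coefficients in [rot_deriv_num] at [m'], which is [m] with one unit moved from the
    second exponent to the first. There the first term of [rot_deriv] contributes [m 1] times the
    coefficient at [m], and the second a multiple of the one at [m''], where two units have
    moved. *)
Lemma coef_rec (m : 'X_{1..2}) : (0 < m 1%R)%N -> exists (m' m'' : 'X_{1..2}) (c : R),
  [/\ (m' 1%R < m 1%R)%N, (m'' 1%R < m 1%R)%N &
    (m 1)%:R *: num_coef m = num_coef m' *m hodge_tangent + c *: num_coef m''].
Proof.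
move=> m1; pose m' := (m - U_(1) + U_(0%R))%MM.
have m'1 : m' 1 = (m 1%R).-1.
  by rewrite mnmDE mnmBE !mnm1E /= addn0 subn1.
have m'0 : (0 < m' 0%R)%N by rewrite mnmDE mnm1E eqxx addn1.
have mE : (m' - U_(0%R) + U_(1))%MM = m.
  rewrite addmK; apply: submK; apply/mnm_lepP => i; rewrite mnm1E.
  by case: eqP => // <-; exact: m1.
have mp : m' 1 = 0%N \/ (0 < m' 1%R)%N by case: (m' 1); [left | right].
have lead (p : {mpoly R[2]}) : ('X_0 * mderiv 1 p)@_m' = (m 1)%:R * p@_m.
  rewrite mcoeffXM // mcoeff_deriv mE mulr_natl; congr (_ *+ _).
  by have := congr1 (fun x : 'X_{1..2} => x 1) mE; rewrite mnmDE mnm1E eqxx addn1.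
have rec i j : (rot_deriv (num i j))@_m' = (num_coef m' *m hodge_tangent) i j.
  have /matrixP/(_ i j) := rot_deriv_num; rewrite mxE => ->.
  rewrite !mxE raddf_sum; apply: eq_bigr => k _.
  by rewrite !mxE /= [_ * _%:MP]mulrC mcoeffCM mulrC.
have m'lt : (m' 1%R < m 1%R)%N by rewrite m'1 prednK.
case: mp => m'1_.
  (* The second term of [rot_deriv] contributes nothing here; [m'] is a placeholder with weight
     0. *)
  exists m', m', 0; split=> //; rewrite scale0r addr0; apply/matrixP => i j.
  by rewrite -rec /rot_deriv mcoeffB lead mcoeffXM0 // subr0 !mxE.
pose m'' := (m' - U_(1) + U_(0%R))%MM.
exists m', m'', (((m' - U_(1))%MM 0%R).+1)%:R; split=> //.
  rewrite mnmDE mnmBE !mnm1E /= addn0 subn1.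
  by apply: leq_ltn_trans (leq_pred _) m'lt.
apply/matrixP => i j; rewrite [RHS]mxE -rec /rot_deriv mcoeffB lead mcoeffXM //.
by rewrite mcoeff_deriv !mxE !mulr_natl subrK.
Qed.

(** By [coef_rec] all coefficients of the numerator arise from those of the powers of [X_0], which
    are scalar because [s] is scalar on the real axis. This replaces exponentiating [Y]: a linear
    condition that holds for scalars and is closed under right multiplication by [Y] passes to
    [s]. *)
Lemma coef_ind (w : int) (K : 'M[R]_n -> Prop) :
  (forall (A : comUnitAlgType R) (t : A), t \is a GRing.unit ->
     S_val s (t, 0) = (t ^ w)%:M) ->
  (forall c, K c%:M) -> (forall P Q, K P -> K Q -> K (P + Q)) ->
  (forall c P, K P -> K (c *: P)) -> (forall P, K P -> K (P *m hodge_tangent)) ->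
  forall m, K (num_coef m).
Proof.
move=> pure K1 KD KZ KY.
have axis (a : R) : a != 0 -> exists c : R, map_mx (meval (pt2 a 0)) num = c%:M.
  move=> a0; have ua : (a : R^o) \is a GRing.unit by rewrite unitfE.
  have := pure R^o a ua.
  rewrite S_valE /S_norm /= expr0n addr0.
  set N := (a ^+ 2 : R^o) => e; exists (N ^+ S_den s * (a : R^o) ^ w).
  have uN : (N ^- S_den s : R^o) \is a GRing.unit.
    by rewrite unitrV unitrX // unitrX.
  have N0 : N != 0 by rewrite expf_neq0.
  apply/matrixP => i j; apply: (mulrI uN).
  have /matrixP/(_ i j) := e; rewrite !mxE mmap_real => ->.
  by rewrite -mulrnAr mulrA mulVr ?mul1r // unitrX // unitrX.
suff H k (m : 'X_{1..2}) : (m 1%R <= k)%N -> K (num_coef m) by move=> m; exact: (H (m 1)).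
elim: k m => [|k IH] m.
  rewrite leqn0 => /eqP m1.
  (* For [n = 0] there is no diagonal entry from which to read off the scalar. *)
  case: (pickP (fun _ : 'I_n => true)) => [i0 _|none]; last first.
    suff -> : num_coef m = 0%:M by exact: K1.
    by apply/matrixP => i; have := none i.
  suff -> : num_coef m = ((num i0 i0)@_m)%:M by exact: K1.
  apply/matrixP => i j; rewrite !mxE; case: eqP => [<-|ij].
    rewrite mulr1n; apply/eqP; rewrite -subr_eq0 -mcoeffB; apply/eqP.
    apply: mcoeff_axis m1 => a a0; have [c /matrixP e] := axis a a0.
    have := e i i; have := e i0 i0; rewrite !mxE !eqxx mevalB => -> ->.
    exact: subrr.
  apply: mcoeff_axis m1 => a a0; have [c /matrixP/(_ i j)] := axis a a0.
  by rewrite !mxE => ->; case: eqP ij.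
rewrite leq_eqVlt => /orP[/eqP m1|]; last exact: IH.
have m1_gt0 : (0 < m 1%R)%N by rewrite m1.
have [m' [m'' [c [lt' lt'' e]]]] := coef_rec m1_gt0.
have -> : num_coef m = (m 1)%:R^-1 *: ((m 1)%:R *: num_coef m).
  by rewrite scalerA mulVf ?scale1r // pnatr_eq0 m1.
rewrite e; apply/KZ/KD; first by apply/KY/IH; rewrite -ltnS -m1.
by apply/KZ/IH; rewrite -ltnS -m1.
Qed.
End HodgeTangent.

(** Take [d] minimal: a rational relation [q] between the entries of [r] with [q i] nonzero would
    allow [r i] to be eliminated. The rows of [C] are the rational components of [y]. *)
Lemma rational_coordinates (F : numFieldType) N (y : 'rV[F]_N) :
  exists d (r : 'rV[F]_d) (C : 'M[rat]_(d, N)), y = r *m map_mx ratr C /\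
    forall q : 'cV[rat]_d, r *m map_mx ratr q = 0 -> q = 0.
Proof.
pose P d := `[< exists (r : 'rV[F]_d) (C : 'M[rat]_(d, N)), y = r *m map_mx ratr C >].
have exP : exists d, P d.
  by exists N; apply/asboolP; exists y, 1%:M; rewrite map_mx1 mulmx1.
case: (ex_minnP exP) => d /asboolP[r [C e]] mind.
exists d, r, C; split=> // q rq; apply: contrapT => /eqP q0.
have [i qi] : exists i, q i 0 != 0.
  apply: contrapT => h; case/eqP: q0; apply/colP => i; rewrite [RHS]mxE.
  by apply: contrapT => /eqP h'; apply: h; exists i.
case: d => [|d] in r C e mind q rq q0 i qi *; first by case: i qi.
have : P d.
  apply/asboolP; pose C' := C - (q i 0)^-1 *: (q *m row i C).
  have e' : y = r *m map_mx ratr C'.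
    rewrite e /C' map_mxB map_mxZ map_mxM mulmxBr -scalemxAr mulmxA rq mul0mx.
    by rewrite scaler0 subr0.
  exists (col' i r), (row' i C'); rewrite e'; apply/rowP => j; rewrite !mxE.
  rewrite (bigD1_ord i) //= [map_mx _ _ i j]mxE.
  have -> : C' i j = 0.
    by rewrite /C' !mxE big_ord1 !mxE mulrA mulVf // mul1r subrr.
  by rewrite rmorph0 mulr0 add0r; apply: eq_bigr => k _; rewrite !mxE.
by move/mind; rewrite ltnn.
Qed.

Section HodgeLie.
Variables (R : realType) (n : nat) (s : S_rep R n).
Local Notation num := (S_num s).
Local Notation Y := (hodge_tangent s).

Lemma mcoeff_mulC_l p q r (V : 'M[R]_(p, q)) (X : 'M[{mpoly R[2]}]_(q, r)) m :
  map_mx (mcoeff m) (map_mx (@mpolyC 2 R) V *m X) = V *m map_mx (mcoeff m) X.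
Proof.
apply/matrixP => i j; rewrite !mxE raddf_sum; apply: eq_bigr => k _.
by rewrite !mxE /= mcoeffCM.
Qed.

Lemma mcoeff_mulC_r p q r (V : 'M[R]_(q, r)) (X : 'M[{mpoly R[2]}]_(p, q)) m :
  map_mx (mcoeff m) (X *m map_mx (@mpolyC 2 R) V) = map_mx (mcoeff m) X *m V.
Proof.
apply/matrixP => i j; rewrite !mxE raddf_sum; apply: eq_bigr => k _.
by rewrite !mxE /= [_ * _%:MP]mulrC mcoeffCM mulrC.
Qed.

Lemma mpoly_mx_eq p q (X X' : 'M[{mpoly R[2]}]_(p, q)) :
  (forall m, map_mx (mcoeff m) X = map_mx (mcoeff m) X') -> X = X'.
Proof.
move=> h; apply/matrixP => i j; apply/mpolyP => m.
by have /matrixP/(_ i j) := h m; rewrite !mxE.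
Qed.

Lemma map_mevalC p q (v : 'I_2 -> R) (A : 'M[R]_(p, q)) :
  map_mx (meval v) (map_mx (@mpolyC 2 R) A) = A.
Proof. by apply/matrixP => i j; rewrite !mxE /= mevalC. Qed.

Section Pure.
Variable w : int.
Hypothesis pure : forall (A : comUnitAlgType R) (t : A), t \is a GRing.unit ->
  S_val s (t, 0) = (t ^ w)%:M.

Lemma commute_S_val (g : 'M[rat]_n) : map_mx ratr g *m Y = Y *m map_mx ratr g ->
  forall (A : comUnitAlgType R) (z : A * A),
  map_mx (@rat_in_alg R A) g *m S_val s z = S_val s z *m map_mx (@rat_in_alg R A) g.
Proof.
move=> gY A z; set G := map_mx ratr g in gY.
have C m : G *m num_coef s m = num_coef s m *m G.
  apply: (coef_ind (K := fun P => G *m P = P *m G) pure).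
  - by move=> c; rewrite scalar_mxC.
  - by move=> P Q hP hQ; rewrite mulmxDr mulmxDl hP hQ.
  - by move=> c P hP; rewrite -scalemxAr -scalemxAl hP.
  - by move=> P hP; rewrite mulmxA hP -!mulmxA gY.
have E : map_mx (@mpolyC 2 R) G *m num = num *m map_mx (@mpolyC 2 R) G.
  by apply: mpoly_mx_eq => m; rewrite mcoeff_mulC_l mcoeff_mulC_r C.
have -> : map_mx (@rat_in_alg R A) g = map_mx (mmap (in_alg A) (pt2 z.1 z.2)) (map_mx (@mpolyC 2 R) G).
  by apply/matrixP => i j; rewrite !mxE mmapC.
by rewrite S_valE -scalemxAl -scalemxAr -!map_mxM E.
Qed.

Lemma stable_S_val p (V : 'M[R]_(p, n)) : (V *m Y^T <= V)%MS ->
  (V *m (S_val s (0 : R^o, 1 : R^o) : 'M[R]_n)^T <= V)%MS.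
Proof.
move=> VY; set W := cokermx V.
have C m : V *m (num_coef s m)^T *m W = 0.
  apply: (coef_ind (K := fun P => V *m P^T *m W = 0) pure).
  - by move=> c; rewrite tr_scalar_mx mul_mx_scalar -scalemxAl mulmx_coker scaler0.
  - by move=> P Q hP hQ; rewrite linearD /= mulmxDr mulmxDl hP hQ addr0.
  - by move=> c P hP; rewrite linearZ /= -scalemxAr -scalemxAl hP scaler0.
  - move=> P hP; rewrite trmx_mul [V *m (_ *m _)]mulmxA; have /submxP[X ->] := VY.
    by rewrite -mulmxA -mulmxA [V *m (_ *m _)]mulmxA hP mulmx0.
have E : map_mx (@mpolyC 2 R) V *m num^T *m map_mx (@mpolyC 2 R) W = 0.
  apply: mpoly_mx_eq => m; rewrite mcoeff_mulC_r mcoeff_mulC_l -matrix.map_trmx C.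
  by rewrite map_mx0.
rewrite submxE; apply/eqP.
have -> : (S_val s (0 : R^o, 1 : R^o) : 'M[R]_n) = map_mx (meval (pt2 0 1)) num.
  rewrite S_valE /S_norm /= expr0n expr1n add0r expr1n invr1 scale1r.
  by apply/matrixP => i j; rewrite !mxE mmap_real.
have := congr1 (map_mx (meval (pt2 0 1))) E; rewrite map_mx0 !map_mxM -matrix.map_trmx => <-.
by rewrite !map_mevalC.
Qed.
End Pure.
End HodgeLie.

Lemma dual_mxMl (A : comUnitRingType) m n p (X : 'M[A]_(m, n)) (B : 'M[A]_(n, p)) :
  dual_mx X *m map_mx (@dual_const A) B = dual_mx (X *m B).
Proof.
apply/matrixP => i j; rewrite !mxE.
transitivity (\sum_k Dual 0 (X i k * B k j)).
  apply: eq_bigr => k _; rewrite !mxE; apply: dual_ext; rewrite /= ?mul0r ?add0r //.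
by apply: dual_ext; rewrite raddf_sum // big1.
Qed.

Lemma dual_mxMr (A : comUnitRingType) m n p (B : 'M[A]_(m, n)) (X : 'M[A]_(n, p)) :
  map_mx (@dual_const A) B *m dual_mx X = dual_mx (B *m X).
Proof.
apply/matrixP => i j; rewrite !mxE.
transitivity (\sum_k Dual 0 (B i k * X k j)).
  apply: eq_bigr => k _; rewrite !mxE; apply: dual_ext; rewrite /= ?mulr0 ?mul0r ?addr0 //.
by apply: dual_ext; rewrite raddf_sum // big1.
Qed.

Lemma dual_mx_skew (A : comUnitRingType) n (X P : 'M[A]_n) :
  (1%:M + dual_mx X)^T *m map_mx (@dual_const A) P *m (1%:M + dual_mx X) =
  map_mx (@dual_const A) P -> X^T *m P + P *m X = 0.
Proof.
have -> : (1%:M + dual_mx X)^T = 1%:M + dual_mx X^T.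
  by rewrite linearD /= trmx1; congr (_ + _); apply/matrixP => i j; rewrite !mxE.
rewrite mulmxDl mul1mx dual_mxMl mulmxDr mulmx1 mulmxDl dual_mxM0 addr0 dual_mxMr.
rewrite -addrA -[RHS]addr0 => /addrI /matrixP h; apply/matrixP => i j.
by have /(congr1 (@deps _)) := h i j; rewrite !mxE.
Qed.

Section HodgeLie.
Variables (R : realType) (n : nat) (s : S_rep R n).
Local Notation Y := (hodge_tangent s).

(** The [r i] being independent over Q, a rational linear condition on [Y] holds for each [b i]:
    this gives tangency and skewness for [psi]. By skewness the [psi]-orthogonal of a stable [U] is
    stable; it meets [U] trivially because the real span of [U] is stable under [s(i)] and
    [psi(x, s(i) x) > 0]. Transposes occur because the lattice theorem acts on rows, and multiples
    because only multiples of the [b i] preserve lattices. *)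
Theorem hodge_lie (Lam : set 'cV[rat]_n) (w : int) (psi : 'M[rat]_n) (M : Qsubgroup n) :
  is_polarisation Lam s w psi -> factors_through s M ->
  exists d (b : 'I_d -> 'M[rat]_n), [/\ forall i q, tangent M (q *: b i),
    forall N : nat, (0 < N)%N -> semisimple (fun i => N%:R *: (b i)^T) &
    forall g, (forall i, g *m b i = b i *m g) ->
      forall (A : comUnitAlgType R) (z : A * A),
      map_mx (@rat_in_alg R A) g *m S_val s z = S_val s z *m map_mx (@rat_in_alg R A) g].
Proof.
move=> pol sM; have pure := pol_pure pol.
have [d [r [C [eY indep]]]] := rational_coordinates (mxvec Y).
pose b i := vec_mx (row i C).
have YE : Y = \sum_i r 0 i *: map_mx ratr (b i).
  apply: (can_inj mxvecK); rewrite eY mulmx_sum_row linear_sum.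
  apply: eq_bigr => i _; rewrite linearZ /= -map_mxvec; congr (_ *: _).
  by rewrite /b vec_mxK map_row.
have indep_mx p q (B : 'I_d -> 'M[rat]_(p, q)) :
    \sum_k r 0 k *: map_mx ratr (B k) = 0 -> forall k, B k = 0.
  move=> h k; apply/matrixP => i j; rewrite [RHS]mxE.
  suff /colP/(_ k) : \col_k B k i j = 0 by rewrite !mxE.
  apply: indep; apply/rowP => j'; rewrite !mxE.
  have /matrixP/(_ i j) := h; rewrite summxE [RHS]mxE => e; rewrite -[RHS]e.
  by apply: eq_bigr => k' _; rewrite !mxE.
(* The invariance of [psi] is differentiated: at [1 + eps i] the norm is 1, so the multiplier
   disappears. *)
have skew i : (b i)^T *m psi + psi *m b i = 0.
  apply: (indep_mx _ _ (fun i => (b i)^T *m psi + psi *m b i)).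
  have : Y^T *m map_mx ratr psi + map_mx ratr psi *m Y = 0 :> 'M[R]_n.
    apply: (@dual_mx_skew R^o).
    have := pol_mor pol (S_points_eps R).
    rewrite S_norm_eps S_val_eps.
    rewrite exp1rz.
    rewrite scale1r.
    have -> : map_mx (@rat_in_alg R (dual R^o)) psi = map_mx (@dual_const R^o) (map_mx ratr psi).
      apply/matrixP => k j; rewrite !mxE; apply: dual_ext; rewrite /= ?scaler0 //.
      by rewrite /GRing.scale /= mulr1.
    by [].
  move=> e; rewrite -[RHS]e YE linear_sum mulmx_suml mulmx_sumr -big_split; apply: eq_bigr => k _ /=.
  rewrite map_mxD !map_mxM scalerDr -matrix.map_trmx linearZ /=.
  by rewrite -scalemxAl -scalemxAr.
exists d, b; split.
- move=> i q.
  have := sM (dual R^o) (S_eps R) (S_points_eps R); rewrite S_val_eps => /tangent_descent.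
  apply=> c hc.
  have dreE x : dre (@rat_in_alg R (dual R^o) x) = ratr x.
    by rewrite /= /GRing.scale /= mulr1.
  pose B k : 'M[rat]_1 := (\sum_i c i * entries (b k) i)%:M.
  have /(_ i) : forall k, B k = 0.
    apply: indep_mx; apply/matrixP => k j; rewrite !ord1 [RHS]mxE -[RHS]hc.
    rewrite summxE YE.
    transitivity (\sum_i \sum_k0 ratr (c i) * (r 0 k0 * ratr (entries (b k0) i))).
      rewrite exchange_big; apply: eq_bigr => k0 _.
      rewrite !mxE mulr1n rmorph_sum mulr_sumr; apply: eq_bigr => p _.
      by rewrite rmorphM mulrCA.
    apply: eq_bigr => p _; rewrite -mulr_sumr dreE; congr (_ * _).
    rewrite /entries linear_sum summxE; apply: eq_bigr => k0 _.
    by rewrite linearZ /= mxE -map_mxvec mxE.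
  move=> /matrixP/(_ 0 0); rewrite !mxE mulr1n => e0.
  rewrite -[RHS](mulr0 q) -[X in _ = q * X]e0 mulr_sumr; apply: eq_bigr => p _.
  by rewrite /entries linearZ mxE mulrCA.
- move=> N N0 U stU.
  have Nr : (N%:R : rat) != 0 by rewrite pnatr_eq0 -lt0n.
  have stU' i : (U *m (b i)^T <= U)%MS.
    by have := stU i; rewrite -scalemxAr (eqmx_scale _ Nr).
  pose D := kermx (psi *m U^T).
  have stR : (map_mx ratr U *m Y^T <= map_mx (ratr : rat -> R) U)%MS.
    rewrite YE linear_sum mulmx_sumr; apply: summx_sub => i _ /=.
    rewrite linearZ /= -scalemxAr; apply: scalemx_sub.
    by rewrite matrix.map_trmx -map_mxM map_submx.
  have stS := stable_S_val pure stR.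
  have cap0 : (U :&: D = 0)%MS.
    apply/eqP; rewrite -submx0; apply/rV_subP => x; rewrite sub_capmx sub_kermx.
    case/andP => /submxP[a ea] /eqP xD; apply: contraT; rewrite submx0 => x0.
    set xR := map_mx (ratr : rat -> R) x.
    have : xR^T != 0 by rewrite -(inj_eq (@trmx_inj _ _ _)) trmxK trmx0 map_mx_eq0.
    move/(pol_pos pol); rewrite trmxK.
    have : (xR *m (S_val s (0 : R^o, 1 : R^o) : 'M[R]_n)^T <= map_mx (ratr : rat -> R) U)%MS.
      by apply: submx_trans stS; rewrite submxMr // map_submx ea submxMl.
    case/submxP => a' ea'.
    have SxR : (S_val s (0 : R^o, 1 : R^o) : 'M[R]_n) *m xR^T = (map_mx ratr U)^T *m a'^T.
      by rewrite -trmx_mul -ea' trmx_mul trmxK.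
    rewrite /pol_form -!mulmxA SxR matrix.map_trmx !mulmxA -!map_mxM -mulmxA xD.
    by rewrite map_mx0 mul0mx mxE ltxx.
  exists D; split=> //.
  + move=> i; rewrite sub_kermx -scalemxAr -scalemxAl -mulmxA [(b i)^T *m _]mulmxA.
    have -> : (b i)^T *m psi = - (psi *m b i).
      by apply/eqP; rewrite -addr_eq0; apply/eqP.
    have /submxP[X eX] := stU' i.
    have e1 : b i *m U^T = U^T *m X^T by rewrite -trmx_mul -eX trmx_mul trmxK.
    rewrite mulNmx -[psi *m b i *m _]mulmxA e1 [psi *m (_ *m _)]mulmxA.
    by rewrite mulmxN mulmxA mulmx_ker mul0mx oppr0 scaler0.
  + rewrite -col_leq_rank mxrank_disjoint_sum // mxrank_ker.
    have : (\rank (psi *m U^T) <= \rank U)%N by rewrite (leq_trans (mxrankM_maxr _ _)) // mxrank_tr.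
    have := rank_leq_row (psi *m U^T); lia.
- move=> g gb; apply: (commute_S_val pure).
  rewrite YE mulmx_sumr mulmx_suml; apply: eq_bigr => i _.
  by rewrite -scalemxAr -scalemxAl -!map_mxM gb.
Qed.
End HodgeLie.

(** * Isogenies and lattices *)

Section Cosets.
Variable n : nat.
Implicit Types X Y : set 'cV[rat]_n.

(** Translation by [y] permutes the [N] cosets. Summing over representatives, these cancel modulo
    [X] and [N y] remains. *)
Lemma coset_exponent X Y N y : subgroup_set X -> X 0 -> subgroup_set Y -> Y 0 ->
  (cosets Y X #= `I_N)%card -> Y y -> X (N%:R *: y).
Proof.
move=> subX X0 subY Y0 /card_esym/card_set_bijP[f [fcos finj fsurj]] Yy.
have cosE u v : [set u + x | x in X] = [set v + x | x in X] -> X (u - v).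
  move=> e; have : [set u + x | x in X] u by exists 0; rewrite ?addr0.
  by rewrite e => -[x Xx <-]; rewrite addrAC subrr add0r.
have cosE' u v : X (u - v) -> [set u + x | x in X] = [set v + x | x in X].
  move=> Xuv; apply/seteqP; split=> z [x Xx <-].
    by exists (u - v + x); [exact: subgroupD | rewrite addrA [v + _]addrC subrK].
  exists (x - (u - v)); first exact: subX.
  by rewrite opprB addrCA [u + _]addrC subrK addrC.
have /choice[r hr] : forall i : 'I_N, exists r, Y r /\ f i = [set r + x | x in X].
  by move=> i; have [r Yr e] := fcos i (ltn_ord i); exists r.
have /choice[sg hsg] : forall i : 'I_N, exists j : 'I_N, f j = [set (r i + y) + x | x in X].
  move=> i; have /fsurj[j jN e] : cosets Y X [set (r i + y) + x | x in X].
    by exists (r i + y) => //; apply: subgroupD => //; exact: (hr i).1.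
  by exists (Ordinal jN).
have sg_inj : injective sg.
  move=> i j e; have := hsg j; rewrite -e hsg => /cosE.
  rewrite opprD addrACA subrr addr0 => /cosE'; rewrite -(hr i).2 -(hr j).2 => ef.
  by apply: val_inj; apply: finj; rewrite ?inE //; exact: ltn_ord.
have Xi i : X (r i + y - r (sg i)).
  by apply: cosE; rewrite -(hr (sg i)).2 -hsg.
have : X (\sum_(i < N) (r i + y - r (sg i))) by apply: subgroup_sum.
have eS : \sum_(i < N) r i = \sum_(i < N) r (sg i) by rewrite [LHS](reindex_inj sg_inj).
rewrite !big_split /= sumrN eS addrAC subrr add0r sumr_const card_ord.
by rewrite scaler_nat.
Qed.
End Cosets.

Section Integrality.
Variables (l : nat) (hl : prime l).
Local Notation Zl := (Zadic hl).
Local Notation Ql := (Qadic hl).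
Local Notation iZ := (@Zadic_to_Qadic l hl).
Local Notation iQ := (@rat_to_Qadic l hl).

(** The numerator of [q] over [l^k] equals [l^k z] in Z_l, so its residue modulo [l^k] is 0. *)
Lemma rat_l_integral (q : rat) k (z : Zl) :
  (l ^ k)%:R * q \is a Num.int -> iQ q = iZ z -> q \is a Num.int.
Proof.
move=> /intrP[m em] eq.
have /(congr1 (fun x : Zl => zres x k)) : (l ^ k)%:R * z = m%:~R.
  have e1 : iZ ((l ^ k)%:R * z) = (l ^ k)%:R * iZ z.
    by rewrite rmorphM; congr (_ * _); exact: (rmorph_nat iZ).
  have e2 : iZ m%:~R = m%:~R by exact: (rmorph_int iZ).
  apply: (@iZ_inj _ hl); rewrite e1 e2 -eq -(rmorph_int iQ) -em.
  by rewrite (rmorphM iQ) (rmorph_nat iQ).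
rewrite zres_mulpow // zres_int => /esym /dvdz_mod0P /dvdzP[p ep].
have lr : (l ^ k)%:R != 0 :> rat by rewrite pnatr_eq0 -lt0n expn_gt0 prime_gt0.
have -> : q = p%:~R.
  by apply: (mulfI lr); rewrite em ep intrM mulrC.
exact: intr_int.
Qed.

Lemma Zl_span_lattice n (b : 'M[rat]_n) (y : 'cV[Ql]_n) :
  Zl_span hl [set b *m map_mx intr x | x in [set: 'cV[int]_n]] y ->
  exists z : 'cV[Zl]_n, y = map_mx iQ b *m map_mx iZ z.
Proof.
case=> k [c [x [hx ->]]].
have /choice[u hu] : forall i, exists u : 'cV[int]_n, b *m map_mx intr u = x i.
  by move=> i; have [u _ e] := hx i; exists u.
exists (\sum_i c i *: map_mx intr (u i)).
rewrite map_mx_sum mulmx_sumr; apply: eq_bigr => i _.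
rewrite -hu map_mxZ map_mxM -scalemxAr; congr (_ *: (_ *m _)).
by rewrite -!map_mx_comp; apply/matrixP => a a'; rewrite !mxE /= !rmorph_int.
Qed.

Lemma Zl_span_mem m n (X : set 'M[rat]_(m, n)) x : X x -> Zl_span hl X (map_mx iQ x).
Proof.
move=> Xx; exists 1%N, (fun=> 1), (fun=> x); split=> //.
by rewrite big_ord1 rmorph1 scale1r.
Qed.

Lemma Zl_span_map m n p (X : set 'M[rat]_(n, p)) (X' : set 'M[rat]_(m, p)) (a : 'M[rat]_(m, n)) y :
  (forall x, X x -> X' (a *m x)) -> Zl_span hl X y -> Zl_span hl X' (map_mx iQ a *m y).
Proof.
move=> aX [k [c [x [hx ->]]]]; exists k, c, (fun i => a *m x i).
split=> [i|]; first exact: aX.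
by rewrite mulmx_sumr; apply: eq_bigr => i _; rewrite -scalemxAr map_mxM.
Qed.
End Integrality.

Lemma intmx_intr m n (A : 'M[rat]_(m, n)) : A \is a intmx ->
  exists B : 'M[int]_(m, n), A = map_mx intr B.
Proof.
move=> /mxOverP hA; exists (map_mx Num.floor A).
by apply/matrixP => i j; rewrite !mxE floorK.
Qed.

Lemma is_lattice_mem n (Lam : set 'cV[rat]_n) : is_lattice Lam ->
  exists2 b : 'M[rat]_n, b \in unitmx &
    Lam = [set b *m map_mx intr x | x in [set: 'cV[int]_n]] /\
    forall v, Lam v <-> invmx b *m v \is a intmx.
Proof.
case=> b [ub e]; exists b => //; split=> // v; rewrite e; split.
  case=> x _ <-; rewrite mulKmx //; apply/mxOverP => i j; rewrite mxE.
  exact: intr_int.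
by move=> /intmx_intr[x ex]; exists x => //; rewrite -ex mulKVmx.
Qed.

Section Colour.
Variables (n D : nat).
Hypothesis D_gt0 : (0 < D)%N.

(** Representatives of [D^-1 Z^n] modulo [D Z^n]. A sandwiched lattice contains the latter and lies
    in the former, so it is determined by the representatives that it contains. *)
Definition residue_vec (v : {ffun 'I_n -> 'I_(D * D)}) : 'rV[rat]_n :=
  \row_j ((v j)%:R / D%:R).

Definition colour (L : set 'rV[rat]_n) : {set {ffun 'I_n -> 'I_(D * D)}} :=
  [set v | `[< L (residue_vec v) >]].

Lemma colour_sub (L L' : set 'rV[rat]_n) : subgroup_set L -> subgroup_set L' ->
  sandwiched D L -> sandwiched D L' -> colour L = colour L' -> L `<=` L'.
Proof.
move=> subL subL' sL sL' e x Lx.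
have Dr : (D%:R : rat) != 0 by rewrite pnatr_eq0 -lt0n.
have DD : (Posz (D * D)) != 0 by rewrite eqz_nat -lt0n muln_gt0 D_gt0.
have /mxOverP hx := sL.2 _ Lx.
have /choice[m hm] : forall j, exists m : int, D%:R * x 0 j = m%:~R.
  by move=> j; have := hx 0 j; rewrite mxE => /intrP.
have mlt j : (absz (m j %% (D * D)%N)%Z < D * D)%N.
  by rewrite -ltz_nat gez0_abs ?modz_ge0 // ltz_pmod // ltz_nat muln_gt0 D_gt0.
have ea j : (absz (m j %% (D * D)%N)%Z)%:R = (m j %% (D * D)%N)%Z%:~R :> rat.
  by rewrite pmulrn gez0_abs ?modz_ge0.
pose v : {ffun 'I_n -> 'I_(D * D)} := [ffun j => Ordinal (mlt j)].
pose q : 'rV[rat]_n := \row_j ((m j %/ (D * D)%N)%Z)%:~R.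
have hq : q \is a intmx by apply/mxOverP => i j; rewrite mxE intr_int.
have ex : x = D%:R *: q + residue_vec v.
  apply/rowP => j; rewrite !mxE ffunE /=; apply: (mulfI Dr); rewrite hm.
  rewrite {1}(divz_eq (m j) (D * D)%N) intrD intrM.
  rewrite mulrDr mulrA [in RHS]mulrC [D%:R * (_ / _)]mulrC mulfVK // -natrM.
  by rewrite ea mulrC.
have Lv : L (residue_vec v).
  have -> : residue_vec v = x - D%:R *: q by rewrite ex addrAC subrr add0r.
  by apply: subL => //; apply: sL.1.
have : v \in colour L' by rewrite -e inE; apply/asboolP.
rewrite inE => /asboolP L'v; rewrite ex.
apply: subgroupD => //; [exact: sandwiched0 sL' | exact: sL'.1].
Qed.
End Colour.

Lemma map_invmx_l (F : fieldType) (phi : {rmorphism rat -> F}) n (a : 'M[rat]_n) :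
  a \in unitmx -> map_mx phi (invmx a) *m map_mx phi a = 1%:M.
Proof. by move=> ua; rewrite -map_mxM mulVmx // map_mx1. Qed.

Section Assembly.
Variables (R : realType) (L E : fieldType) (iota : {rmorphism L -> E}).
Variables (l : nat) (hl : prime l) (n : nat).
Local Notation structure := (infl_structure R iota hl n).
Local Notation iZ := (@Zadic_to_Qadic l hl).
Local Notation iQ := (@rat_to_Qadic l hl).
Implicit Types (V W T : structure) (a g h : 'M[rat]_n).

Definition hodge_commutes V g : Prop :=
  forall (A : comUnitAlgType R) (z : A * A), S_points z ->
  map_mx (@rat_in_alg R A) g *m S_val (hdg V) z =
  S_val (hdg V) z *m map_mx (@rat_in_alg R A) g.

(** A multiple of [g] preserves the lattice, so it is an endomorphism of the integral Hodge
    structure, and [end_sub] makes it commute with Galois. *)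
Lemma hodge_commutes_galrep V g : hodge_commutes V g ->
  forall sigma, map_mx iQ g *m galrep V sigma = galrep V sigma *m map_mx iQ g.
Proof.
move=> hg sigma; have [b ub [_ latE]] := is_lattice_mem (latP V).
have [N N0 hN] := common_denominator (invmx b *m g *m b).
have mor : hodge_mor (lat V) (hdg V) (lat V) (hdg V) (N%:R *: g).
  split=> [x /latE hx|A z Sz].
    apply/latE.
    have -> : invmx b *m (N%:R *: g *m x) =
        (N%:R *: (invmx b *m g *m b)) *m (invmx b *m x).
      by rewrite -!scalemxAl -scalemxAr !mulmxA mulmxK.
    exact: intmxM.
  have := hg A z Sz; move: (S_val _ z) => S e.
  by rewrite map_mxZ -scalemxAl -scalemxAr; congr (_ *: _).
have [_ /(_ sigma)] := end_sub (Zl_span_mem hl mor).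
have Nr : (N%:R : Qadic hl) != 0.
  by rewrite -(rmorph_nat iQ) fmorph_eq0 pnatr_eq0 -lt0n.
rewrite map_mxZ rmorph_nat -scalemxAl -scalemxAr.
exact: scalerI.
Qed.

(** Isogenies identify the Hodge and Galois structures rationally, so [W] and [W'] differ only in
    their lattices pulled back to [V]; [g] matches these and commutes with both structures. *)
Lemma isogeny_factor V W W' a a' g : isogeny V W a -> isogeny V W' a' ->
  g \in unitmx -> hodge_commutes V g ->
  (forall v, lat W (a *m v) <-> lat W' (a' *m (g *m v))) ->
  isomorphism W W' (a' *m g *m invmx a).
Proof.
move=> [ua [_ sa] [_ ra]] [ua' [_ sa'] [_ ra']] ug hg gE.
have gal := hodge_commutes_galrep hg.
set h := a' *m g *m invmx a.
have uh : h \in unitmx by rewrite /h !unitmx_mul ua' ug unitmx_inv ua.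
have hE v : lat W v <-> lat W' (h *m v).
  by rewrite -{1}[v](mulKVmx ua) gE /h -!mulmxA.
split; last first.
  apply/seteqP; split=> [_ [v /hE hv <-] //|v hv].
  by exists (invmx h *m v); [apply/hE; rewrite mulKVmx | rewrite mulKVmx].
split=> //.
- split=> [v /hE //|A z Sz].
  rewrite /h !map_mxM.
  have e : map_mx (@rat_in_alg R A) (invmx a) *m S_val (hdg W) z =
      S_val (hdg V) z *m map_mx (@rat_in_alg R A) (invmx a).
    have av : map_mx (@rat_in_alg R A) a *m map_mx (@rat_in_alg R A) (invmx a) = 1%:M.
      by rewrite -map_mxM mulmxV // map_mx1.
    have va : map_mx (@rat_in_alg R A) (invmx a) *m map_mx (@rat_in_alg R A) a = 1%:M.
      by rewrite -map_mxM mulVmx // map_mx1.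
    rewrite -[S_val (hdg W) z]mulmx1 -av !mulmxA -[_ *m S_val (hdg W) z *m _]mulmxA.
    by rewrite -sa // mulmxA va mul1mx.
  by rewrite -mulmxA e mulmxA -[_ *m _ *m S_val (hdg V) z]mulmxA hg // !mulmxA sa'.
- split=> [x hx|sigma]; first by apply: Zl_span_map hx => v /hE.
  rewrite /h !map_mxM.
  have e : map_mx iQ (invmx a) *m galrep W sigma = galrep V sigma *m map_mx iQ (invmx a).
    have av : map_mx iQ a *m map_mx iQ (invmx a) = 1%:M.
      by rewrite -map_mxM mulmxV // map_mx1.
    have va := map_invmx_l iQ ua.
    rewrite -[galrep W sigma]mulmx1 -av !mulmxA -[_ *m galrep W sigma *m _]mulmxA.
    by rewrite -ra mulmxA va mul1mx.
  by rewrite -mulmxA e mulmxA -[_ *m _ *m galrep V sigma]mulmxA gal !mulmxA ra'.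
Qed.

(** [h] maps the cosets in [lat T] bijectively onto those in [lat W], so the index is unchanged. *)
Lemma l_isogeny_comp V T W a h : l_isogeny V T a -> isomorphism T W h ->
  l_isogeny V W (h *m a).
Proof.
move=> [[ua [la sa] [ra1 ra2]] [k ck]] [[uh [lh sh] [rh1 rh2]] eh]; split.
  split; first by rewrite unitmx_mul uh.
  - split=> [x /la /lh|A z Sz]; first by rewrite mulmxA.
    by rewrite map_mxM -mulmxA sa // mulmxA sh // mulmxA.
  - split=> [x /ra1 /rh1|sigma]; first by rewrite map_mxM mulmxA.
    by rewrite map_mxM -mulmxA ra2 mulmxA rh2 mulmxA.
exists k; apply: card_eq_trans ck.
have -> : cosets (lat W) (mulmx (h *m a) @` lat V) =
    (fun c => mulmx h @` c) @` cosets (lat T) (mulmx a @` lat V).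
  have im y : [set h *m y + x | x in mulmx (h *m a) @` lat V] =
      mulmx h @` [set y + x | x in mulmx a @` lat V].
    apply/seteqP; split=> z.
      case=> _ [v Vv <-] <-; exists (y + a *m v); first by exists (a *m v) => //; exists v.
      by rewrite mulmxDr mulmxA.
    case=> _ [_ [v Vv <-] <-] <-; exists (h *m a *m v); first by exists v.
    by rewrite mulmxDr mulmxA.
  apply/seteqP; split=> c.
    case=> y; rewrite -eh => -[u Tu <-] <-; rewrite im.
    by exists [set u + x | x in mulmx a @` lat V] => //; exists u.
  case=> _ [u Tu <-] <-; rewrite -im; exists (h *m u) => //.
  by rewrite -eh; exists u.
apply: inj_card_eq => c c' _ _ e; apply/seteqP; split=> x cx.
  have : (mulmx h @` c) (h *m x) by exists x.
  by rewrite e => -[x' cx' /(can_inj (mulKmx uh)) <-].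
have : (mulmx h @` c') (h *m x) by exists x.
by rewrite -e => -[x' cx' /(can_inj (mulKmx uh)) <-].
Qed.

Lemma l_isogeny_refl V : l_isogeny V V 1%:M.
Proof.
split.
  split; first exact: unitmx1.
  - split=> [x|A z Sz]; first by rewrite mul1mx.
    by rewrite map_mx1 mul1mx mulmx1.
  - split=> [x|sigma]; first by rewrite map_mx1 mul1mx.
    by rewrite map_mx1 mul1mx mulmx1.
exists 0%N; rewrite expn0 II1.
have -> : cosets (lat V) (mulmx 1%:M @` lat V) = [set lat V].
  have subV : subgroup_set (lat V).
    have [b ub [_ latE]] := is_lattice_mem (latP V).
    by move=> x y /latE hx /latE hy; apply/latE; rewrite mulmxBr; apply: intmxB.
  have e1 : mulmx 1%:M @` lat V = lat V.
    by apply/seteqP; split=> x; [case=> y Vy <-; rewrite mul1mx | exists x; rewrite ?mul1mx].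
  have L0 : lat V 0.
    have [b ub [_ latE]] := is_lattice_mem (latP V).
    by apply/latE; rewrite mulmx0; apply: mxOver0; exact: rpred0.
  rewrite e1; apply/seteqP; split=> c.
    case=> y Vy <-; apply/seteqP; split=> z; first by case=> x Vx <-; apply: subgroupD.
    by move=> Vz; exists (z - y); [apply: subV | rewrite addrC subrK].
  move=> ->; exists 0 => //; apply/seteqP; split=> z; first by case=> x Vx <-; rewrite add0r.
  by exists z => //; rewrite add0r.
exact: eq_card1.
Qed.

(** Transposed because the lattice theorem works with row vectors acted on from the right. *)
Definition pullback W a : set 'rV[rat]_n := [set y | lat W (a *m y^T)].

Lemma pullback_lattice W a : a \in unitmx -> lattice (pullback W a).
Proof.
move=> ua; have [b ub [_ latE]] := is_lattice_mem (latP W).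
pose t := (invmx b *m a)^T.
have ut : t \in unitmx by rewrite unitmx_tr unitmx_mul unitmx_inv ub.
have -> : pullback W a = [set y | (y *m t) \is a intmx].
  apply/seteqP; split=> y /=.
    move=> /latE; rewrite mulmxA => /mxOverP h; apply/mxOverP => i j.
    by rewrite -[y]trmxK -trmx_mul mxE.
  move=> /mxOverP h; apply/latE; rewrite mulmxA; apply/mxOverP => i j.
  by have := h j i; rewrite -[y in y *m t]trmxK -trmx_mul mxE.
apply: (@lattice_preim _ _ [set y | y \is a intmx] t (invmx t)); first exact: mulmxV.
split; first by move=> x y; exact: intmxB.
by exists 1%N => //; split=> x /= hx; rewrite scale1r.
Qed.

(* Away from [l], [lat W] agrees with [a (lat V)], which [B] preserves; at [l]
   the lattice is stable under the Galois image, whose span contains [B]. *)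
Lemma pullback_stable V W a (B : 'M[rat]_n) k (c : 'I_k -> Zadic hl) (sg : 'I_k -> Defs.Gal iota) :
  l_isogeny V W a -> (forall x, lat V x -> lat V (B *m x)) ->
  map_mx iQ B = \sum_(i < k) iZ (c i) *: galrep V (sg i) ->
  forall v, lat W (a *m v) -> lat W (a *m (B *m v)).
Proof.
move=> [[ua [la sa] [ra1 ra2]] [e ce]] BV eB v Wv.
have [b ub [latWE latE]] := is_lattice_mem (latP W).
have subW : subgroup_set (lat W).
  by move=> x y /latE hx /latE hy; apply/latE; rewrite mulmxBr; apply: intmxB.
have W0 : lat W 0 by apply/latE; rewrite mulmx0; apply: mxOver0; exact: rpred0.
have [bV ubV [_ latVE]] := is_lattice_mem (latP V).
have subaV : subgroup_set (mulmx a @` lat V).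
  move=> _ _ [x Vx <-] [y Vy <-]; exists (x - y); last by rewrite mulmxBr.
  by move: Vx Vy => /latVE hx /latVE hy; apply/latVE; rewrite mulmxBr; apply: intmxB.
have aV0 : (mulmx a @` lat V) 0.
  by exists 0; [apply/latVE; rewrite mulmx0; apply: mxOver0; exact: rpred0 | rewrite mulmx0].
(* Away from [l]: the index is [l^e], so [l^e v] lies in [lat V]. *)
have [u Vu eu] := coset_exponent subaV aV0 subW W0 ce Wv.
have euv : u = (l ^ e)%:R *: v.
  by apply: (can_inj (mulKmx ua)); rewrite eu scalemxAr.
have far : lat W ((l ^ e)%:R *: (a *m (B *m v))).
  by rewrite 2!scalemxAr -euv; apply: la; apply: BV.
(* At [l]: [a] intertwines the Galois actions, so [a B v] is a Z_l-combination of Galois translates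
   of [a v], which stay in the Z_l-span of [lat W]. *)
have near : exists z : 'cV[Zadic hl]_n,
    map_mx iQ (a *m (B *m v)) = map_mx iQ b *m map_mx iZ z.
  have /choice[z hz] : forall i, exists z : 'cV[Zadic hl]_n,
      galrep W (sg i) *m map_mx iQ (a *m v) = map_mx iQ b *m map_mx iZ z.
    move=> i; apply: Zl_span_lattice; rewrite -latWE -(rho_stab (galP W) (sg i)).
    by exists (map_mx iQ (a *m v)) => //; exact: Zl_span_mem.
  exists (\sum_i c i *: z i).
  rewrite map_mx_sum mulmx_sumr !map_mxM eB mulmx_suml mulmx_sumr.
  apply: eq_bigr => i _; rewrite map_mxZ -scalemxAl -!scalemxAr -hz.
  by rewrite map_mxM !mulmxA ra2.
case: near => z hz; apply/latE/mxOverP => i j.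
apply: (@rat_l_integral _ hl _ e (z i j)).
  by have /latE := far; rewrite -scalemxAr => /mxOverP/(_ i j); rewrite mxE.
have /matrixP/(_ i j) := congr1 (mulmx (map_mx iQ (invmx b))) hz.
by rewrite [_ *m (map_mx iQ b *m _)]mulmxA (map_invmx_l iQ ub) mul1mx -map_mxM !mxE.
Qed.
End Assembly.

(** * Finiteness of the set of isomorphism classes *)

Theorem theorem5p5 (R : realType) (l : nat) (hl : prime l)
    (L : fieldExtType rat) (Lbar : closedFieldType)
    (iota : {rmorphism L -> Lbar}) (Lbar_alg : forall x, algebraicOver iota x)
    (n : nat) (V : infl_structure R iota hl n)
    (M : Qsubgroup n) (hM : is_Mumford_Tate (hdg V) M)
    (hU : adic_open_in (range (galrep V)) (gl_points M (@rat_to_Qadic l hl))) :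
  exists (m : nat) (T : 'I_m -> infl_structure R iota hl n),
    l_isogeny_class V = \bigcup_(i in [set: 'I_m]) isomorphism_class (T i).
Proof.
have [d [b [tb ssb cb]]] := hodge_lie (polP V) hM.1.
have [bV ubV [_ latVE]] := is_lattice_mem (latP V).
have U1 : range (galrep V) 1%:M by exists (Defs.gal_id iota) => //; exact: rho1 (galP V).
have spanb i : exists p : nat, (0 < p)%N /\ exists k (c : 'I_k -> Zadic hl) (sg : 'I_k -> Defs.Gal iota),
    p%:R *: map_mx (@rat_to_Qadic l hl) (b i) =
    \sum_(j < k) Zadic_to_Qadic (c j) *: galrep V (sg j).
  have [N N0 hN] := common_denominator (b i).
  have tN : tangent M (l%:R *: (N%:R *: b i)) by rewrite scalerA; exact: tb.
  have [e [k [c [u [hu eu]]]]] := lie_in_span hN tN hU U1.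
  have /choice[sg hsg] : forall j, exists sigma, galrep V sigma = u j.
    by move=> j; have [sigma _ h] := hu j; exists sigma.
  exists (l ^ e * N)%N; split; first by rewrite muln_gt0 N0 expn_gt0 prime_gt0.
  exists k, c, sg; rewrite natrM -scalerA.
  rewrite -(rmorph_nat (@rat_to_Qadic l hl) N) -map_mxZ eu.
  by apply: eq_bigr => j _; rewrite hsg.
have /choice[p hp] := spanb.
have /choice[p' hp'] : forall i, exists q : nat, (0 < q)%N /\
    q%:R *: (invmx bV *m b i *m bV) \is a intmx.
  by move=> i; have [q] := common_denominator (invmx bV *m b i *m bV); exists q.
(* [p i] brings the multiple of [b i] into the Z_l-span of the Galois image and [p' i] makes it
   preserve [lat V]; both depend on [V] only. *)
pose N := (\prod_i (p i * p' i))%N.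
have N_gt0 : (0 < N)%N.
  by apply/prodn_gt0 => i; rewrite muln_gt0 (hp i).1 (hp' i).1.
pose B i := N%:R *: b i.
have BV i x : lat V x -> lat V (B i *m x).
  move=> /latVE hx; apply/latVE.
  have -> : invmx bV *m (B i *m x) =
      (N%:R *: (invmx bV *m b i *m bV)) *m (invmx bV *m x).
    by rewrite /B -!scalemxAl -scalemxAr !mulmxA mulmxK.
  apply: intmxM => //; rewrite /N (bigD1 i) //= mulnC mulnA natrM -scalerA.
  by apply: intmx_natZ; exact: (hp' i).2.
have spanB i : exists k (c : 'I_k -> Zadic hl) (sg : 'I_k -> Defs.Gal iota),
    map_mx (@rat_to_Qadic l hl) (B i) =
    \sum_(j < k) Zadic_to_Qadic (c j) *: galrep V (sg j).
  have [_ [k [c [sg e]]]] := hp i.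
  exists k, (fun j => (p' i * \prod_(i' | i' != i) (p i' * p' i'))%:R * c j), sg.
  rewrite /B map_mxZ rmorph_nat /N (bigD1 i) //= [(p i * p' i)%N]mulnC mulnAC natrM.
  rewrite -scalerA e scaler_sumr; apply: eq_bigr => j _.
  rewrite scalerA; congr (_ *: _); rewrite [RHS]rmorphM; congr (_ * _).
  exact/esym/(rmorph_nat (@Zadic_to_Qadic l hl)).
have [D D_gt0 hD] := jordan_zassenhaus (ssb N N_gt0).
pose F := {set {ffun 'I_n -> 'I_(D * D)}}.
pose has_colour (c : F) W := exists a t, [/\ l_isogeny V W a, t \in unitmx,
  commutes (fun i => N%:R *: (b i)^T) t,
  sandwiched D [set x | pullback W a (x *m t)] &
  colour D [set x | pullback W a (x *m t)] = c].
have coloured W a : l_isogeny V W a -> exists c, has_colour c W.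
  move=> isoa; have st : stable (fun i => N%:R *: (b i)^T) (pullback W a).
    move=> i x Wx; have [k [c [sg eB]]] := spanB i.
    have := pullback_stable isoa (BV i) eB Wx.
    by rewrite /pullback /= trmx_mul linearZ /= trmxK.
  have ua : a \in unitmx by case: isoa => -[].
  have [t [ut ct sD]] := hD _ (pullback_lattice W ua) st.
  by eexists; exists a, t; split.
have same c W W' : has_colour c W -> has_colour c W' -> exists h, isomorphism W W' h.
  case=> a [t [isoa ut ct sD cc]] [a' [t' [isoa' ut' ct' sD' cc']]].
  have ua : a \in unitmx by case: isoa => -[].
  have ua' : a' \in unitmx by case: isoa' => -[].
  have subS := @subgroup_preim _ _ _ t (pullback_lattice W ua).1.
  have subS' := @subgroup_preim _ _ _ t' (pullback_lattice W' ua').1.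
  have ecc : colour D [set x | pullback W a (x *m t)] =
      colour D [set x | pullback W' a' (x *m t')] by rewrite cc cc'.
  have SS' := colour_sub D_gt0 subS subS' sD sD' ecc.
  have S'S := colour_sub D_gt0 subS' subS sD' sD (esym ecc).
  (* Equal colours mean that the pullbacks normalised by [t] and [t'] coincide, so [t^-1 t'] carries
     one pullback to the other; the transpose turns it into an action on columns. *)
  pose g := (invmx t *m t')^T.
  have Nr : (N%:R : rat) != 0 by rewrite pnatr_eq0 -lt0n.
  have comm (u : 'M[rat]_n) i : commutes (fun i => N%:R *: (b i)^T) u ->
      u *m (b i)^T = (b i)^T *m u.
    by move=> /(_ i); rewrite -scalemxAr -scalemxAl => /(scalerI Nr).
  have gb i : g *m b i = b i *m g.
    apply: trmx_inj; rewrite !trmx_mul trmxK mulmxA.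
    have -> : (b i)^T *m invmx t = invmx t *m (b i)^T.
      by rewrite -[LHS](mulKmx ut) [t *m (_ *m _)]mulmxA (comm _ _ ct) mulmxK.
    by rewrite -!mulmxA (comm _ _ ct').
  exists (a' *m g *m invmx a); apply: (isogeny_factor isoa.1 isoa'.1).
  - by rewrite unitmx_tr unitmx_mul unitmx_inv ut.
  - by move=> A z _; exact: cb gb A z.
  - move=> v.
    have eW : lat W (a *m v) = pullback W a (v^T *m invmx t *m t).
      by rewrite /pullback /= mulmxKV // trmxK.
    have eW' : lat W' (a' *m (g *m v)) = pullback W' a' (v^T *m invmx t *m t').
      by rewrite /pullback /= -mulmxA trmx_mul trmxK.
    by rewrite eW eW'; split; [exact: SS' | exact: S'S].
(* For a colour that does not occur [V] serves as default: it belongs to its own [l]-isogeny class,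
   so its isomorphism class adds nothing outside it. *)
have /choice[T hT] : forall c : F, exists T, (exists a, l_isogeny V T a) /\
    ((exists W, has_colour c W) -> has_colour c T).
  move=> c; case: (pselect (exists W, has_colour c W)) => [[W hW]|no].
    exists W; split=> //.
    by have [a [t [isoa _ _ _ _]]] := hW; exists a.
  exists V; split=> //; exists 1%:M; exact: l_isogeny_refl.
exists #|F|, (fun i => T (enum_val i)); apply/seteqP; split=> W.
  case=> a isoa; have [c hc] := coloured W a isoa.
  exists (enum_rank c) => //; rewrite enum_rankK.
  have hTc : has_colour c (T c) by apply: (hT c).2; exists W.
  exact: same hTc hc.
case=> i _ [h isoh]; have [[a isoa] _] := hT (enum_val i).
by exists (h *m a); exact: l_isogeny_comp isoa isoh.
Qed.
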